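(* For every $d\geq 2$ and every $m\geq 1$ there exist a smooth rational real quasi-projective variety $X$ of dimension $d$ and a relative real form $h\colon\mathcal{X}\to\mathbb{A}^m_{\mathbb{R}}$ of $X$ whose fibres over $\mathbb{R}$-rational points of $\mathbb{A}^m_{\mathbb{R}}$ are pairwise non-isomorphic real forms of $X$ (fibres over distinct $\mathbb{R}$-rational points are non-isomorphic as $\mathbb{R}$-schemes), all birationally diffeomorphic to $\mathbb{A}^d_{\mathbb{R}}$.
   Context: A subscript $\mathbb{C}$ denotes base change from $\mathbb{R}$ to $\mathbb{C}$. A relative real form of an $\mathbb{R}$-scheme $X$ over an $\mathbb{R}$-scheme $S$ is a morphism of $\mathbb{R}$-schemes $f\colon\mathcal{X}\to S$ together with an isomorphism of $S_{\mathbb{C}}$-schemes $\theta\colon\mathcal{X}_{\mathbb{C}}\to S_{\mathbb{C}}\times_{\mathbb{C}}X_{\mathbb{C}}$. A real form of $X$ is an $\mathbb{R}$-scheme whose complexification is isomorphic to $X_{\mathbb{C}}$. A birational diffeomorphism between two smooth real algebraic varieties $X$ and $X'$ with non-empty real loci is a birational map $f\colon X\dashrightarrow X'$ such that $f$ and $f^{-1}$ are defined at every $\mathbb{R}$-rational point of $X$ and $X'$ respectively (it then induces a diffeomorphism $X(\mathbb{R})\to X'(\mathbb{R})$). *)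

(* Defs.v *)
(* MathComp world; only the type of real numbers and the notations for
   classical sets come from MathComp-Analysis. *)
From HB Require Import structures.
From mathcomp Require Import all_boot all_order all_algebra.
From mathcomp Require Import complex mpoly.
From mathcomp Require Import classical_sets reals.
Set Implicit Arguments.
Unset Strict Implicit.
Unset Printing Implicit Defensive.
Import GRing.Theory.
Local Open Scope ring_scope.
Local Open Scope classical_set_scope.

(* Quasi-projective varieties over a field k, in the language of varieties
   defined over k.  Here iota : k -> C embeds k in an algebraically closed
   field C of characteristic 0.  A reduced quasi-projective k-scheme embedded in
   projective space is given by its set of C-points, a subset of P(C^N) which is
   locally closed for the topology whose closed sets are the zero loci of
   homogeneous polynomials with coefficients in k; its k-morphisms are the maps
   on C-points locally given by homogeneous polynomials with coefficients in k.
   In this language base change from k to C leaves sets and maps unchanged and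
   replaces iota by the identity of C. *)

(* P(C^N), the projective space of dimension N - 1: lines through 0 in C^N. *)
Definition pt (C : fieldType) (N : nat) :=
  {L : {vspace 'rV[C]_N} | \dim L == 1%N}.

(* v is a vector of homogeneous coordinates of p; in particular v != 0. *)
Definition coords (C : fieldType) (N : nat) (p : pt C N) (v : 'rV[C]_N) : Prop :=
  val p = <[v]>%VS.

Section Geometry.
Variables (k C : fieldType) (iota : {rmorphism k -> C}).

Definition evalp (N : nat) (F : {mpoly k[N]}) (v : 'rV[C]_N) : C :=
  (map_mpoly iota F).@[v 0].

Definition vanishes (N : nat) (F : {mpoly k[N]}) (p : pt C N) : Prop :=
  forall v, coords p v -> evalp F v = 0.

Definition homogeneous (N : nat) (F : {mpoly k[N]}) : Prop :=
  exists e : nat, F \is e.-homog.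

Definition zclosed (N : nat) (Z : set (pt C N)) : Prop :=
  exists2 S : set {mpoly k[N]}, (forall F, S F -> homogeneous F) &
    Z = [set p | forall F, S F -> vanishes F p].

Definition quasi_projective (N : nat) (X : set (pt C N)) : Prop :=
  exists Z W, [/\ zclosed Z, zclosed W & X = Z `\` W].

Definition dense_open (N : nat) (X U : set (pt C N)) : Prop :=
  (exists2 Z, zclosed Z & U = X `\` Z) /\
  (forall Z, zclosed Z -> U `<=` Z -> X `<=` Z).

Definition zirreducible (N : nat) (X : set (pt C N)) : Prop :=
  X !=set0 /\
  forall Z1 Z2, zclosed Z1 -> zclosed Z2 -> X `<=` Z1 `|` Z2 ->
    X `<=` Z1 \/ X `<=` Z2.

(* Values of f outside X are irrelevant. *)
Definition var_morphism (N M : nat) (X : set (pt C N)) (Y : set (pt C M))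
    (f : pt C N -> pt C M) : Prop :=
  (forall p, X p -> Y (f p)) /\
  forall p, X p ->
    exists (e : nat) (F : 'I_M -> {mpoly k[N]}),
    [/\ forall i, F i \is e.-homog,
        forall v, coords p v -> \row_i evalp (F i) v != 0 &
        forall q v, X q -> coords q v -> \row_i evalp (F i) v != 0 ->
          coords (f q) (\row_i evalp (F i) v)].

Definition isomorphism (N M : nat) (X : set (pt C N)) (Y : set (pt C M))
    (f : pt C N -> pt C M) : Prop :=
  exists g, [/\ var_morphism X Y f, var_morphism Y X g,
    forall p, X p -> g (f p) = p & forall q, Y q -> f (g q) = q].

Definition isomorphic (N M : nat) (X : set (pt C N)) (Y : set (pt C M)) : Prop :=
  exists f, isomorphism X Y f.

Definition rational_points (N : nat) (X : set (pt C N)) : set (pt C N) :=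
  [set p | X p /\ exists v : 'rV[k]_N, coords p (map_mx iota v)].

(* (U, f) and (V, g) represent mutually inverse rational maps X --> Y and
   Y --> X, defined on U and on V respectively. *)
Definition inverse_rational_maps (N M : nat)
    (X : set (pt C N)) (Y : set (pt C M))
    (U : set (pt C N)) (f : pt C N -> pt C M)
    (V : set (pt C M)) (g : pt C M -> pt C N) : Prop :=
  [/\ dense_open X U /\ var_morphism U Y f,
      dense_open Y V /\ var_morphism V X g,
      exists2 U', dense_open X U' &
        forall p, U' p -> [/\ U p, V (f p) & g (f p) = p] &
      exists2 V', dense_open Y V' &
        forall q, V' q -> [/\ V q, U (g q) & f (g q) = q]].

Definition birational (N M : nat) (X : set (pt C N)) (Y : set (pt C M)) : Prop :=
  exists U f V g, inverse_rational_maps X Y U f V g.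

End Geometry.

(* Smoothness of relative dimension d at p by the Jacobian criterion: around p,
   X is the zero locus of r = (N - 1) - d homogeneous polynomials whose Jacobian
   matrix has rank r at p (the scheme they define is then reduced near p). *)
Definition smooth_at (C : fieldType) (N d : nat) (X : set (pt C N))
    (p : pt C N) : Prop :=
  exists (r : nat) (F : 'I_r -> {mpoly C[N]}) (W : set (pt C N)),
  [/\ N = (r + d).+1 /\ (forall i, homogeneous (F i)),
      zclosed idfun W /\ ~ W p,
      X `\` W = [set q | forall i, vanishes idfun (F i) q] `\` W &
      forall v, coords p v ->
        row_free (\matrix_(i < r, j < N) evalp idfun (mderiv j (F i)) v)].

Definition smooth_of_dim (C : fieldType) (N d : nat) (X : set (pt C N)) : Prop :=
  forall p, X p -> smooth_at d X p.

Definition smooth (C : fieldType) (N : nat) (X : set (pt C N)) : Prop :=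
  forall p, X p -> exists d, smooth_at d X p.

(* A^m, as the complement of the hyperplane x_0 = 0 in P^m. *)
Definition affine_space (C : fieldType) (m : nat) : set (pt C (1 + m)) :=
  [set p | exists a : 'rV[C]_m, coords p (row_mx 1%:M a)].
Arguments affine_space : clear implicits.

(* r is the image of (p, q) under the Segre embedding
   P(C^N) x P(C^M) -> P(C^N (x) C^M). *)
Definition segre (C : fieldType) (N M : nat)
    (p : pt C N) (q : pt C M) (r : pt C (N * M)) : Prop :=
  exists u v, [/\ coords p u, coords q v & coords r (mxvec (u^T *m v))].

Definition var_product (C : fieldType) (N M : nat)
    (X : set (pt C N)) (Y : set (pt C M)) : set (pt C (N * M)) :=
  [set r | exists p q, [/\ X p, Y q & segre p q r]].

Section Real.
Variable R : realType.
Local Notation C := R[i].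
Local Notation RtoC := (real_complex R : {rmorphism R -> C}).

(* Irreducibility is over C: real varieties are geometrically integral. *)
Definition real_variety (N : nat) (X : set (pt C N)) : Prop :=
  quasi_projective RtoC X /\ zirreducible idfun X.

Definition rational_of_dim (d N : nat) (X : set (pt C N)) : Prop :=
  birational RtoC X (affine_space C d).

Definition real_form (N M : nat) (X : set (pt C N)) (Y : set (pt C M)) : Prop :=
  quasi_projective RtoC Y /\ isomorphic idfun Y X.

(* The last condition says that theta is a morphism over S_C. *)
Definition relative_real_form (N M K : nat)
    (X : set (pt C N)) (S : set (pt C M)) (XX : set (pt C K))
    (h : pt C K -> pt C M) (theta : pt C K -> pt C (M * N)) : Prop :=
  [/\ quasi_projective RtoC XX,
      var_morphism RtoC XX S h,
      isomorphism idfun XX (var_product S X) theta &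
      forall z, XX z -> exists2 x, X x & segre (h z) x (theta z)].

(* For a relative real form of a variety X the scheme-theoretic fibre over a
   real point s is reduced, its complexification being isomorphic to that of X;
   so it is determined by this set of C-points. *)
Definition fibre (K M : nat) (XX : set (pt C K)) (h : pt C K -> pt C M)
    (s : pt C M) : set (pt C K) := [set z | XX z /\ h z = s].

Definition birationally_diffeomorphic (N M : nat)
    (X : set (pt C N)) (Y : set (pt C M)) : Prop :=
  [/\ [/\ real_variety X, smooth X & rational_points RtoC X !=set0],
      [/\ real_variety Y, smooth Y & rational_points RtoC Y !=set0] &
      exists U f V g,
        [/\ inverse_rational_maps RtoC X Y U f V g,
            rational_points RtoC X `<=` U &
            rational_points RtoC Y `<=` V]].

End Real.

(* Main.v *)
(** Let S be the real surface x^2 + y^2 = t z^2 in A^1 x P^2, where t is the coordinate of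
    A^1. With u = x + iy and v = x - iy it is u v = t z^2, and conjugation
    exchanges u and v. It has no real point with z = 0, and its chart z = 1 is
    the real plane. For s = (1, s_1, ..., s_m) remove from S the points
    z = (s_j + i) v, u = t (s_j + i) z of the conics over t = (j + 1) i, and their
    conjugates, and multiply by B^(d-2), where B is A^1 without the points i and -i.
    Nothing real has been removed, so the result X_s is birationally
    diffeomorphic to A^d.

    Over C, S has the automorphisms (u, v, z) |-> (u + 2 t f z + t f^2 v, v, z + f v)
    for f in C[t], and those with u and v exchanged. Choosing f by Lagrange interpolation
    one identifies X_s with X_s', algebraically in s and s'.

    Let f : X_s -> X_s' be a real isomorphism. A curve parametrized by A^1 has a
    polynomial lift to homogeneous coordinates without common zero. Such curves are
    constant in B, and the conics minus a point stay in the fibres of t, so f maps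
    t to a t + c with a, c real, on the slices b = 0 and b = beta. The section
    u = z = 0 and its conjugate v = z = 0 go to two disjoint conjugate sections, and a
    parity argument puts these in z = 0. So, up to exchanging u and v, in the
    coordinate w = z / v of the conics f is w |-> k w. On the curves with w
    constant one sees that k is constant and c = 0, and conjugation gives
    a |k|^2 = 1. Finally f extends to no removed point, so it permutes those: first
    a = 1 from the values of t, then k = 1 from s_0 = s'_0 = 1, and then s = s'. *)

Require Import Defs.
From mathcomp Require Import all_boot all_order all_algebra.
From mathcomp Require Import complex mpoly.
From mathcomp Require Import boolp classical_sets reals.
From mathcomp Require Import ring zify.
Set Implicit Arguments.
Unset Strict Implicit.
Unset Printing Implicit Defensive.
Import Order.TTheory GRing.Theory Num.Theory.
Local Open Scope ring_scope.
Local Open Scope classical_set_scope.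

(** * Morphisms and polynomial curves in projective space *)

(** No compactification and no group of birational maps is used: rigidity rests on curves
    parametrized by the affine line, whose polynomial lifts turn nowhere vanishing functions into
    constants. This dictates the choices. The sections w = 0 must be whole affine lines inside every
    slice, so the removed points have w = s_j + i or s_j - i, never 0 for real s. The factor B
    raises the dimension without harm: b + i is a nowhere vanishing function on it, so it receives
    no nonconstant affine line, while its real locus is all of R. The removed points lie over
    nonreal t, hence no real point is lost, and over purely imaginary t, so that a positive dilation
    of t permuting them is the identity. The value s_0 = 1 has two roles: it is the homogeneous
    coordinate that makes s a point of A^m, and it is the reference that pins k. Its point w = 1 + i
    also excludes the exchange of u and v, since (1 + i)^2 has modulus 2 and not 1. A nontrivial
    shear fixes one of the two conjugate sections and moves the other, so it is not real; parity is
    the device that controls arbitrary real isomorphisms in place of a structure theorem. *)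

Section Coordinates.
Variable C : fieldType.

Lemma coords_neq0 N (p : pt C N) v : coords p v -> v != 0.
Proof.
rewrite /coords => e; have /eqP := valP p; rewrite e.
by apply: contra_eq_neq => ->; rewrite dim_vline eqxx.
Qed.

Lemma coords_ex N (p : pt C N) : exists v, coords p v.
Proof.
exists (vpick (val p)); rewrite /coords; apply/eqP; rewrite eq_sym eqEdim.
rewrite -memvE memv_pick /=.
have /eqP d1 := valP p; rewrite d1 dim_vline lt0b.
by rewrite vpick0 -dimv_eq0 d1.
Qed.

Lemma coordsZ N (p : pt C N) v a : a != 0 -> coords p v -> coords p (a *: v).
Proof.
move=> a0 pv; rewrite /coords pv; apply/eqP; rewrite eqEdim.
have v0 := coords_neq0 pv.
rewrite !dim_vline scaler_eq0 negb_or a0 v0 leqnn andbT -memvE.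
by apply/vlineP; exists a^-1; rewrite scalerA mulVf // scale1r.
Qed.

Lemma coords_prop N (p : pt C N) v w :
  coords p v -> coords p w -> exists2 a, a != 0 & w = a *: v.
Proof.
move=> pv pw; have w0 := coords_neq0 pw.
have : w \in <[v]>%VS by rewrite -pv pw memv_line.
case/vlineP => a wE; exists a => //.
by apply: contraNneq w0 => a0; rewrite wE a0 scale0r.
Qed.

Lemma coords_inj N (p q : pt C N) v : coords p v -> coords q v -> p = q.
Proof. by move=> pv qv; apply: val_inj; rewrite pv qv. Qed.

(** [q0] is the default of [insubd], taken only at the zero vector, which spans no point. *)
Definition pt_of N (q0 : pt C N) (v : 'rV[C]_N) : pt C N := insubd q0 <[v]>%VS.

Lemma coords_pt_of N (q0 : pt C N) v : v != 0 -> coords (pt_of q0 v) v.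
Proof. by move=> v0; rewrite /coords /pt_of val_insubd dim_vline v0. Qed.

Lemma pt_ex N (v : 'rV[C]_N) : v != 0 -> exists p : pt C N, coords p v.
Proof.
move=> v0; have h : \dim <[v]>%VS == 1%N by rewrite dim_vline v0.
by exists (exist _ <[v]>%VS h).
Qed.
End Coordinates.

(** * Polynomial functions, homogeneous functions and closed sets *)

Section Evaluation.
Variables (k C : fieldType) (iota : {rmorphism k -> C}).
Implicit Types (N : nat).

Lemma evalpE N (F : {mpoly k[N]}) v :
  evalp iota F v = \sum_(m <- msupp F) iota F@_m * \prod_i v 0 i ^+ m i.
Proof.
rewrite /evalp {1}(mpolyE F) (raddf_sum (map_mpoly iota)) raddf_sum /=; apply: eq_bigr => m _.
by rewrite map_mpolyZ map_mpolyX mevalZ mevalX.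
Qed.

Lemma evalpD N (F G : {mpoly k[N]}) v :
  evalp iota (F + G) v = evalp iota F v + evalp iota G v.
Proof. by rewrite /evalp !raddfD. Qed.

Lemma evalpN N (F : {mpoly k[N]}) v : evalp iota (- F) v = - evalp iota F v.
Proof. by rewrite /evalp !raddfN. Qed.

Lemma evalpB N (F G : {mpoly k[N]}) v :
  evalp iota (F - G) v = evalp iota F v - evalp iota G v.
Proof. by rewrite evalpD evalpN. Qed.

Lemma evalpM N (F G : {mpoly k[N]}) v :
  evalp iota (F * G) v = evalp iota F v * evalp iota G v.
Proof. by rewrite /evalp !rmorphM. Qed.

Lemma evalpC N (c : k) v : evalp iota (c%:MP : {mpoly k[N]}) v = iota c.
Proof. by rewrite /evalp map_mpolyC mevalC. Qed.

Lemma evalp1 N v : evalp iota (1 : {mpoly k[N]}) v = 1.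
Proof. by rewrite /evalp !rmorph1. Qed.

Lemma evalpX N (i : 'I_N) v : evalp iota 'X_i v = v 0 i.
Proof. by rewrite /evalp map_mpolyX mevalXU. Qed.

Lemma evalp_exp N (F : {mpoly k[N]}) n v :
  evalp iota (F ^+ n) v = evalp iota F v ^+ n.
Proof. by rewrite /evalp !rmorphXn. Qed.

Lemma evalpZ N c (F : {mpoly k[N]}) v :
  evalp iota (c *: F) v = iota c * evalp iota F v.
Proof. by rewrite -mul_mpolyC evalpM evalpC. Qed.

Lemma evalp_mon N (m : 'X_{1..N}) v :
  evalp iota 'X_[m] v = \prod_i v 0 i ^+ m i.
Proof. by rewrite /evalp map_mpolyX mevalX. Qed.

Lemma evalp_sum N (I : Type) (r : seq I) (F : I -> {mpoly k[N]}) v :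
  evalp iota (\sum_(i <- r) F i) v = \sum_(i <- r) evalp iota (F i) v.
Proof. by rewrite /evalp (raddf_sum (map_mpoly iota)) raddf_sum. Qed.

Lemma evalp_homog N e (F : {mpoly k[N]}) a v :
  F \is e.-homog -> evalp iota F (a *: v) = a ^+ e * evalp iota F v.
Proof.
move=> /dhomogP hF; rewrite !evalpE mulr_sumr; apply: eq_big_seq => m mF.
rewrite mulrCA; congr (_ * _).
under eq_bigr do rewrite mxE exprMn.
by rewrite big_split /= prodrXr -mdegE hF.
Qed.

(** Polynomiality is a property of a function, so that formulas remain equations between values,
    within reach of [ring], and explicit polynomials are rarely written. *)
Definition polyfun N (f : 'rV[C]_N -> C) :=
  exists P, forall v, f v = evalp iota P v.

Lemma polyfunX N (i : 'I_N) : polyfun (fun v => v 0 i).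
Proof. by exists 'X_i => v; rewrite evalpX. Qed.

Lemma polyfunC N c : polyfun (fun _ : 'rV[C]_N => iota c).
Proof. by exists c%:MP => v; rewrite evalpC. Qed.

Lemma polyfunD N (f g : 'rV[C]_N -> C) :
  polyfun f -> polyfun g -> polyfun (fun v => f v + g v).
Proof. by move=> [P hP] [Q hQ]; exists (P + Q) => v; rewrite evalpD hP hQ. Qed.

Lemma polyfunN N (f : 'rV[C]_N -> C) : polyfun f -> polyfun (fun v => - f v).
Proof. by move=> [P hP]; exists (- P) => v; rewrite evalpN hP. Qed.

Lemma polyfunM N (f g : 'rV[C]_N -> C) :
  polyfun f -> polyfun g -> polyfun (fun v => f v * g v).
Proof. by move=> [P hP] [Q hQ]; exists (P * Q) => v; rewrite evalpM hP hQ. Qed.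

Lemma polyfun_exp N (f : 'rV[C]_N -> C) n :
  polyfun f -> polyfun (fun v => f v ^+ n).
Proof. by move=> [P hP]; exists (P ^+ n) => v; rewrite evalp_exp hP. Qed.

Lemma polyfun_ext N (f g : 'rV[C]_N -> C) : f =1 g -> polyfun f -> polyfun g.
Proof. by move=> fg [P hP]; exists P => v; rewrite -fg. Qed.

Lemma polyfun0 N : polyfun (fun _ : 'rV[C]_N => 0).
Proof. by apply: polyfun_ext (polyfunC N 0) => v; rewrite rmorph0. Qed.

Lemma polyfun1 N : polyfun (fun _ : 'rV[C]_N => 1).
Proof. by apply: polyfun_ext (polyfunC N 1) => v; rewrite rmorph1. Qed.

Lemma polyfun_sum N (I : Type) (r : seq I) (f : I -> 'rV[C]_N -> C) :
  (forall i, polyfun (f i)) -> polyfun (fun v => \sum_(i <- r) f i v).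
Proof.
move=> h; elim: r => [|i r IH].
  by apply: polyfun_ext (polyfun0 N) => v; rewrite big_nil.
by apply: polyfun_ext (polyfunD (h i) IH) => v; rewrite big_cons.
Qed.

(** With [D] strictly above all degrees every monomial keeps a factor [v 0 i0]; both sides then
    vanish on [v 0 i0 = 0], and the formula holds without restriction. *)
Lemma homogenize N (i0 : 'I_N) (f : 'rV[C]_N -> C) : polyfun f ->
  exists D0 : nat, forall D, (D0 < D)%N -> exists2 H : {mpoly k[N]}, H \is D.-homog &
    forall v, evalp iota H v = v 0 i0 ^+ D * f ((v 0 i0)^-1 *: v).
Proof.
move=> [P hP]; exists (\max_(m <- msupp P) mdeg m)%N => D hD.
have le m : m \in msupp P -> (mdeg m < D)%N.
  move=> mP; apply: leq_ltn_trans hD.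
  by rewrite (big_rem m mP) /= leq_maxl.
exists (\sum_(m <- msupp P) P@_m *: ('X_[m] * 'X_i0 ^+ (D - mdeg m))).
  rewrite big_seq; apply: rpred_sum => m mP; apply: rpredZ.
  rewrite -(subnKC (ltnW (le m mP))) addKn; apply: dhomogM.
    by rewrite dhomogX.
  by rewrite -[X in X.-homog]mul1n; apply: dhomogMn; rewrite dhomogX /= mdeg1.
move=> v; rewrite hP [in RHS]evalpE evalp_sum mulr_sumr.
apply: eq_big_seq => m mP; rewrite evalpZ mulrCA; congr (_ * _).
rewrite evalpM evalp_exp evalpX evalp_mon.
under [in RHS]eq_bigr do rewrite mxE exprMn.
rewrite big_split /= prodrXr -mdegE mulrA [LHS]mulrC; congr (_ * _).
have [->|v0] := eqVneq (v 0 i0) 0.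
  rewrite !expr0n subn_eq0 leqNgt le //= gtn_eqF ?mul0r //.
  exact: leq_trans hD.
by rewrite exprVn expfB ?le.
Qed.

End Evaluation.

Section Closed.
Variables (k C : fieldType) (iota : {rmorphism k -> C}).
Implicit Types (N : nat).

Definition homfun N e (f : 'rV[C]_N -> C) :=
  exists2 P : {mpoly k[N]}, P \is e.-homog & forall v, f v = evalp iota P v.

Lemma homfunX N (i : 'I_N) : homfun 1 (fun v => v 0 i).
Proof.
by exists 'X_i; [rewrite dhomogX /= mdeg1 | move=> v; rewrite evalpX].
Qed.

Lemma homfunD N e (f g : 'rV[C]_N -> C) :
  homfun e f -> homfun e g -> homfun e (fun v => f v + g v).
Proof.
move=> [P hP fP] [Q hQ gQ].
by exists (P + Q); [apply: dhomogD | move=> v; rewrite evalpD fP gQ].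
Qed.

Lemma homfunZ N e c (f : 'rV[C]_N -> C) :
  homfun e f -> homfun e (fun v => iota c * f v).
Proof.
move=> [P hP fP].
by exists (c *: P); [apply: dhomogZ | move=> v; rewrite evalpZ fP].
Qed.

Lemma homfunB N e (f g : 'rV[C]_N -> C) :
  homfun e f -> homfun e g -> homfun e (fun v => f v - g v).
Proof.
move=> [P hP fP] [Q hQ gQ].
exists (P - Q); last by move=> v; rewrite evalpB fP gQ.
by apply: dhomogD => //; rewrite dhomogN.
Qed.

Lemma homfunM N e e' (f g : 'rV[C]_N -> C) :
  homfun e f -> homfun e' g -> homfun (e + e') (fun v => f v * g v).
Proof.
move=> [P hP fP] [Q hQ gQ].
by exists (P * Q); [apply: dhomogM | move=> v; rewrite evalpM fP gQ].
Qed.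

Lemma vanishes_at N (F : {mpoly k[N]}) (p : pt C N) v :
  homogeneous F -> coords p v -> evalp iota F v = 0 -> vanishes iota F p.
Proof.
move=> [e hF] pv F0 w pw; have [a a0 ->] := coords_prop pv pw.
by rewrite (evalp_homog _ _ _ hF) F0 mulr0.
Qed.

Lemma zclosed_homfun N (I : Type) (e : I -> nat) (f : I -> 'rV[C]_N -> C) :
  (forall i, homfun (e i) (f i)) ->
  zclosed iota [set p | forall i v, coords p v -> f i v = 0].
Proof.
move=> h; exists [set F | (exists e, F \is e.-homog) /\
   exists i, forall v, f i v = evalp iota F v].
  by move=> F [[d hF] _]; exists d.
apply/seteqP; split=> p /= hp.
  by move=> F [_ [i hi]] v pv; rewrite -hi; exact: hp.
move=> i v pv; have [P hP fP] := h i; rewrite fP; apply: hp => //.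
by split; [exists (e i) | exists i].
Qed.

Lemma zclosedT N : zclosed iota [set: pt C N].
Proof. by exists set0 => [F []|]; apply/seteqP; split=> p // _ F []. Qed.

Lemma zclosed0 N : zclosed iota (@set0 (pt C N)).
Proof.
exists [set 1] => [F ->|]; first by exists 0%N; rewrite dhomog1.
apply/seteqP; split=> p //= h; have [v pv] := coords_ex p.
by have /eqP := h _ erefl v pv; rewrite evalp1 oner_eq0.
Qed.

Lemma zclosed_bigI N (I : Type) (Z : I -> set (pt C N)) :
  (forall i, zclosed iota (Z i)) -> zclosed iota [set p | forall i, Z i p].
Proof.
move=> h; exists [set F | exists i, exists2 S : set {mpoly k[N]},
    (forall F, S F -> homogeneous F) /\
    Z i = [set p | forall F, S F -> vanishes iota F p] & S F].
  by move=> F [i [S [hS _] SF]]; exact: hS.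
apply/seteqP; split=> p /= hp.
  by move=> F [i [S [_ ZE] SF]]; have := hp i; rewrite ZE; exact.
move=> i; have [S hS ZE] := h i; rewrite ZE => F SF.
by apply: hp; exists i, S.
Qed.

Lemma zclosedI N (Z W : set (pt C N)) :
  zclosed iota Z -> zclosed iota W -> zclosed iota (Z `&` W).
Proof.
move=> hZ hW; have hb : forall b : bool, zclosed iota (if b then Z else W) by case.
have [S hS E] := zclosed_bigI hb; exists S => //; rewrite -E; apply/seteqP; split=> p /=.
  by case=> Zp Wp [].
by move=> h; split; [exact: (h true) | exact: (h false)].
Qed.

Lemma zclosedU N (Z W : set (pt C N)) :
  zclosed iota Z -> zclosed iota W -> zclosed iota (Z `|` W).
Proof.
move=> [S hS ->] [T hT ->].
exists [set H | exists F G, [/\ S F, T G & H = F * G]].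
  move=> H [F [G [/hS[e hF] /hT[e' hG] ->]]].
  by exists (e + e')%N; apply: dhomogM.
apply/seteqP; split=> p /=.
  by case=> hp H [F [G [SF TG ->]]] v pv; rewrite evalpM;
    [rewrite (hp F SF v pv) mul0r | rewrite (hp G TG v pv) mulr0].
move=> hp; have [|] := pselect (forall F, S F -> vanishes iota F p); first by left.
move=> /existsNP[F /not_implyP[SF]] nF; right=> G TG v pv.
have : evalp iota F v * evalp iota G v = 0.
  by rewrite -evalpM; apply: hp => //; exists F, G.
move=> /eqP; rewrite mulf_eq0 => /orP[/eqP F0|/eqP //].
by case: nF; apply: vanishes_at F0 => //; exact: hS.
Qed.

Lemma zclosed_bigU N (I : finType) (Z : I -> set (pt C N)) :
  (forall i, zclosed iota (Z i)) -> zclosed iota [set p | exists i, Z i p].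
Proof.
move=> h.
suff : forall s : seq I, zclosed iota [set p | exists2 i, i \in s & Z i p].
  move=> /(_ (enum I)); congr zclosed; apply/seteqP; split=> p /=.
    by case=> i _ Zp; exists i.
  by case=> i Zp; exists i => //; rewrite mem_enum.
elim=> [|i s IH].
  by have := zclosed0 N; congr zclosed; apply/seteqP; split=> p //= [].
have := zclosedU (h i) IH; congr zclosed; apply/seteqP; split=> p /=.
  by case=> [Zp|[j js Zp]]; [exists i; rewrite ?mem_head|exists j; rewrite // inE js orbT].
case=> j; rewrite inE => /orP[/eqP ->|js] Zp; [by left|by right; exists j].
Qed.

Lemma evalp_map N (F : {mpoly k[N]}) v :
  evalp idfun (map_mpoly iota F) v = evalp iota F v.
Proof.
rewrite /evalp; congr (_.@[_]); apply/mpolyP => m.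
by rewrite mcoeff_map_mpoly.
Qed.

Lemma map_mpoly_homog N e (F : {mpoly k[N]}) :
  F \is e.-homog -> map_mpoly iota F \is e.-homog.
Proof.
move=> /dhomogP hF; apply/dhomogP => m; rewrite mcoeff_msupp mcoeff_map_mpoly => h.
apply: hF; rewrite mcoeff_msupp; apply: contraNneq h => ->; apply/eqP.
exact: rmorph0.
Qed.

Lemma zclosed_base_change N (Z : set (pt C N)) :
  zclosed iota Z -> zclosed idfun Z.
Proof.
move=> [S hS ->]; exists [set map_mpoly iota F | F in S].
  by move=> _ [F /hS[e hF] <-]; exists e; apply: map_mpoly_homog.
apply/seteqP; split=> p /= hp.
  by move=> _ [F SF <-] v pv; rewrite evalp_map; apply: hp.
by move=> F SF v pv; rewrite -evalp_map; apply: hp => //; exists F.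
Qed.

Lemma quasi_projectiveI N (X Z : set (pt C N)) :
  quasi_projective iota X -> zclosed iota Z -> quasi_projective iota (X `&` Z).
Proof.
move=> [A [W [hA hW ->]]] hZ; exists (A `&` Z), W; split => //.
  exact: zclosedI.
by apply/seteqP; split=> p /= [[? ?] ?].
Qed.

(* A map given in a chart v_i0 = 1 by polynomials is given there by homogeneous
   polynomials; a spare factor v_i0 makes them vanish outside the chart. *)
Lemma var_morphism_chart N M (X : set (pt C N)) (Y : set (pt C M)) f :
  (forall p, X p -> Y (f p)) ->
  (forall p, X p -> exists (i0 : 'I_N) (G : 'I_M -> 'rV[C]_N -> C),
     [/\ forall i, polyfun iota (G i), forall v, coords p v -> v 0 i0 != 0 &
         forall q v, X q -> coords q v -> v 0 i0 = 1 ->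
           coords (f q) (\row_i G i v)]) ->
  var_morphism iota X Y f.
Proof.
move=> XY h; split=> // p Xp; have [i0 [G [hG pi0 hf]]] := h p Xp.
have /fin_all_exists[D0 hD0] i := homogenize i0 (hG i).
pose D := (\max_i D0 i).+1.
have /fin_all_exists2[H hH HE] i : exists2 H : {mpoly k[N]}, H \is D.-homog &
   forall v, evalp iota H v = v 0 i0 ^+ D * G i ((v 0 i0)^-1 *: v).
  by apply: hD0; rewrite ltnS leq_bigmax.
have rE v : \row_i evalp iota (H i) v = v 0 i0 ^+ D *: \row_i G i ((v 0 i0)^-1 *: v).
  by apply/rowP => i; rewrite !mxE HE.
have key q v : X q -> coords q v -> v 0 i0 != 0 ->
    coords (f q) (\row_i evalp iota (H i) v).
  move=> Xq qv v0; rewrite rE; apply: coordsZ; first by rewrite expf_neq0.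
  apply: hf => //; first by apply: coordsZ => //; rewrite invr_eq0.
  by rewrite mxE mulVf.
exists D, H; split=> // [v pv|q v Xq qv].
  by apply: (@coords_neq0 _ _ (f p)); apply: key => //; apply: pi0.
move=> nz; apply: key => //; apply: contraNneq nz => v0.
by rewrite rE v0 expr0n scale0r.
Qed.

End Closed.

(** * Polynomial functions of one variable and cofinite conditions *)

Section Curves.
Variable C : numClosedFieldType.

(** In characteristic zero the natural numbers already give more roots than the size of [P]
    allows. *)
Lemma horner_inj0 (P : {poly C}) : (forall x, P.[x] = 0) -> P = 0.
Proof.
move=> h; apply/eqP; apply: contraT => P0.
have := max_poly_roots P0 (rs := [seq i%:R | i <- iota 0 (size P)]).
rewrite size_map size_iota ltnn; apply.
  by apply/allP => x _; rewrite /root h.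
by rewrite map_inj_uniq ?iota_uniq //; apply: mulrIn; rewrite oner_eq0.
Qed.

Definition polyf (f : C -> C) := exists P : {poly C}, forall x, f x = P.[x].

Lemma polyfX : polyf id.
Proof. by exists 'X => x; rewrite hornerX. Qed.

Lemma polyfC c : polyf (fun=> c).
Proof. by exists c%:P => x; rewrite hornerC. Qed.

Lemma polyf_horner (P : {poly C}) : polyf (fun x => P.[x]).
Proof. by exists P. Qed.

Lemma polyfD f g : polyf f -> polyf g -> polyf (fun x => f x + g x).
Proof. by move=> [P hP] [Q hQ]; exists (P + Q) => x; rewrite hornerD hP hQ. Qed.

Lemma polyfN f : polyf f -> polyf (fun x => - f x).
Proof. by move=> [P hP]; exists (- P) => x; rewrite hornerN hP. Qed.

Lemma polyfB f g : polyf f -> polyf g -> polyf (fun x => f x - g x).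
Proof. by move=> hf hg; apply: polyfD => //; apply: polyfN. Qed.

Lemma polyfM f g : polyf f -> polyf g -> polyf (fun x => f x * g x).
Proof. by move=> [P hP] [Q hQ]; exists (P * Q) => x; rewrite hornerM hP hQ. Qed.

Lemma polyf_exp f n : polyf f -> polyf (fun x => f x ^+ n).
Proof. by move=> [P hP]; exists (P ^+ n) => x; rewrite horner_exp hP. Qed.

Lemma polyf_ext f g : f =1 g -> polyf f -> polyf g.
Proof. by move=> fg [P hP]; exists P => x; rewrite -fg. Qed.

Lemma polyf_sum (I : Type) (r : seq I) (f : I -> C -> C) :
  (forall i, polyf (f i)) -> polyf (fun x => \sum_(i <- r) f i x).
Proof.
move=> h; elim: r => [|i r IH].
  by apply: polyf_ext (polyfC 0) => x; rewrite big_nil.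
by apply: polyf_ext (polyfD (h i) IH) => x; rewrite big_cons.
Qed.

Lemma polyf_prod (I : Type) (r : seq I) (f : I -> C -> C) :
  (forall i, polyf (f i)) -> polyf (fun x => \prod_(i <- r) f i x).
Proof.
move=> h; elim: r => [|i r IH].
  by apply: polyf_ext (polyfC 1) => x; rewrite big_nil.
by apply: polyf_ext (polyfM (h i) IH) => x; rewrite big_cons.
Qed.

Lemma polyf_comp f g : polyf f -> polyf g -> polyf (fun x => f (g x)).
Proof. by move=> [P hP] [Q hQ]; exists (P \Po Q) => x; rewrite horner_comp -hQ -hP. Qed.

Lemma polyf_evalp (k : fieldType) (iota : {rmorphism k -> C}) N (F : {mpoly k[N]})
    (g : C -> 'rV[C]_N) :
  (forall i, polyf (fun x => g x 0 i)) -> polyf (fun x => evalp iota F (g x)).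
Proof.
move=> h; apply: polyf_ext (fun x => esym (evalpE iota F (g x))) _.
apply: polyf_sum => m; apply: polyfM; first exact: polyfC.
by apply: polyf_prod => i; apply: polyf_exp.
Qed.

(** One nonzero polynomial bounds the exceptional set: conjunctions become products, and a witness
    exists because the field is infinite. *)
Definition cofinitely (Q : C -> Prop) :=
  exists2 e : {poly C}, e != 0 & forall x, e.[x] != 0 -> Q x.

Lemma cofinitely_and Q Q' :
  cofinitely Q -> cofinitely Q' -> cofinitely (fun x => Q x /\ Q' x).
Proof.
move=> [e e0 he] [e' e0' he']; exists (e * e'); first by rewrite mulf_neq0.
by move=> x; rewrite hornerM mulf_eq0 negb_or => /andP[/he ? /he' ?].
Qed.

Lemma cofinitelyW (Q Q' : C -> Prop) :
  (forall x, Q x -> Q' x) -> cofinitely Q -> cofinitely Q'.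
Proof. by move=> h [e e0 he]; exists e => // x /he /h. Qed.

Lemma cofinitely_all (Q : C -> Prop) : (forall x, Q x) -> cofinitely Q.
Proof. by move=> h; exists 1 => //; rewrite oner_eq0. Qed.

Lemma cofinitely_neq0 f x : polyf f -> f x != 0 -> cofinitely (fun y => f y != 0).
Proof.
move=> [P hP] h; exists P => [|y]; last by rewrite hP.
by apply: contraNneq h => P0; rewrite hP P0 horner0.
Qed.

Lemma cofinitely_neq a : cofinitely (fun x => x != a).
Proof.
exists ('X - a%:P); first by rewrite polyXsubC_eq0.
by move=> x; rewrite hornerXsubC subr_eq0.
Qed.

Lemma cofinitely_notin (s : seq C) : cofinitely (fun x => x \notin s).
Proof.
elim: s => [|a s IH]; first exact: cofinitely_all.
apply: cofinitelyW (cofinitely_and (cofinitely_neq a) IH) => x [xa xs].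
by rewrite inE negb_or xa.
Qed.

Lemma cofinitely_ex Q : cofinitely Q -> exists x, Q x.
Proof.
move=> [e e0 he]; apply: contrapT => h; move/eqP: e0; apply.
apply: horner_inj0 => x; apply/eqP; apply: contraT => /he Qx.
by case: h; exists x.
Qed.

Lemma polyf_eq f g : polyf f -> polyf g ->
  cofinitely (fun x => f x = g x) -> forall x, f x = g x.
Proof.
move=> [P hP] [Q hQ] [e e0 he] x.
have : (P - Q) * e = 0.
  apply: horner_inj0 => y; rewrite hornerM hornerD hornerN -hP -hQ.
  have [->|/he ->] := eqVneq e.[y] 0; first by rewrite mulr0.
  by rewrite subrr mul0r.
move=> /eqP; rewrite mulf_eq0 (negbTE e0) orbF subr_eq0 => /eqP PQ.
by rewrite hP hQ PQ.
Qed.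

(** A nonconstant polynomial has a root in a closed field. Most constancy claims of the rigidity
    part come from here. *)
Lemma polyf_nz_const f : polyf f -> (forall x, f x != 0) -> forall x, f x = f 0.
Proof.
move=> [P hP] h x; have : size P == 1%N.
  apply: contraT => /closed_rootP[y /rootP Py0].
  by have := h y; rewrite hP Py0 eqxx.
by move=> /size_poly1P[c _ Pc]; rewrite !hP Pc !hornerC.
Qed.

End Curves.

(** * Complex conjugation and descent of closed sets to the reals *)

Section Conjugation.
Variable R : realType.
Local Notation C := R[i].
Local Notation RtoC := (real_complex R : {rmorphism R -> C}).

Definition cj (x : C) : C := conjc x.
Lemma cjD x y : cj (x + y) = cj x + cj y. Proof. exact: (rmorphD (@conjc R)). Qed.
Lemma cjN x : cj (- x) = - cj x. Proof. exact: (rmorphN (@conjc R)). Qed.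
Lemma cjB x y : cj (x - y) = cj x - cj y. Proof. exact: (rmorphB (@conjc R)). Qed.
Lemma cjM x y : cj (x * y) = cj x * cj y. Proof. exact: (rmorphM (@conjc R)). Qed.
Lemma cjX x j : cj (x ^+ j) = cj x ^+ j. Proof. exact: (rmorphXn (@conjc R)). Qed.
Lemma cj0 : cj 0 = 0. Proof. exact: (rmorph0 (@conjc R)). Qed.
Lemma cj1 : cj 1 = 1. Proof. exact: (rmorph1 (@conjc R)). Qed.
Lemma cjK : involutive cj. Proof. exact: conjcK. Qed.
Lemma cj_nat j : cj j%:R = j%:R. Proof. exact: conjc_nat. Qed.
Lemma cj_real (x : R) : cj (RtoC x) = RtoC x. Proof. exact: conjc_real. Qed.
Lemma cj_eq0 x : (cj x == 0) = (x == 0). Proof. exact: conjc_eq0. Qed.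
Lemma cjV x : cj x^-1 = (cj x)^-1. Proof. exact: conjc_inv. Qed.
Lemma cj_sum (I : Type) (r : seq I) (F : I -> C) :
  cj (\sum_(i <- r) F i) = \sum_(i <- r) cj (F i).
Proof. exact: (rmorph_sum (@conjc R)). Qed.
Lemma cj_prod (I : Type) (r : seq I) (F : I -> C) :
  cj (\prod_(i <- r) F i) = \prod_(i <- r) cj (F i).
Proof. exact: (rmorph_prod (@conjc R)). Qed.
Lemma cj_i : cj 'i%C = - 'i%C.
Proof. by apply/eqP; rewrite eq_complex /= oppr0 !eqxx. Qed.

Local Notation conjv := (map_mx cj).

(** [vpick] selects some vector of the line; [coords_conj] shows that the choice does not matter. *)
Definition conjpt N (p : pt C N) : pt C N :=
  pt_of p (conjv (vpick (val p))).

Lemma conjv_neq0 N (v : 'rV[C]_N) : v != 0 -> conjv v != 0.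
Proof.
apply: contra_neq => /rowP h; apply/rowP => i.
by have := h i; rewrite !mxE => /eqP; rewrite cj_eq0 => /eqP.
Qed.

Lemma coords_conj N (p : pt C N) v : coords p v -> coords (conjpt p) (conjv v).
Proof.
move=> pv; have [w pw] := coords_ex p.
have pk : coords p (vpick (val p)).
  rewrite /coords; apply/eqP; rewrite eq_sym eqEdim -memvE memv_pick /=.
  have /eqP d1 := valP p; rewrite d1 dim_vline lt0b.
  by rewrite vpick0 -dimv_eq0 d1.
have [a a0 ->] := coords_prop pk pv.
have -> : conjv (a *: vpick (val p)) = cj a *: conjv (vpick (val p)).
  by apply/rowP => i; rewrite !mxE cjM.
apply: coordsZ; first by rewrite cj_eq0.
by apply: coords_pt_of; apply: conjv_neq0; apply: coords_neq0 pk.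
Qed.

Lemma evalp_conj N (F : {mpoly R[N]}) v :
  evalp RtoC F (conjv v) = cj (evalp RtoC F v).
Proof.
rewrite !evalpE cj_sum; apply: eq_bigr => m _.
rewrite cjM cj_prod cj_real; congr (_ * _).
by apply: eq_bigr => i _; rewrite mxE cjX.
Qed.

(** Conjugating the second equation gives [a - i b = 0]. It will separate the real and imaginary
    parts of a polynomial that vanishes at a point and at its conjugate. *)
Lemma lin_conj_eq0 (a b : C) :
  a + 'i%C * b = 0 -> cj a + 'i%C * cj b = 0 -> a = 0 /\ b = 0.
Proof.
move=> e1 /(congr1 cj); rewrite cjD cjM cj_i !cjK mulNr cj0 => /subr0_eq e2.
have b0 : 'i%C * b = 0.
  have : ('i%C * b) *+ 2 == 0 by rewrite mulr2n -{1}e2 e1.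
  by rewrite mulrn_eq0 /= => /eqP.
move: e1; rewrite e2 b0 addr0; split=> //; apply/eqP.
by move/eqP: b0; rewrite mulf_eq0 => /orP[/eqP[/eqP]|//]; rewrite oner_eq0.
Qed.

(** Each equation is split into two with real coefficients. On a conjugation-stable set both parts
    vanish, since the equation holds at [p] and at [conjpt p]. The removed points need this: their
    natural equations involve [i]. *)
Lemma zclosed_descent N (Z : set (pt C N)) :
  zclosed idfun Z -> (forall p, Z p -> Z (conjpt p)) -> zclosed RtoC Z.
Proof.
move=> [S hS ZE] hc.
pose reF (F : {mpoly C[N]}) : {mpoly R[N]} := \sum_(m <- msupp F) complex.Re F@_m *: 'X_[m].
pose imF (F : {mpoly C[N]}) : {mpoly R[N]} := \sum_(m <- msupp F) complex.Im F@_m *: 'X_[m].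
have reE F v : evalp idfun F v = evalp RtoC (reF F) v + 'i%C * evalp RtoC (imF F) v.
  rewrite evalpE !evalp_sum mulr_sumr -big_split; apply: eq_bigr => m _ /=.
  rewrite !evalpZ !evalp_mon mulrA -mulrDl; congr (_ * _).
  exact: complexE.
have hom (c : C -> R) (F : {mpoly C[N]}) : homogeneous F ->
    homogeneous (\sum_(m <- msupp F) c F@_m *: 'X_[m] : {mpoly R[N]}).
  move=> [e /dhomogP hF]; exists e; rewrite big_seq; apply: rpred_sum => m mF.
  by apply: dhomogZ; rewrite dhomogX; apply/eqP; apply: hF.
exists [set G | exists2 F, S F & G = reF F \/ G = imF F].
  by move=> _ [F /hS hF [->|->]]; apply: hom.
apply/seteqP; split=> p Zp.
  move=> G [F SF GF] v pv.
  have F0 : evalp idfun F v = 0 by move: Zp; rewrite ZE; exact.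
  have F1 : evalp idfun F (conjv v) = 0.
    by have := hc p Zp; rewrite ZE; apply=> //; apply: coords_conj.
  rewrite reE in F0; rewrite reE !evalp_conj in F1.
  have [a0 b0] := lin_conj_eq0 F0 F1.
  by case: GF => ->; [exact: a0 | exact: b0].
rewrite ZE => F SF v pv; rewrite reE (Zp (reF F)) ?(Zp (imF F)) ?mulr0 ?addr0 //.
  by exists F => //; right.
by exists F => //; left.
Qed.

End Conjugation.

Section Maps.
Variable C : fieldType.

(** [choice] fixes one coordinate vector per point, and the second hypothesis makes the result
    independent of it. [F] may contain divisions or case distinctions; regularity is proved
    separately. *)
Lemma pt_map_ex N M (q0 : pt C M) (X : set (pt C N)) (F : 'rV[C]_N -> 'rV[C]_M) :
  (forall p v, X p -> coords p v -> F v != 0) ->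
  (forall p v a, X p -> coords p v -> a != 0 -> exists a', F (a *: v) = a' *: F v) ->
  exists f : pt C N -> pt C M, forall p v, X p -> coords p v -> coords (f p) (F v).
Proof.
move=> nz sc; have [r hr] := choice (@coords_ex C N).
exists (fun p => pt_of q0 (F (r p))) => p v Xp pv.
have [a a0 vE] := coords_prop (hr p) pv.
have [a' e] := sc _ _ _ Xp (hr p) a0.
have := nz _ _ Xp pv; rewrite vE e scaler_eq0 negb_or => /andP[a'0 _].
by apply: coordsZ a'0 _; apply: coords_pt_of; apply: nz (hr p).
Qed.
End Maps.

(** * The family of varieties *)

Section Family.
Variable R : realType.
Local Notation C := R[i].
Local Notation cj := (@cj R).
Local Notation conjv := (map_mx cj).

Definition ii : C := 'i%C.

Lemma mulii : ii * ii = -1.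
Proof. by rewrite -expr2 /ii sqr_i. Qed.

Lemma ii_neq0 : ii != 0.
Proof. by apply/eqP; case=> /eqP; rewrite oner_eq0. Qed.

Lemma cj_ii : cj ii = - ii.
Proof. exact: cj_i. Qed.

Lemma two_neq0 : (2 : C) != 0.
Proof. by rewrite pnatr_eq0. Qed.

Definition ox : 'I_3 := @Ordinal 3 0 isT.
Definition oy : 'I_3 := @Ordinal 3 1 isT.
Definition oz : 'I_3 := @Ordinal 3 2 isT.

Lemma I3_cases (P : 'I_3 -> Prop) : P ox -> P oy -> P oz -> forall i, P i.
Proof.
move=> h0 h1 h2 [[|[|[|i]]] //= h].
- by have -> : Ordinal h = ox by apply: val_inj.
- by have -> : Ordinal h = oy by apply: val_inj.
- by have -> : Ordinal h = oz by apply: val_inj.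
Qed.

Implicit Types u : 'rV[C]_3.
Definition cU u := u 0 ox + ii * u 0 oy.
Definition cV u := u 0 ox - ii * u 0 oy.
Definition cZ u := u 0 oz.
(** The inverse change of coordinates: [x = (u + v) / 2] and
    [y = (u - v) / (2 i) = (v - u) i / 2]. *)
Definition uvz (a b c : C) : 'rV[C]_3 :=
  \row_i if i == ox then (a + b) / 2 else if i == oy then (b - a) * ii / 2 else c.

Lemma mul_ii_half x : ii * (x * ii / 2) = - x / 2.
Proof. by rewrite !mulrA [ii * x]mulrC -(mulrA x) mulii mulrN1. Qed.

Lemma half_add (x : C) : x / 2 + x / 2 = x.
Proof. by rewrite -mulrDl -mulr2n -[x *+ 2]mulr_natr mulfK ?two_neq0. Qed.

Lemma cU_uvz a b c : cU (uvz a b c) = a.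
Proof. by rewrite /cU !mxE /= mul_ii_half -[RHS]half_add; ring. Qed.

Lemma cV_uvz a b c : cV (uvz a b c) = b.
Proof. by rewrite /cV !mxE /= mul_ii_half -[RHS]half_add; ring. Qed.

Lemma cZ_uvz a b c : cZ (uvz a b c) = c.
Proof. by rewrite /cZ mxE. Qed.

Definition uvzE := (cU_uvz, cV_uvz, cZ_uvz).

Lemma uvzK u : uvz (cU u) (cV u) (cZ u) = u.
Proof.
apply/rowP; apply: I3_cases; rewrite mxE //=.
  by rewrite -[RHS]half_add /cU /cV; ring.
rewrite -[RHS]half_add /cU /cV.
have -> : u 0 ox - ii * u 0 oy - (u 0 ox + ii * u 0 oy) =
    - (u 0 oy * ii) - u 0 oy * ii by ring.
have -> : (- (u 0 oy * ii) - u 0 oy * ii) * ii = (- u 0 oy - u 0 oy) * (ii * ii).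
  by ring.
by rewrite mulii; ring.
Qed.

Lemma uvz_inj u u' : cU u = cU u' -> cV u = cV u' -> cZ u = cZ u' -> u = u'.
Proof. by move=> eU eV eZ; rewrite -(uvzK u) eU eV eZ uvzK. Qed.

Lemma cUZ a u : cU (a *: u) = a * cU u.
Proof. by rewrite /cU !mxE mulrDr mulrCA. Qed.
Lemma cVZ a u : cV (a *: u) = a * cV u.
Proof. by rewrite /cV !mxE mulrBr mulrCA. Qed.
Lemma cZZ a u : cZ (a *: u) = a * cZ u.
Proof. by rewrite /cZ !mxE. Qed.

Lemma uvzZ k a b c : uvz (k * a) (k * b) (k * c) = k *: uvz a b c.
Proof. by apply: uvz_inj; rewrite ?cUZ ?cVZ ?cZZ !uvzE. Qed.

Lemma u_eq0 u : (u == 0) = [&& cU u == 0, cV u == 0 & cZ u == 0].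
Proof.
apply/eqP/and3P => [->|[/eqP eU /eqP eV /eqP eZ]].
  by rewrite /cU /cV /cZ !mxE mulr0 subr0 addr0 eqxx.
by apply: uvz_inj; rewrite ?eU ?eV ?eZ /cU /cV /cZ !mxE ?mulr0 ?subr0 ?addr0.
Qed.

Lemma cUVE u : cU u * cV u = u 0 ox ^+ 2 + u 0 oy ^+ 2.
Proof.
by rewrite /cU /cV mulrC -subr_sqr exprMn [ii ^+ _]mulii mulN1r opprK.
Qed.

Lemma cU_conj u : cU (conjv u) = cj (cV u).
Proof. by rewrite /cU /cV !mxE cjB cjM cj_ii mulNr opprK. Qed.
Lemma cV_conj u : cV (conjv u) = cj (cU u).
Proof. by rewrite /cU /cV !mxE cjD cjM cj_ii mulNr. Qed.
Lemma cZ_conj u : cZ (conjv u) = cj (cZ u).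
Proof. by rewrite /cZ !mxE. Qed.

Variables (m e : nat).
Local Notation n := ((1 + m) + (1 + e))%N.
Local Notation K := (3 * n)%N.
Implicit Types (s : 'rV[C]_(1 + m)) (t : C) (b : 'rV[C]_e).

(** Nonzero and purely imaginary: conjugation acts as a change of sign, no [tj j] equals a [- tj k],
    and only the trivial positive dilation maps this finite set into itself. *)
Definition tj (j : 'I_(1 + m)) : C := j.+1%:R * ii.

Lemma tj_inj : injective tj.
Proof.
move=> j k /(mulIf ii_neq0)/eqP; rewrite eqr_nat => /eqP [] /val_inj; exact.
Qed.

Lemma tj_conj j : cj (tj j) = - tj j.
Proof. by rewrite /tj cjM cj_ii mulrN cj_nat. Qed.

Lemma tj_neqN j k : tj j != - tj k.
Proof.
rewrite -subr_eq0 opprK -mulrDl mulf_neq0 ?ii_neq0 // -natrD pnatr_eq0.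
by rewrite addSn.
Qed.

(* The removed points: in the conic over t = tj j the point
   z = w v, u = t w z with w = s_j + i, and its complex conjugate. *)
Definition removed1 s u t j :=
  [/\ t = tj j, cZ u = (s 0 j + ii) * cV u & cU u = t * (s 0 j + ii) * cZ u].
Definition removed2 s u t j :=
  [/\ t = - tj j, cZ u = (s 0 j - ii) * cU u & cV u = t * (s 0 j - ii) * cZ u].
Definition removed s u t := exists j, removed1 s u t j \/ removed2 s u t j.

(* Points of the family; s 0 0 = 1 means that s is in A^m. *)
Definition good s u t b :=
  [/\ s 0 0 = 1, u != 0, cU u * cV u = t * cZ u ^+ 2,
      forall l, b 0 l ^+ 2 + 1 != 0 & ~ removed s u t].

(* Segre coordinates of P^2 x (A^m x A^1 x A^e). *)
Definition base s t b : 'rV[C]_n := row_mx s (row_mx t%:M b).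
Definition pvec s u t b : 'rV[C]_K := mxvec (u^T *m base s t b).

Definition total_space : set (pt C K) :=
  [set p | exists s u t b, good s u t b /\ coords p (pvec s u t b)].
Definition slice s : set (pt C K) :=
  [set p | exists u t b, good s u t b /\ coords p (pvec s u t b)].

Definition js (j : 'I_(1 + m)) : 'I_n := lshift (1 + e) j.
Definition jt : 'I_n := rshift (1 + m) (lshift e 0).
Definition jb (l : 'I_e) : 'I_n := rshift (1 + m) (rshift 1 l).

Lemma base_s s t b j : base s t b 0 (js j) = s 0 j.
Proof. by rewrite row_mxEl. Qed.
Lemma base_t s t b : base s t b 0 jt = t.
Proof. by rewrite row_mxEr row_mxEl mxE. Qed.
Lemma base_b s t b l : base s t b 0 (jb l) = b 0 l.
Proof. by rewrite row_mxEr row_mxEr. Qed.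

Lemma js_cases (P : 'I_n -> Prop) :
  (forall j, P (js j)) -> P jt -> (forall l, P (jb l)) -> forall i, P i.
Proof.
move=> hs ht hb i; case: (splitP i) => [j|j] ij.
  by have -> : i = js j by apply: val_inj.
case: (splitP j) => [k|k] jk.
  have -> : i = jt by apply: val_inj; rewrite /= ij jk (ord1 k).
  by [].
by have -> : i = jb k by apply: val_inj; rewrite /= ij jk.
Qed.

Lemma pvecE s u t b i j : pvec s u t b 0 (mxvec_index i j) = u 0 i * base s t b 0 j.
Proof. by rewrite /pvec mxvecE mxE big_ord1 mxE. Qed.

Lemma pvec_s s u t b i j : pvec s u t b 0 (mxvec_index i (js j)) = u 0 i * s 0 j.
Proof. by rewrite pvecE base_s. Qed.
Lemma pvec_t s u t b i : pvec s u t b 0 (mxvec_index i jt) = u 0 i * t.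
Proof. by rewrite pvecE base_t. Qed.
Lemma pvec_b s u t b i l : pvec s u t b 0 (mxvec_index i (jb l)) = u 0 i * b 0 l.
Proof. by rewrite pvecE base_b. Qed.
Lemma pvec_0 s u t b i : s 0 0 = 1 -> pvec s u t b 0 (mxvec_index i (js 0)) = u 0 i.
Proof. by move=> s0; rewrite pvec_s s0 mulr1. Qed.

Lemma pvecZ a s u t b : pvec s (a *: u) t b = a *: pvec s u t b.
Proof. by rewrite /pvec linearZ /= -scalemxAl linearZ. Qed.

Lemma vecP (v w : 'rV[C]_K) :
  (forall i j, v 0 (mxvec_index i j) = w 0 (mxvec_index i j)) -> v = w.
Proof.
move=> h; rewrite -[v]vec_mxK -[w]vec_mxK; congr mxvec.
by apply/matrixP => i j; rewrite !mxE.
Qed.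

Lemma u_pivot u : u != 0 -> exists i, u 0 i != 0.
Proof.
move=> u0; apply/existsP; apply: contraNT u0; rewrite negb_exists => /forallP h.
by apply/eqP/rowP => i; rewrite mxE; apply/eqP; have := h i; rewrite negbK.
Qed.

Lemma pvec_neq0 s u t b : s 0 0 = 1 -> u != 0 -> pvec s u t b != 0.
Proof.
move=> s0 /u_pivot[i ui]; apply: contraNneq ui => /rowP/(_ (mxvec_index i (js 0))).
by rewrite pvec_0 // mxE => ->.
Qed.

Lemma pvec_inj s u t b s' u' t' b' :
  s 0 0 = 1 -> s' 0 0 = 1 -> u != 0 ->
  pvec s u t b = pvec s' u' t' b' -> [/\ s = s', u = u', t = t' & b = b'].
Proof.
move=> s0 s0' u0 /rowP E.
have uu : u = u'.
  by apply/rowP => i; have := E (mxvec_index i (js 0)); rewrite !pvec_0.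
rewrite -{u'}uu in E *; have [i ui] := u_pivot u0.
have cc j : base s t b 0 j = base s' t' b' 0 j.
  by have := E (mxvec_index i j); rewrite !pvecE => /(mulfI ui).
split=> //; first by apply/rowP => j; have := cc (js j); rewrite !base_s.
  by have := cc jt; rewrite !base_t.
by apply/rowP => j; have := cc (jb j); rewrite !base_b.
Qed.

Lemma removed_scale a s u t : a != 0 -> removed s (a *: u) t <-> removed s u t.
Proof.
move=> a0.
have E x y z : (a * x = y * (a * z)) <-> (x = y * z).
  by rewrite mulrCA; split=> [/(mulfI a0)|->].
by split=> -[j h]; exists j; case: h => -[h1 h2 h3]; [left|right|left|right];
  split=> //; move: h2 h3; rewrite ?cUZ ?cVZ ?cZZ ?E.
Qed.

Lemma good_scale a s u t b : a != 0 -> good s u t b -> good s (a *: u) t b.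
Proof.
move=> a0 [s0 u0 E hb hr]; split=> //.
- by rewrite scaler_eq0 negb_or a0.
- by rewrite cUZ cVZ cZZ mulrACA E exprMn -expr2 mulrCA.
- by rewrite removed_scale.
Qed.

Lemma total_coords p w : total_space p -> coords p w ->
  exists s u t b, good s u t b /\ w = pvec s u t b.
Proof.
move=> [s [u [t [b [g pv]]]]] pw; have [a a0 ->] := coords_prop pv pw.
by exists s, (a *: u), t, b; rewrite pvecZ; split=> //; apply: good_scale.
Qed.

Lemma slice_total s p : slice s p -> total_space p.
Proof. by move=> [u [t [b h]]]; exists s, u, t, b. Qed.

Lemma slice_coords s p w : slice s p -> coords p w ->
  exists u t b, good s u t b /\ w = pvec s u t b.
Proof.
move=> [u [t [b [g pv]]]] pw; have [a a0 ->] := coords_prop pv pw.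
by exists (a *: u), t, b; rewrite pvecZ; split=> //; apply: good_scale.
Qed.

Lemma pvec_conj s u t b : conjv (pvec s u t b) = pvec (conjv s) (conjv u) (cj t) (conjv b).
Proof.
apply: vecP => i j; rewrite mxE !pvecE cjM; congr (_ * _).
  by rewrite mxE.
by move: j; apply: js_cases => *; rewrite ?base_s ?base_t ?base_b ?mxE.
Qed.

Lemma removed_conj s u t : removed s u t -> removed (conjv s) (conjv u) (cj t).
Proof.
case=> j [] [-> h1 h2]; exists j; [right|left]; split.
- by rewrite tj_conj.
- by rewrite cZ_conj h1 cjM cjD cj_ii cU_conj mxE.
- by rewrite cV_conj h2 !cjM cjD cj_ii cZ_conj mxE.
- by rewrite cjN tj_conj opprK.
- by rewrite cZ_conj h1 cjM cjB cj_ii opprK cV_conj mxE.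
- by rewrite cU_conj h2 !cjM cjB cj_ii opprK cZ_conj mxE.
Qed.
End Family.

Lemma homfun_all (k C : fieldType) (iota : {rmorphism k -> C}) N d
    (f : 'rV[C]_N -> C) (p : pt C N) v w :
  homfun iota d f -> coords p v -> f v = 0 -> coords p w -> f w = 0.
Proof.
move=> [P hP fP] pv f0 pw; have [a a0 ->] := coords_prop pv pw.
by rewrite fP (evalp_homog _ _ _ hP) -fP f0 mulr0.
Qed.

(** * The total space and its real slices are quasi-projective over the reals *)

Section QuasiProjective.
Variable R : realType.
Local Notation C := R[i].
Local Notation RtoC := (real_complex R : {rmorphism R -> C}).
Local Notation cj := (@cj R).
Local Notation conjv := (map_mx cj).
Local Notation ii := (ii R).
Variables (m e : nat).
Local Notation n := ((1 + m) + (1 + e))%N.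
Local Notation K := (3 * n)%N.
Local Notation total_space := (@total_space R m e).
Local Notation js := (@js m e).
Local Notation jt := (jt m e).
Local Notation jb := (@jb m e).
Implicit Types (u : 'rV[C]_3) (s : 'rV[C]_(1 + m)) (t : C) (b : 'rV[C]_e).
Implicit Types (v : 'rV[C]_K) (i : 'I_3).

Lemma coords_conjV N (p : pt C N) w : coords (conjpt p) w -> coords p (conjv w).
Proof.
move=> pw; have [v pv] := coords_ex p.
have [a a0 ->] := coords_prop (coords_conj pv) pw.
have -> : conjv (a *: conjv v) = cj a *: v.
  by apply/rowP => i; rewrite !mxE cjM cjK.
by apply: coordsZ => //; rewrite cj_eq0.
Qed.

(** A coordinate vector is read as a matrix with 3 rows and [n] columns. On the total space it has
    rank one: columns are multiples of [u], rows are multiples of [base s t b]. *)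
Definition ent v i (j : 'I_n) : C := v 0 (mxvec_index i j).
Definition colv v (j : 'I_n) : 'rV[C]_3 := \row_i ent v i j.

Lemma colv_pvec s u t b j : colv (pvec s u t b) j = base s t b 0 j *: u.
Proof. by apply/rowP => i; rewrite mxE [RHS]mxE /ent pvecE mulrC. Qed.

Lemma colv_conj v j : colv (conjv v) j = conjv (colv v j).
Proof. by apply/rowP => i; rewrite !mxE /ent mxE. Qed.

Section Hom.
Variables (k : fieldType) (iota : {rmorphism k -> C}).
Lemma homfun_ent i (j : 'I_n) : homfun iota 1 (fun v => ent v i j).
Proof. exact: homfunX. Qed.
End Hom.

Lemma homfunZC d c (f : 'rV[C]_K -> C) : homfun idfun d f -> homfun idfun d (fun v => c * f v).
Proof. exact: (homfunZ (iota := idfun)). Qed.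

Lemma homfun_cZ (j : 'I_n) : homfun idfun 1 (fun v => cZ (colv v j)).
Proof.
have [P hP fP] := homfun_ent idfun oz j.
by exists P => // v; rewrite /cZ mxE fP.
Qed.

Lemma homfun_cU (j : 'I_n) : homfun idfun 1 (fun v => cU (colv v j)).
Proof.
have [P hP fP] := homfunD (homfun_ent idfun ox j) (homfunZC ii (homfun_ent idfun oy j)).
by exists P => // v; rewrite /cU !mxE fP.
Qed.

Lemma homfun_cV (j : 'I_n) : homfun idfun 1 (fun v => cV (colv v j)).
Proof.
have [P hP fP] := homfunB (homfun_ent idfun ox j) (homfunZC ii (homfun_ent idfun oy j)).
by exists P => // v; rewrite /cV !mxE fP.
Qed.

(** The conditions [removed1] ([true]) and [removed2] ([false]) made linear in the matrix entries:
    [s_j u] is column [js j], the equation for [t] is multiplied by each [u_i], and in the last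
    equation [t] is replaced by its constant value. *)
Definition removed_eq (q : 'I_(1 + m) * bool) (k : 'I_3 + bool) v : C :=
  match q, k with
  | (j, true), inl i => ent v i jt - tj R j * ent v i (js 0)
  | (j, true), inr true =>
      cZ (colv v (js 0)) - (cV (colv v (js j)) + ii * cV (colv v (js 0)))
  | (j, true), inr false =>
      cU (colv v (js 0)) - tj R j * (cZ (colv v (js j)) + ii * cZ (colv v (js 0)))
  | (j, false), inl i => ent v i jt - (- tj R j) * ent v i (js 0)
  | (j, false), inr true =>
      cZ (colv v (js 0)) - (cU (colv v (js j)) - ii * cU (colv v (js 0)))
  | (j, false), inr false =>
      cV (colv v (js 0)) - (- tj R j) * (cZ (colv v (js j)) - ii * cZ (colv v (js 0)))
  end.

Lemma homfun_removed_eq q k : homfun idfun 1 (removed_eq q k).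
Proof.
case: q => j [] /=; case: k => [i|[]] /=;
  do ?[apply: homfun_cU | apply: homfun_cV | apply: homfun_cZ | apply: homfun_ent
      | apply: homfunB | apply: homfunD | apply: homfunZC].
Qed.

Lemma removed_eq_conj (j : 'I_(1 + m)) (o : bool) k v :
  removed_eq (j, o) k (conjv v) = cj (removed_eq (j, ~~ o) k v).
Proof.
case: o; case: k => [i|[]] /=; rewrite ?colv_conj ?cU_conj ?cV_conj ?cZ_conj /ent ?mxE;
  repeat match goal with
  | |- context [cU ?x] => generalize (cU x) => ?
  | |- context [cV ?x] => generalize (cV x) => ?
  | |- context [cZ ?x] => generalize (cZ x) => ?
  end;
  by rewrite !(cjB, cjD, cjM, cjN, tj_conj, cj_ii, mulNr, opprK).
Qed.

Definition removed_set : set (pt C K) :=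
  [set p | exists q, forall k v, coords p v -> removed_eq q k v = 0].

(** The equations are complex, but conjugation exchanges the systems [(j, true)] and [(j, false)],
    so the union descends. *)
Lemma removed_set_closed : zclosed RtoC removed_set.
Proof.
apply: zclosed_descent.
  apply: zclosed_bigU => q; exact: zclosed_homfun (homfun_removed_eq q).
move=> p [[j o] h]; exists (j, ~~ o) => k v /coords_conjV pv.
have -> : v = conjv (conjv v) by apply/rowP => i; rewrite !mxE cjK.
by rewrite removed_eq_conj negbK h ?cj0.
Qed.

Lemma removed_eqP s u t b : s 0 0 = 1 -> u != 0 ->
  (exists q, forall k, removed_eq q k (pvec s u t b) = 0) <-> removed s u t.
Proof.
move=> s0 /u_pivot[i ui].
have cE (j : 'I_(1 + m)) : colv (pvec s u t b) (js j) = s 0 j *: u by rewrite colv_pvec base_s.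
have eE k : ent (pvec s u t b) k jt = u 0 k * t by rewrite /ent pvec_t.
have e0 k : ent (pvec s u t b) k (js 0) = u 0 k by rewrite /ent pvec_0.
split.
  move=> [[j []] h]; exists j; [left|right]; have h1 := h (inl i);
    have h2 := h (inr true); have h3 := h (inr false); move: h1 h2 h3 => /=;
    rewrite !cE s0 scale1r ?cUZ ?cVZ ?cZZ eE e0 ?[u 0 i * t]mulrC
     => /subr0_eq/(mulIf ui) tE /subr0_eq zE /subr0_eq uE; split=> //.
  - by rewrite zE mulrDl.
  - by rewrite uE tE -mulrDl mulrA.
  - by rewrite zE mulrBl.
  - by rewrite uE tE -mulrBl mulrA.
move=> [j [] [tE zE uE]]; [exists (j, true)|exists (j, false)]; case=> [k|[]] /=;
  rewrite ?cE ?eE ?e0 ?s0 ?scale1r ?cUZ ?cVZ ?cZZ; apply/eqP; rewrite subr_eq0; apply/eqP.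
- by rewrite tE mulrC.
- by rewrite {1}zE mulrDl.
- by rewrite {1}uE tE -mulrDl mulrA.
- by rewrite tE mulrC.
- by rewrite {1}zE mulrBl.
- by rewrite {1}uE tE -mulrBl mulrA.
Qed.

Definition segre_eq (q : ('I_3 * 'I_n) * ('I_3 * 'I_n)) v :=
  ent v q.1.1 q.1.2 * ent v q.2.1 q.2.2 - ent v q.1.1 q.2.2 * ent v q.2.1 q.1.2.
(** Only the products [u_i t] are coordinates, so the conic is multiplied by each [u_i], which makes
    it a cubic. Likewise [branch_eq] is [u_i ^ 2 (1 + b_l ^ 2)]. *)
Definition conic_eq i v :=
  (ent v ox (js 0) * ent v ox (js 0) + ent v oy (js 0) * ent v oy (js 0)) * ent v i (js 0)
  - (ent v i jt * ent v oz (js 0)) * ent v oz (js 0).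
Definition branch_eq (l : 'I_e) i v :=
  ent v i (js 0) * ent v i (js 0) + ent v i (jb l) * ent v i (jb l).

Lemma homfun_segre_eq q : homfun RtoC 2 (segre_eq q).
Proof.
by apply: homfunB; apply: (homfunM (e := 1) (e' := 1)); exact: homfun_ent.
Qed.

Lemma homfun_conic_eq i : homfun RtoC 3 (conic_eq i).
Proof.
have h := homfun_ent RtoC; apply: homfunB; apply: (homfunM (e := 2) (e' := 1)) => //.
  by apply: homfunD; apply: (homfunM (e := 1) (e' := 1)).
exact: (homfunM (e := 1) (e' := 1)).
Qed.

Lemma homfun_branch_eq l i : homfun RtoC 2 (branch_eq l i).
Proof.
by apply: homfunD; apply: (homfunM (e := 1) (e' := 1)); exact: homfun_ent.
Qed.

(** The first set consists of the points whose column [js 0] is zero, that is, outside the chart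
    [s_0 = 1]. *)
Definition excluded : set (pt C K) :=
  [set p | forall i v, coords p v -> ent v i (js 0) = 0] `|`
  [set p | exists l, forall i v, coords p v -> branch_eq l i v = 0] `|` removed_set.

Lemma excluded_closed : zclosed RtoC excluded.
Proof.
apply: zclosedU; last exact: removed_set_closed.
apply: zclosedU.
  by apply: (zclosed_homfun (e := fun=> 1%N)) => i; exact: homfun_ent.
apply: zclosed_bigU => l.
by apply: (zclosed_homfun (e := fun=> 2%N)) => i; exact: homfun_branch_eq.
Qed.

Lemma total_equations p : total_space p <->
  (forall q v, coords p v -> segre_eq q v = 0) /\
  (forall i v, coords p v -> conic_eq i v = 0) /\ ~ excluded p.
Proof.
split=> [tp|[h1 [h2 h3]]].
  have main w : coords p w -> exists s u t b, good s u t b /\ w = pvec s u t b.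
    exact: total_coords tp.
  split; [|split].
  - move=> [[i j] [i' j']] v /main[s [u [t [b [_ ->]]]]].
    by rewrite /segre_eq /ent !pvecE /=; ring.
  - move=> i v /main[s [u [t [b [[s0 _ E _ _] ->]]]]].
    rewrite /conic_eq /ent !pvec_0 // pvec_t.
    have -> : u 0 ox * u 0 ox + u 0 oy * u 0 oy = t * u 0 oz ^+ 2.
      by rewrite -[RHS]E cUVE !expr2.
    by ring.
  - have [w pw] := coords_ex p; have [s [u [t [b [[s0 u0 E hb hr] wE]]]]] := main w pw.
    have [i ui] := u_pivot u0.
    case=> [[/(_ i w pw)|[l /(_ i w pw)]]|[q h]]; rewrite ?wE.
    + by rewrite /ent pvec_0 // => /eqP; rewrite (negbTE ui).
    + rewrite /branch_eq /ent pvec_0 // pvec_b => /eqP.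
      have -> : u 0 i * u 0 i + u 0 i * b 0 l * (u 0 i * b 0 l)
         = (u 0 i * u 0 i) * (b 0 l ^+ 2 + 1) by ring.
      by rewrite !mulf_eq0 (negbTE ui) (negbTE (hb l)).
    + by apply: hr; apply/(removed_eqP t b s0 u0); exists q => k; rewrite -wE; exact: h.
have [v pv] := coords_ex p.
(* This entry is the pivot: column [js 0] is taken as [u], row [k] divided by the pivot gives [s],
   [t], [b], and the minors recover every other entry. *)
have [k vk] : exists k, ent v k (js 0) != 0.
  apply: contrapT => /forallNP h; apply: h3; left; left => i w pw.
  apply: homfun_all (homfun_ent RtoC i (js 0)) pv _ pw.
  by apply/eqP; apply: contraT => /h.
pose u := colv v (js 0); pose s : 'rV[C]_(1 + m) := \row_j (ent v k (js j) / ent v k (js 0)).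
pose t := ent v k jt / ent v k (js 0).
pose b : 'rV[C]_e := \row_l (ent v k (jb l) / ent v k (js 0)).
have bE j : base s t b 0 j = ent v k j / ent v k (js 0).
  by move: j; apply: js_cases => *; rewrite ?base_s ?base_t ?base_b ?mxE.
have vE : v = pvec s u t b.
  apply: vecP => i j; rewrite pvecE bE mxE; apply: (mulIf vk).
  rewrite mulrA divfK //.
  by have /subr0_eq := h1 ((i, j), (k, js 0)) v pv; rewrite /= => ->.
have s0 : s 0 0 = 1 by rewrite mxE divff.
have u0 : u != 0 by apply: contraNneq vk => /rowP/(_ k); rewrite !mxE => ->.
have uE i : ent v i (js 0) = u 0 i by rewrite mxE.
exists s, u, t, b; split; last by rewrite -vE.
split=> //.
- rewrite cUVE /cZ; apply: (mulIf vk).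
  have /subr0_eq := h2 k v pv; rewrite !uE -!expr2 => ->.
  rewrite -[u 0 k]uE -mulrA -expr2 mulrAC divfK //.
- move=> l; apply/eqP => bl; apply: h3; left; right; exists l => i w pw.
  apply: homfun_all (homfun_branch_eq l i) pv _ pw.
  rewrite vE /branch_eq /ent pvec_0 // pvec_b.
  have -> : u 0 i * u 0 i + u 0 i * b 0 l * (u 0 i * b 0 l)
         = (u 0 i * u 0 i) * (b 0 l ^+ 2 + 1) by ring.
  by rewrite bl mulr0.
- move=> /(removed_eqP t b s0 u0)[q hq]; apply: h3; right; exists q => k' w pw.
  by apply: homfun_all (homfun_removed_eq q k') pv _ pw; rewrite vE.
Qed.

Lemma total_quasi_projective : quasi_projective RtoC total_space.
Proof.
exists ([set p | forall q v, coords p v -> segre_eq q v = 0] `&`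
        [set p | forall i v, coords p v -> conic_eq i v = 0]), excluded; split.
- apply: zclosedI.
    exact: (zclosed_homfun (e := fun=> 2%N) homfun_segre_eq).
  exact: (zclosed_homfun (e := fun=> 3%N) homfun_conic_eq).
- exact: excluded_closed.
- apply/seteqP; split=> p.
    by move=> /total_equations[h1 [h2 h3]]; split.
  by move=> [[h1 h2] h3]; apply/total_equations.
Qed.

Lemma sliceE s p : s 0 0 = 1 ->
  slice s p <-> total_space p /\ forall q v, coords p v ->
    ent v q.1 (js q.2) - s 0 q.2 * ent v q.1 (js 0) = 0.
Proof.
move=> s0; split=> [sp|[tp h]].
  split; first exact: slice_total sp.
  move=> [i j] v pv /=; have [u [t [b [[s0' _ _ _ _] ->]]]] := slice_coords sp pv.
  by rewrite /ent pvec_s pvec_0 // mulrC subrr.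
have [w pw] := coords_ex p; have [s' [u [t [b [g wE]]]]] := total_coords tp pw.
have [s0' u0 _ _ _] := g; have [i ui] := u_pivot u0.
have <- : s' = s.
  apply/rowP => j; have /subr0_eq := h (i, j) w pw.
  by rewrite wE /ent pvec_s pvec_0 //= mulrC => /(mulIf ui).
by exists u, t, b; rewrite -wE.
Qed.

Lemma slice_quasi_projective (r : 'rV[R]_(1 + m)) : r 0 0 = 1 ->
  quasi_projective RtoC (@slice R m e (map_mx RtoC r)).
Proof.
move=> r0.
pose f (q : 'I_3 * 'I_(1 + m)) v := ent v q.1 (js q.2) - RtoC (r 0 q.2) * ent v q.1 (js 0).
have hf q : homfun RtoC 1 (f q).
  by apply: homfunB; [|apply: homfunZ]; apply: homfun_ent.
have s0 : map_mx RtoC r 0 0 = 1 by rewrite mxE r0 rmorph1.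
suff -> : @slice R m e (map_mx RtoC r) =
    total_space `&` [set p | forall q v, coords p v -> f q v = 0].
  apply: quasi_projectiveI total_quasi_projective _.
  exact: (zclosed_homfun (e := fun=> 1%N)).
apply/seteqP; split=> p.
  move=> /(sliceE _ s0)[tp h]; split=> // q v pv.
  by have := h q v pv; rewrite mxE.
by move=> [tp h]; apply/sliceE => //; split=> // q v pv; rewrite mxE; apply: h.
Qed.

End QuasiProjective.

(** * Charts of the total space and irreducibility of the slices *)

Lemma cofinitely_forall (C : numClosedFieldType) (I : finType) (Q : I -> C -> Prop) :
  (forall i, cofinitely (Q i)) -> cofinitely (fun x => forall i, Q i x).
Proof.
move=> /fin_all_exists2[h h0 hQ]; exists (\prod_i h i); first exact/prodf_neq0.
by move=> x; rewrite horner_prod => /prodf_neq0 nz i; apply: hQ; apply: nz.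
Qed.

(** Some equation of [Z] is nonzero at [x0]; restricted to the curve it is a nonzero polynomial in
    [x]. *)
Lemma curve_notin (C : numClosedFieldType) (k : fieldType) (iota : {rmorphism k -> C})
    N (g : C -> 'rV[C]_N) (Z : set (pt C N)) x0 p :
  (forall i, polyf (fun x => g x 0 i)) -> zclosed iota Z ->
  coords p (g x0) -> ~ Z p ->
  cofinitely (fun x => forall q, coords q (g x) -> ~ Z q).
Proof.
move=> hg [S hS ->] px /existsNP[F /not_implyP[SF nF]].
have F0 : evalp iota F (g x0) != 0.
  by apply/eqP => F0; apply: nF; apply: vanishes_at F0 => //; exact: hS.
apply: cofinitelyW (cofinitely_neq0 (f := fun x => evalp iota F (g x))
  (polyf_evalp iota F hg) F0).
by move=> x /eqP Fx q qx /(_ F SF (g x) qx).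
Qed.

Section Irreducible.
Variable R : realType.
Local Notation C := R[i].
Local Notation ii := (ii R).
Variables (m e : nat).
Local Notation n := ((1 + m) + (1 + e))%N.
Local Notation K := (3 * n)%N.
Local Notation total_space := (@total_space R m e).
Local Notation js := (@js m e).
Local Notation jt := (jt m e).
Local Notation jb := (@jb m e).
Implicit Types (u : 'rV[C]_3) (s : 'rV[C]_(1 + m)) (t : C) (b : 'rV[C]_e).
Implicit Types (v : 'rV[C]_K) (i : 'I_3).

(** Row [i] holds the parameters multiplied by [u_i]; in the chart [u_i = 1] it holds the parameters
    themselves. *)
Definition sv v i : 'rV[C]_(1 + m) := \row_j ent v i (js j).
Definition tv v i : C := ent v i jt.
Definition bv v i : 'rV[C]_e := \row_l ent v i (jb l).

Lemma sv_pvec s u t b i : sv (pvec s u t b) i = u 0 i *: s.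
Proof. by apply/rowP => j; rewrite mxE [RHS]mxE /ent pvec_s. Qed.
Lemma tv_pvec s u t b i : tv (pvec s u t b) i = u 0 i * t.
Proof. by rewrite /tv /ent pvec_t. Qed.
Lemma bv_pvec s u t b i : bv (pvec s u t b) i = u 0 i *: b.
Proof. by apply/rowP => j; rewrite mxE [RHS]mxE /ent pvec_b. Qed.
Lemma col0_pvec s u t b : s 0 0 = 1 -> colv (pvec s u t b) (js 0) = u.
Proof. by move=> s0; rewrite colv_pvec base_s s0 scale1r. Qed.

Lemma total_morphism (k : fieldType) (iota : {rmorphism k -> C}) M
    (X : set (pt C K)) (Y : set (pt C M)) f
    (G : 'rV[C]_3 -> 'rV[C]_(1 + m) -> C -> 'rV[C]_e -> 'rV[C]_M) :
  X `<=` total_space ->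
  (forall i j, polyfun iota
     (fun v => G (colv v (js 0)) (sv v i) (tv v i) (bv v i) 0 j)) ->
  (forall p u s t b, X p -> good s u t b -> coords p (pvec s u t b) ->
     coords (f p) (G u s t b)) ->
  (forall p, X p -> Y (f p)) -> var_morphism iota X Y f.
Proof.
move=> XT hG hf XY; apply: var_morphism_chart XY _ => p Xp.
have [s [u [t [b [[s0 u0 _ _ _] pv]]]]] := XT p Xp.
have [i ui] := u_pivot u0.
exists (mxvec_index i (js 0)),
  (fun j v => G (colv v (js 0)) (sv v i) (tv v i) (bv v i) 0 j); split=> //.
  by move=> v pv'; have [a a0 ->] := coords_prop pv pv'; rewrite mxE pvec_0 // mulf_neq0.
move=> q v Xq qv; have [s' [u' [t' [b' [g vE]]]]] := total_coords (XT q Xq) qv.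
have [s0' _ _ _ _] := g; rewrite vE in qv *; rewrite pvec_0 // => ui'.
have -> : \row_j G (colv (pvec s' u' t' b') (js 0)) (sv (pvec s' u' t' b') i)
   (tv (pvec s' u' t' b') i) (bv (pvec s' u' t' b') i) 0 j = G u' s' t' b'.
  by apply/rowP => j; rewrite mxE sv_pvec tv_pvec bv_pvec col0_pvec // ui' !scale1r mul1r.
exact: hf Xq g qv.
Qed.

(** Dividing by any nonzero entry of column [js 0] returns the same [s, t, b]; only the scale of [u]
    depends on the representative. *)
Lemma total_map_ex M (q0 : pt C M)
    (G : 'rV[C]_3 -> 'rV[C]_(1 + m) -> C -> 'rV[C]_e -> 'rV[C]_M) :
  (forall s u t b, good s u t b -> G u s t b != 0) ->
  (forall s u t b a, good s u t b -> a != 0 ->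
     exists a', G (a *: u) s t b = a' *: G u s t b) ->
  exists f : pt C K -> pt C M, forall p s u t b, good s u t b ->
    coords p (pvec s u t b) -> coords (f p) (G u s t b).
Proof.
move=> nz sc.
pose piv v := odflt ox [pick i | ent v i (js 0) != 0].
pose F v := let i := piv v in let a := (ent v i (js 0))^-1 in
  G (colv v (js 0)) (a *: sv v i) (a * tv v i) (a *: bv v i).
have FE s u t b : s 0 0 = 1 -> u != 0 -> F (pvec s u t b) = G u s t b.
  move=> s0 /u_pivot[i ui]; rewrite /F /=; set k := piv _.
  have uk : u 0 k != 0.
    rewrite /k /piv; case: pickP => [i'|/(_ i)]; rewrite /ent pvec_0 //=.
    by rewrite ui.
  rewrite col0_pvec // sv_pvec tv_pvec bv_pvec /ent pvec_0 // !scalerA mulrA.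
  by rewrite mulVf // !scale1r mul1r.
have [p v tp pv|p v a tp pv a0|f hf] := pt_map_ex q0 (X := total_space) (F := F).
- have [s [u [t [b [g ->]]]]] := total_coords tp pv; have [s0 u0 _ _ _] := g.
  by rewrite FE //; apply: nz.
- have [s [u [t [b [g ->]]]]] := total_coords tp pv; have [s0 u0 _ _ _] := g.
  by rewrite -pvecZ !FE // ?scaler_eq0 ?negb_or ?a0 //; apply: sc.
exists f => p s u t b g pv; have [s0 u0 _ _ _] := g.
by rewrite -(FE s u t b) //; apply: hf => //; exists s, u, t, b.
Qed.

Lemma polyf_cU (g : C -> 'rV[C]_3) : (forall i, polyf (fun x => g x 0 i)) ->
  polyf (fun x => cU (g x)).
Proof. by move=> h; apply: polyfD => //; apply: polyfM (polyfC _) _. Qed.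
Lemma polyf_cV (g : C -> 'rV[C]_3) : (forall i, polyf (fun x => g x 0 i)) ->
  polyf (fun x => cV (g x)).
Proof. by move=> h; apply: polyfB => //; apply: polyfM (polyfC _) _. Qed.
Lemma polyf_cZ (g : C -> 'rV[C]_3) : (forall i, polyf (fun x => g x 0 i)) ->
  polyf (fun x => cZ (g x)).
Proof. exact. Qed.

Lemma polyf_uvz (f g h : C -> C) : polyf f -> polyf g -> polyf h ->
  forall i, polyf (fun x => uvz (f x) (g x) (h x) 0 i).
Proof.
move=> hf hg hh; apply: I3_cases.
- apply: polyf_ext (fun x => (f x + g x) / 2) _ _ _ => [x|]; first by rewrite mxE.
  by apply: polyfM (polyfC _); apply: polyfD.
- apply: polyf_ext (fun x => (g x - f x) * ii / 2) _ _ _ => [x|]; first by rewrite mxE.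
  by apply: polyfM (polyfC _); apply: polyfM (polyfC _); apply: polyfB.
- by apply: polyf_ext hh => x; rewrite mxE.
Qed.

Lemma polyf_pvec (g : C -> 'rV[C]_(1 + m)) (f : C -> 'rV[C]_3) (h : C -> C)
    (b : C -> 'rV[C]_e) :
  (forall j, polyf (fun x => g x 0 j)) -> (forall j, polyf (fun x => f x 0 j)) ->
  polyf h -> (forall j, polyf (fun x => b x 0 j)) ->
  forall k, polyf (fun x => pvec (g x) (f x) (h x) (b x) 0 k).
Proof.
move=> hg hf hh hb k; case/mxvec_indexP: k => i j.
apply: polyf_ext (fun x => esym (pvecE _ _ _ _ i j)) _; apply: polyfM => //.
move: j; apply: js_cases => [j||l].
- by apply: polyf_ext (hg j) => x; rewrite base_s.
- by apply: polyf_ext hh => x; rewrite base_t.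
- by apply: polyf_ext (hb l) => x; rewrite base_b.
Qed.

(** The conic equation is assumed along the whole curve, and the other conditions are open, hence
    inherited from [x0] by all but finitely many points. *)
Lemma good_cofinitely s (f : C -> 'rV[C]_3) (h : C -> C) (b : C -> 'rV[C]_e) x0 :
  (forall j, polyf (fun x => f x 0 j)) -> polyf h -> (forall j, polyf (fun x => b x 0 j)) ->
  (forall x, cU (f x) * cV (f x) = h x * cZ (f x) ^+ 2) ->
  good s (f x0) (h x0) (b x0) -> cofinitely (fun x => good s (f x) (h x) (b x)).
Proof.
move=> hf hh hb E [s0 u0 _ b0 r0]; have [i ui] := u_pivot u0.
have pU := polyf_cU hf; have pV := polyf_cV hf; have pZ := polyf_cZ hf.
have pc := @polyfC C.
have nonzero f1 f2 : polyf f1 -> polyf f2 -> f1 x0 <> f2 x0 ->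
    cofinitely (fun x => f1 x <> f2 x).
  move=> p1 p2 /eqP; rewrite -subr_eq0 => ne.
  apply: cofinitelyW (cofinitely_neq0 (polyfB p1 p2) ne) => x.
  by rewrite subr_eq0 => /eqP.
(* Both kinds of removed point are conjunctions of three polynomial equations. One of the three
   fails at [x0], and that one fails cofinitely. *)
have rem (P : 'I_(1 + m) -> C -> Prop) f1 f2 f3 f4 f5 f6 :
    (forall j, (polyf (f1 j) /\ polyf (f2 j)) /\
      [/\ polyf (f3 j), polyf (f4 j), polyf (f5 j) & polyf (f6 j)]) ->
    (forall j x, P j x <-> [/\ f1 j x = f2 j x, f3 j x = f4 j x & f5 j x = f6 j x]) ->
    (forall j, ~ P j x0) -> cofinitely (fun x => forall j, ~ P j x).
  move=> pf PE nP; apply: cofinitely_forall => j; have [[p1 p2] [p3 p4 p5 p6]] := pf j.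
  have [e1|ne] := pselect (f1 j x0 = f2 j x0); last first.
    by apply: (cofinitelyW _ (nonzero _ _ p1 p2 ne)) => x ne' /PE[].
  have [e2|ne] := pselect (f3 j x0 = f4 j x0); last first.
    by apply: (cofinitelyW _ (nonzero _ _ p3 p4 ne)) => x ne' /PE[].
  have [e3|ne] := pselect (f5 j x0 = f6 j x0); last first.
    by apply: (cofinitelyW _ (nonzero _ _ p5 p6 ne)) => x ne' /PE[].
  by case: (nP j); apply/PE.
have c1 : cofinitely (fun x => forall j, ~ removed1 s (f x) (h x) j).
  apply: (rem _ (fun _ x => h x) (fun j _ => tj R j) (fun _ x => cZ (f x))
    (fun j x => (s 0 j + ii) * cV (f x)) (fun _ x => cU (f x))
    (fun j x => h x * (s 0 j + ii) * cZ (f x))) => [j|j x|j r].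
  - by split; split; do ?[exact: polyfC | exact: hh | exact: pU | exact: pV | exact: pZ
      | apply: polyfM].
  - by split.
  - by apply: r0; exists j; left.
have c2 : cofinitely (fun x => forall j, ~ removed2 s (f x) (h x) j).
  apply: (rem _ (fun _ x => h x) (fun j _ => - tj R j) (fun _ x => cZ (f x))
    (fun j x => (s 0 j - ii) * cU (f x)) (fun _ x => cV (f x))
    (fun j x => h x * (s 0 j - ii) * cZ (f x))) => [j|j x|j r].
  - by split; split; do ?[exact: polyfC | exact: hh | exact: pU | exact: pV | exact: pZ
      | apply: polyfM].
  - by split.
  - by apply: r0; exists j; right.
have cb : cofinitely (fun x => forall l, b x 0 l ^+ 2 + 1 != 0).
  apply: cofinitely_forall => l.
  by apply: (cofinitely_neq0 (f := fun x => b x 0 l ^+ 2 + 1)) (b0 l);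
     apply: polyfD => //; apply: polyf_exp.
have cu := cofinitely_neq0 (hf i) ui.
apply: cofinitelyW (cofinitely_and (cofinitely_and c1 c2) (cofinitely_and cb cu)).
move=> x [[h1 h2] [h3 h4]]; split=> //.
  by apply: contraNneq h4 => ->; rewrite mxE.
by case=> j [/h1|/h2].
Qed.

Definition affu (x y : C) : 'rV[C]_3 := uvz (x + ii * y) (x - ii * y) 1.

Lemma affuE x y : [/\ affu x y 0 ox = x, affu x y 0 oy = y & affu x y 0 oz = 1].
Proof.
have -> : affu x y = \row_i if i == ox then x else if i == oy then y else 1.
  apply: uvz_inj; rewrite uvzE ?[in RHS]/cU ?[in RHS]/cV ?[in RHS]/cZ !mxE //=.
by rewrite !mxE.
Qed.

Lemma affu_conic x y : cU (affu x y) * cV (affu x y) = (x ^+ 2 + y ^+ 2) * cZ (affu x y) ^+ 2.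
Proof. by have [ux uy uz] := affuE x y; rewrite cUVE /cZ ux uy uz expr1n mulr1. Qed.

Lemma affu_of u t : cU u * cV u = t * cZ u ^+ 2 -> cZ u = 1 ->
  u = affu (u 0 ox) (u 0 oy) /\ t = u 0 ox ^+ 2 + u 0 oy ^+ 2.
Proof.
move=> E z1; split; last by rewrite -cUVE E z1 expr1n mulr1.
by apply: uvz_inj; rewrite !uvzE.
Qed.

Lemma affu_neq0 x y : affu x y != 0.
Proof.
apply/eqP => /rowP/(_ oz); have [_ _ ->] := affuE x y.
by rewrite mxE => /eqP; rewrite oner_eq0.
Qed.

Lemma polyf_affu f g : polyf f -> polyf g -> forall i, polyf (fun x => affu (f x) (g x) 0 i).
Proof.
move=> hf hg; apply: I3_cases.
- by apply: polyf_ext hf => x; have [-> _ _] := affuE (f x) (g x).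
- by apply: polyf_ext hg => x; have [_ -> _] := affuE (f x) (g x).
- by apply: polyf_ext (polyfC 1) => x; have [_ _ ->] := affuE (f x) (g x).
Qed.

(** The chart [z = 1] is dense. A point with [z = 0] has [u = 0] or [v = 0]; within its conic it
    moves along [(t v x^2, v, x v)], or the curve with [u] and [v] exchanged, which leaves [z = 0]
    at once. *)
Lemma slice_chart (k : fieldType) (iota : {rmorphism k -> C}) s p (Z : set (pt C K)) :
  slice s p -> zclosed iota Z -> ~ Z p ->
  exists x y b q, [/\ good s (affu x y) (x ^+ 2 + y ^+ 2) b,
    coords q (pvec s (affu x y) (x ^+ 2 + y ^+ 2) b) & ~ Z q].
Proof.
move=> [u [t [b [g pv]]]] hZ nZ.
suff [u' [q [g' z' qv nq]]] : exists u' q, [/\ good s u' t b, cZ u' != 0,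
    coords q (pvec s u' t b) & ~ Z q].
  have zi : (cZ u')^-1 != 0 by rewrite invr_eq0.
  have g2 := good_scale zi g'; have [_ _ E _ _] := g2.
  have [uE tE] : _ /\ _ := affu_of E (etrans (cZZ _ _) (mulVf z')).
  exists (((cZ u')^-1 *: u') 0 ox), (((cZ u')^-1 *: u') 0 oy), b, q.
  by rewrite -uE -tE pvecZ; split=> //; apply: coordsZ.
have [z0|z0] := eqVneq (cZ u) 0; last by exists u, p.
have [s0 u0 E hb hr] := g.
have curve (f : C -> 'rV[C]_3) : (forall i, polyf (fun x => f x 0 i)) -> f 0 = u ->
    (forall x, cU (f x) * cV (f x) = t * cZ (f x) ^+ 2) ->
    (forall x, x != 0 -> cZ (f x) != 0) ->
    exists u' q, [/\ good s u' t b, cZ u' != 0, coords q (pvec s u' t b) & ~ Z q].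
  move=> hf f0 fE fz.
  have c1 : cofinitely (fun x => good s (f x) t b).
    apply: (good_cofinitely (h := fun=> t) (b := fun=> b) (x0 := 0)) => //.
    - exact: polyfC.
    - by move=> j; apply: polyfC.
    - by rewrite f0.
  have c2 : cofinitely (fun x => forall q, coords q (pvec s (f x) t b) -> ~ Z q).
    apply: (curve_notin (g := fun x => pvec s (f x) t b) (x0 := 0) (p := p) _ hZ _ nZ).
      apply: polyf_pvec hf _ _; [|exact: polyfC|]; by move=> j; apply: polyfC.
    by rewrite f0.
  have [x [[h1 h2] x0]] := cofinitely_ex (cofinitely_and (cofinitely_and c1 c2)
    (cofinitely_neq 0)).
  have [s0' fx0 _ _ _] := h1.
  have [q qv] := pt_ex (pvec_neq0 t b s0' fx0).
  by exists (f x), q; split=> //; [exact: fz | exact: h2].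
move: E; rewrite z0 expr0n mulr0 => /eqP; rewrite mulf_eq0 => /orP[/eqP U0|/eqP V0].
  have V0 : cV u != 0 by move: u0; rewrite u_eq0 U0 z0 !eqxx andbT.
  apply: (curve (fun x => uvz (t * cV u * x ^+ 2) (cV u) (x * cV u))).
  - apply: polyf_uvz; first by apply: polyfM (polyfC _) _; apply: polyf_exp; exact: polyfX.
      exact: polyfC.
    by apply: polyfM; [exact: polyfX | exact: polyfC].
  - by apply: uvz_inj; rewrite !uvzE ?expr0n ?mulr0 ?mul0r.
  - by move=> x; rewrite !uvzE; ring.
  - by move=> x x0; rewrite uvzE mulf_neq0.
have U0 : cU u != 0 by move: u0; rewrite u_eq0 V0 z0 !eqxx !andbT.
apply: (curve (fun x => uvz (cU u) (t * cU u * x ^+ 2) (x * cU u))).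
- apply: polyf_uvz; first exact: polyfC.
    by apply: polyfM (polyfC _) _; apply: polyf_exp; exact: polyfX.
  by apply: polyfM; [exact: polyfX | exact: polyfC].
- by apply: uvz_inj; rewrite !uvzE ?expr0n ?mulr0 ?mul0r.
- by move=> x; rewrite !uvzE; ring.
- by move=> x x0; rewrite uvzE mulf_neq0.
Qed.

Lemma polyf_line (a c : C) : polyf (fun x => a + x * (c - a)).
Proof. by apply: polyfD (polyfC _) _; apply: polyfM; [exact: polyfX|exact: polyfC]. Qed.

Lemma good_origin s : s 0 0 = 1 -> good s (affu 0 0) (0 ^+ 2 + 0 ^+ 2) (0 : 'rV[C]_e).
Proof.
have [h1 h2 h3] := affuE 0 0.
move=> s0; split=> //; first exact: affu_neq0.
- exact: affu_conic.
- by move=> l; rewrite mxE expr0n add0r oner_eq0.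
- by case=> j [[_ + _]|[_ + _]]; rewrite !uvzE mulr0 ?addr0 ?subr0 mulr0 => /eqP;
    rewrite oner_eq0.
Qed.

(** Points outside [Z1] and outside [Z2] can be moved into the chart, where the segment in
    [(x, y, b)] joins them. A generic point of it is good and avoids both sets. *)
Lemma slice_irreducible s : s 0 0 = 1 -> zirreducible idfun (@slice R m e s).
Proof.
move=> s0; split.
  have g := good_origin s0; have [_ u0 _ _ _] := g.
  have [p pv] := pt_ex (pvec_neq0 (0 ^+ 2 + 0 ^+ 2) (0 : 'rV[C]_e) s0 u0).
  by exists p, (affu 0 0), (0 ^+ 2 + 0 ^+ 2), 0.
move=> Z1 Z2 hZ1 hZ2 cov; apply: contrapT => /not_orP[].
move=> /existsNP[p1 /not_implyP[X1 n1]] /existsNP[p2 /not_implyP[X2 n2]].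
have [x1 [y1 [b1 [q1 [g1 qv1 nq1]]]]] := slice_chart X1 hZ1 n1.
have [x2 [y2 [b2 [q2 [g2 qv2 nq2]]]]] := slice_chart X2 hZ2 n2.
pose x l := x1 + l * (x2 - x1); pose y l := y1 + l * (y2 - y1).
pose b l : 'rV[C]_e := \row_i (b1 0 i + l * (b2 0 i - b1 0 i)).
pose u l := affu (x l) (y l); pose t l := x l ^+ 2 + y l ^+ 2.
have hu : forall i, polyf (fun l => u l 0 i) by apply: polyf_affu; exact: polyf_line.
have ht : polyf t by apply: polyfD; apply: polyf_exp; exact: polyf_line.
have hb j : polyf (fun l => b l 0 j).
  by apply: polyf_ext (polyf_line (b1 0 j) (b2 0 j)) => l; rewrite mxE.
have e0 : [/\ u 0 = affu x1 y1, t 0 = x1 ^+ 2 + y1 ^+ 2 & b 0 = b1].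
  by split; rewrite /u /t /x /y ?mul0r ?addr0 //; apply/rowP => i; rewrite mxE mul0r addr0.
have e1 : [/\ u 1 = affu x2 y2, t 1 = x2 ^+ 2 + y2 ^+ 2 & b 1 = b2].
  by split; rewrite /u /t /x /y ?mul1r ?addrNK ?subrKC //; apply/rowP => i; rewrite mxE mul1r subrKC.
have c0 : cofinitely (fun l => good s (u l) (t l) (b l)).
  apply: (good_cofinitely (x0 := 0)) => //; first by move=> l; apply: affu_conic.
  by case: e0 => -> -> ->.
have hp := polyf_pvec (fun j => polyfC (s 0 j)) hu ht hb.
have c1 : cofinitely (fun l => forall q, coords q (pvec s (u l) (t l) (b l)) -> ~ Z1 q).
  apply: (curve_notin (g := fun l => pvec s (u l) (t l) (b l)) (x0 := 0) (p := q1) hp hZ1 _ nq1).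
  by case: e0 => -> -> ->.
have c2 : cofinitely (fun l => forall q, coords q (pvec s (u l) (t l) (b l)) -> ~ Z2 q).
  apply: (curve_notin (g := fun l => pvec s (u l) (t l) (b l)) (x0 := 1) (p := q2) hp hZ2 _ nq2).
  by case: e1 => -> -> ->.
have [l [gl [n1' n2']]] := cofinitely_ex (cofinitely_and c0 (cofinitely_and c1 c2)).
have [_ ul _ _ _] := gl; have [q qv] := pt_ex (pvec_neq0 (t l) (b l) s0 ul).
have /cov[|] : slice s q by exists (u l), (t l), (b l).
  exact: n1'.
exact: n2'.
Qed.

End Irreducible.

(** * Preimages of closed sets, and affine space as a variety *)

Section Preimage.
Variables (k C : fieldType) (iota : {rmorphism k -> C}).

Lemma homfun_ext N d (f g : 'rV[C]_N -> C) : f =1 g -> homfun iota d f -> homfun iota d g.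
Proof. by move=> fg [P hP fP]; exists P => // v; rewrite -fg. Qed.

Lemma homfun0 N d : homfun iota d (fun _ : 'rV[C]_N => 0).
Proof.
exists 0; first by rewrite dhomog0.
by move=> v; rewrite /evalp raddf0 meval0.
Qed.

Lemma homfun_sum N d (I : eqType) (r : seq I) (f : I -> 'rV[C]_N -> C) :
  (forall i, i \in r -> homfun iota d (f i)) ->
  homfun iota d (fun v => \sum_(i <- r) f i v).
Proof.
elim: r => [|i r IH] h.
  by apply: homfun_ext (homfun0 N d) => v; rewrite big_nil.
apply: homfun_ext (homfunD (h i (mem_head _ _)) (IH _)) => [v|j jr].
  by rewrite big_cons.
by apply: h; rewrite inE jr orbT.
Qed.

Lemma homfun1 N : homfun iota 0 (fun _ : 'rV[C]_N => 1).
Proof. by exists 1; [rewrite dhomog1 | move=> v; rewrite evalp1]. Qed.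

Lemma homfun_exp N d j (f : 'rV[C]_N -> C) :
  homfun iota d f -> homfun iota (j * d) (fun v => f v ^+ j).
Proof.
move=> h; elim: j => [|j IH]; first by apply: homfun_ext (homfun1 N) => v; rewrite expr0.
by rewrite mulSn; apply: homfun_ext (homfunM h IH) => v; rewrite exprS.
Qed.

Lemma homfun_prod N (I : Type) (r : seq I) (d : I -> nat) (f : I -> 'rV[C]_N -> C) :
  (forall i, homfun iota (d i) (f i)) ->
  homfun iota (\sum_(i <- r) d i) (fun v => \prod_(i <- r) f i v).
Proof.
move=> h; elim: r => [|i r IH].
  by rewrite big_nil; apply: homfun_ext (homfun1 N) => v; rewrite big_nil.
by rewrite big_cons; apply: homfun_ext (homfunM (h i) IH) => v; rewrite big_cons.
Qed.

Lemma homfun_evalp N M d e (F : {mpoly k[M]}) (G : 'rV[C]_N -> 'rV[C]_M) :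
  F \is e.-homog -> (forall i, homfun iota d (fun v => G v 0 i)) ->
  homfun iota (e * d) (fun v => evalp iota F (G v)).
Proof.
move=> /dhomogP hF hG; apply: homfun_ext (fun v => esym (evalpE iota F (G v))) _.
apply: homfun_sum => j jF; apply: homfunZ.
have -> : (e * d = \sum_i j i * d)%N by rewrite -big_distrl -mdegE hF.
by apply: homfun_prod => i; apply: homfun_exp.
Qed.

(** Where [G v = 0] there is no image point and the condition is vacuous, so each equation is
    multiplied by the entries of [G v]. *)
Lemma zclosed_preimage N M d (G : 'rV[C]_N -> 'rV[C]_M) (Z : set (pt C M)) :
  (forall i, homfun iota d (fun v => G v 0 i)) -> zclosed iota Z ->
  zclosed iota [set p | forall v q, coords p v -> coords q (G v) -> Z q].
Proof.
move=> hG [S hS ->].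
have -> : [set p : pt C N | forall v q, coords p v -> coords q (G v) ->
    [set p' | forall F, S F -> vanishes iota F p'] q] =
  [set p | forall (q : {F | S F} * 'I_M) v, coords p v ->
     evalp iota (sval q.1) (G v) * G v 0 q.2 = 0].
  apply/seteqP; split=> p /= hp.
    move=> [[F SF] i] v pv /=; have [/eqP|G0] := boolP (G v == 0).
      by move=> ->; rewrite mxE mulr0.
    have [q qv] := pt_ex G0.
    by rewrite (hp v q pv qv F SF (G v) qv) mul0r.
  move=> v q pv qv F SF w qw.
  have /rV0Pn[i Gi] := coords_neq0 qv.
  apply: (vanishes_at (hS F SF) qv _ qw); apply/eqP.
  have := hp (exist _ F SF, i) v pv; rewrite /= => /eqP.
  by rewrite mulf_eq0 (negbTE Gi) orbF.
have /choice[dg hdg] (q : {F | S F} * 'I_M) : exists e, sval q.1 \is e.-homog.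
  by case: q => [[F SF] i] /=; exact: hS.
apply: (zclosed_homfun (e := fun q => dg q * d + d)%N) => q.
by apply: homfunM => //; apply: homfun_evalp.
Qed.

Lemma affine_coords d (p : pt C (1 + d)) w : affine_space C d p -> coords p w ->
  exists c a, c != 0 /\ w = c *: row_mx 1%:M a.
Proof.
by move=> [a pa] pw; have [c c0 ->] := coords_prop pa pw; exists c, a.
Qed.

Lemma affineP d (p : pt C (1 + d)) v : coords p v ->
  affine_space C d p <-> v 0 (lshift d 0) != 0.
Proof.
move=> pv; split=> [/affine_coords /(_ pv) [c [a [c0 ->]]]|v0].
  by rewrite mxE row_mxEl mxE mulr1.
exists ((v 0 (lshift d 0))^-1 *: rsubmx v).
have -> : row_mx 1%:M ((v 0 (lshift d 0))^-1 *: rsubmx v) = (v 0 (lshift d 0))^-1 *: v.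
  rewrite -[v in RHS]hsubmxK scale_row_mx; congr row_mx; last by rewrite hsubmxK.
  apply/rowP => i; rewrite (ord1 i) [LHS]mxE [RHS]mxE hsubmxK [lsubmx _ _ _]mxE mulVf //.
by apply: coordsZ; rewrite ?invr_eq0.
Qed.

Lemma affine_quasi_projective d : quasi_projective iota (affine_space C d).
Proof.
exists setT, [set p | forall (_ : unit) v, coords p v -> v 0 (lshift d 0) = 0]; split.
- exact: zclosedT.
- by apply: (zclosed_homfun (e := fun=> 1%N)) => _; exact: homfunX.
apply/seteqP; split=> p.
  move=> Ap; split=> // h; have [v pv] := coords_ex p.
  by have /(affineP pv) := Ap; rewrite (h tt v pv) eqxx.
move=> [_ h]; have [v pv] := coords_ex p; apply/(affineP pv).
apply: contra_notN h => /eqP v0 _ w pw.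
by have [a _ ->] := coords_prop pv pw; rewrite mxE v0 mulr0.
Qed.

Lemma affine_smooth d : smooth_of_dim d (affine_space C d).
Proof.
move=> p Ap.
(* Zero equations suffice, affine space being open in projective space; [W] is the hyperplane at
   infinity. *)
exists 0%N, (fun=> 0), [set p | forall (_ : unit) v, coords p v -> v 0 (lshift d 0) = 0].
have [v pv] := coords_ex p; split.
- by split=> // -[].
- split; first by apply: (zclosed_homfun (e := fun=> 1%N)) => _; exact: homfunX.
  by move=> /(_ tt v pv) /eqP; apply/negP; apply/(affineP pv).
- apply/seteqP; split=> q [h1 h2]; split=> //; first by case.
  have [w qw] := coords_ex q; apply/(affineP qw); apply: contra_notN h2 => /eqP w0 _ w' qw'.
  by have [a _ ->] := coords_prop qw qw'; rewrite mxE w0 mulr0.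
- by move=> w _; rewrite /row_free [X in \rank X]flatmx0 mxrank0.
Qed.

End Preimage.

Lemma polyf_affine_line (C : numClosedFieldType) d (a c : 'rV[C]_d) i :
  polyf (fun x => (row_mx 1%:M (a + x *: (c - a)) : 'rV_(1 + d)) 0 i).
Proof.
case: (split_ordP i) => j ->.
  by apply: polyf_ext (polyfC _) => x; rewrite row_mxEl.
apply: (@polyf_ext _ (fun x => a 0 j + x * (c 0 j - a 0 j))).
  by move=> x; rewrite row_mxEr !mxE.
by apply: polyfD (polyfC _) _; apply: polyfM; [exact: polyfX|exact: polyfC].
Qed.

Lemma row_mx1_neq0 (C : fieldType) d (a : 'rV[C]_d) : row_mx 1%:M a != 0 :> 'rV_(1 + d).
Proof.
apply/eqP => /rowP/(_ (lshift d 0)); rewrite row_mxEl !mxE => /eqP.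
by rewrite oner_eq0.
Qed.

Lemma affine_irreducible (C : numClosedFieldType) d : zirreducible idfun (affine_space C d).
Proof.
split.
  by have [p pv] := pt_ex (row_mx1_neq0 (0 : 'rV[C]_d)); exists p, 0.
move=> Z1 Z2 hZ1 hZ2 cov; apply: contrapT => /not_orP[].
move=> /existsNP[p1 /not_implyP[[a1 pa1] n1]] /existsNP[p2 /not_implyP[[a2 pa2] n2]].
have hp := polyf_affine_line a1 a2.
pose g x : 'rV[C]_(1 + d) := row_mx 1%:M (a1 + x *: (a2 - a1)).
have c1 : cofinitely (fun x => forall q, coords q (g x) -> ~ Z1 q).
  by apply: (curve_notin (x0 := 0) hp hZ1 _ n1); rewrite scale0r addr0.
have c2 : cofinitely (fun x => forall q, coords q (g x) -> ~ Z2 q).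
  by apply: (curve_notin (x0 := 1) hp hZ2 _ n2); rewrite scale1r subrKC.
have [x [n1' n2']] := cofinitely_ex (cofinitely_and c1 c2).
have [q qv] := pt_ex (row_mx1_neq0 (a1 + x *: (a2 - a1))).
have /cov[|] : affine_space C d q by exists (a1 + x *: (a2 - a1)).
  exact: n1'.
exact: n2'.
Qed.

Lemma affine_real_variety (R : realType) d : real_variety (affine_space R[i] d).
Proof. by split; [exact: affine_quasi_projective | exact: affine_irreducible]. Qed.

(** * The real chart [z = 1] and affine space *)

Section Birational.
Variable R : realType.
Local Notation C := R[i].
Local Notation RtoC := (real_complex R : {rmorphism R -> C}).
Local Notation cj := (@cj R).
Local Notation ii := (ii R).
Variables (m e : nat).
Local Notation n := ((1 + m) + (1 + e))%N.
Local Notation K := (3 * n)%N.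
Local Notation total_space := (@total_space R m e).
Local Notation js := (@js m e).
Local Notation jt := (jt m e).
Implicit Types (u : 'rV[C]_3) (s : 'rV[C]_(1 + m)) (t : C) (b : 'rV[C]_e).

Lemma cj_fixed (x : C) : cj x = x -> exists r, x = RtoC r.
Proof.
case: x => a c /eqP; rewrite eq_complex /= => /andP[_ /eqP h]; exists a.
apply/eqP; rewrite eq_complex eqxx /=.
have : c *+ 2 == 0 by rewrite mulr2n -{1}h addNr.
by rewrite mulrn_eq0.
Qed.

Lemma cj_fixed_sqr (x y : C) : cj x = x -> cj y = y -> x ^+ 2 + y ^+ 2 = 0 ->
  x = 0 /\ y = 0.
Proof.
move=> /cj_fixed[r ->] /cj_fixed[r' ->]; rewrite -!rmorphXn -rmorphD.
move=> /eqP; rewrite fmorph_eq0 paddr_eq0 ?sqr_ge0 // !sqrf_eq0.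
by move=> /andP[/eqP -> /eqP ->]; rewrite rmorph0.
Qed.

Lemma cj_fixed_sqr1 (x : C) : cj x = x -> x ^+ 2 + 1 != 0.
Proof.
move=> rx; apply/eqP; rewrite -[1](expr1n _ 2) => /(cj_fixed_sqr rx (@cj1 R))[_ /eqP].
by rewrite oner_eq0.
Qed.

(** [z * cj z] is real, so the left side is purely imaginary and cannot be a nonzero real number. It
    shows that no real point is removed. *)
Lemma tj_norm_neq (j : 'I_(1 + m)) z (c : C) : cj c = c -> c != 0 -> tj R j * (z * cj z) <> c.
Proof.
move=> cc c0 h; have := congr1 cj h.
rewrite cjM tj_conj cjM cjK [cj z * z]mulrC mulNr h cc => h'.
move: c0; have : c *+ 2 == 0 by rewrite mulr2n -{1}h' addNr.
by rewrite mulrn_eq0 /= => ->.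
Qed.

(** Turns goodness into the complement of a set already known to be closed over the reals. *)
Lemma good_excluded s u t b p : s 0 0 = 1 -> u != 0 -> cU u * cV u = t * cZ u ^+ 2 ->
  coords p (pvec s u t b) -> good s u t b <-> ~ @excluded R m e p.
Proof.
move=> s0 u0 E pv; split=> [g|nx].
  have /total_equations[_ [_ //]] : total_space p by exists s, u, t, b.
have : total_space p.
  apply/total_equations; split; [|split=> //].
  - move=> [[i j] [i' j']] v pv'; have [a _ ->] := coords_prop pv pv'.
    by rewrite -pvecZ /segre_eq /ent !pvecE /=; ring.
  - move=> i v pv'; have [a _ ->] := coords_prop pv pv'.
    rewrite -pvecZ /conic_eq /ent !pvec_0 // pvec_t !mxE.
    have E' : u 0 ox * u 0 ox + u 0 oy * u 0 oy = t * u 0 oz ^+ 2.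
      by rewrite -[RHS]E cUVE !expr2.
    transitivity (a ^+ 3 * u 0 i * (u 0 ox * u 0 ox + u 0 oy * u 0 oy - t * u 0 oz ^+ 2)).
      by ring.
    by rewrite E' subrr mulr0.
move=> /total_coords/(_ pv)[s' [u' [t' [b' [g' vE]]]]]; have [s0' _ _ _ _] := g'.
by have [-> -> -> ->] := pvec_inj s0 s0' u0 vE.
Qed.

Definition avec (z x y : C) b : 'rV[C]_(1 + (2 + e)) :=
  row_mx z%:M (row_mx (row_mx x%:M y%:M : 'rV_2) b).
Definition a0 : 'I_(1 + (2 + e)) := lshift (2 + e) 0.
Definition ax : 'I_(1 + (2 + e)) := rshift 1 (lshift e (lshift 1 (0 : 'I_1))).
Definition ay : 'I_(1 + (2 + e)) := rshift 1 (lshift e (rshift 1 (0 : 'I_1))).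
Definition ab (l : 'I_e) : 'I_(1 + (2 + e)) := rshift 1 (rshift 2 l).

Lemma avecE z x y b : [/\ avec z x y b 0 a0 = z, avec z x y b 0 ax = x,
  avec z x y b 0 ay = y & forall l, avec z x y b 0 (ab l) = b 0 l].
Proof.
split.
- by rewrite row_mxEl mxE mulr1n.
- by rewrite row_mxEr row_mxEl (row_mxEl x%:M) mxE mulr1n.
- by rewrite row_mxEr row_mxEl (row_mxEr x%:M) mxE mulr1n.
- by move=> l; rewrite !row_mxEr.
Qed.

Lemma avec_cases (P : 'I_(1 + (2 + e)) -> Prop) :
  P a0 -> P ax -> P ay -> (forall l, P (ab l)) -> forall j, P j.
Proof.
move=> h0 hx hy hb j; case: (split_ordP j) => [k ->|k ->].
  by rewrite (ord1 k).
case: (split_ordP k) => [l ->|l ->]; last exact: hb.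
by case: (@split_ordP 1 1 l) => [o ->|o ->]; rewrite (ord1 o).
Qed.

Lemma avecZ a z x y b : avec (a * z) (a * x) (a * y) (a *: b) = a *: avec z x y b.
Proof.
have [h1 h2 h3 h4] := avecE z x y b.
have [k1 k2 k3 k4] := avecE (a * z) (a * x) (a * y) (a *: b).
by apply/rowP; apply: avec_cases => [|||l]; rewrite [RHS]mxE ?h1 ?h2 ?h3 ?h4 ?k1 ?k2 ?k3 ?k4 ?mxE.
Qed.

Lemma avec_eta (w : 'rV[C]_(1 + (2 + e))) :
  w = avec (w 0 a0) (w 0 ax) (w 0 ay) (\row_l w 0 (ab l)).
Proof.
have [h1 h2 h3 h4] := avecE (w 0 a0) (w 0 ax) (w 0 ay) (\row_l w 0 (ab l)).
by apply/rowP; apply: avec_cases => [|||l]; rewrite ?h1 ?h2 ?h3 ?h4 ?mxE.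
Qed.

Lemma avec_affine p : affine_space C (2 + e) p <-> exists x y b, coords p (avec 1 x y b).
Proof.
split=> [[a pa]|[x [y [b pv]]]].
  move: pa; rewrite [row_mx _ a]avec_eta [row_mx _ a 0 a0]row_mxEl mxE => pa.
  by do 3!eexists; exact: pa.
by exists (row_mx (row_mx x%:M y%:M : 'rV_2) b).
Qed.

Lemma avec_neq0 z x y b : z != 0 -> avec z x y b != 0.
Proof.
have [h1 _ _ _] := avecE z x y b.
by apply: contraNneq => h; rewrite -h1 h mxE.
Qed.

Lemma polyfun_pvec (k : fieldType) (iota : {rmorphism k -> C}) N
    (g : 'rV[C]_N -> 'rV[C]_(1 + m)) (f : 'rV[C]_N -> 'rV[C]_3)
    (h : 'rV[C]_N -> C) (b : 'rV[C]_N -> 'rV[C]_e) :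
  (forall j, polyfun iota (fun v => g v 0 j)) ->
  (forall j, polyfun iota (fun v => f v 0 j)) -> polyfun iota h ->
  (forall j, polyfun iota (fun v => b v 0 j)) ->
  forall j, polyfun iota (fun v => pvec (g v) (f v) (h v) (b v) 0 j).
Proof.
move=> hg hf hh hb j; case/mxvec_indexP: j => i j.
apply: polyfun_ext (fun v => esym (pvecE _ _ _ _ i j)) _; apply: polyfunM => //.
move: j; apply: js_cases => [j||l].
- by apply: polyfun_ext (hg j) => v; rewrite base_s.
- by apply: polyfun_ext hh => v; rewrite base_t.
- by apply: polyfun_ext (hb l) => v; rewrite base_b.
Qed.

Lemma homfun_pvec (k : fieldType) (iota : {rmorphism k -> C}) N d d'
    (g : 'rV[C]_N -> 'rV[C]_(1 + m)) (f : 'rV[C]_N -> 'rV[C]_3)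
    (h : 'rV[C]_N -> C) (b : 'rV[C]_N -> 'rV[C]_e) :
  (forall j, homfun iota d' (fun v => g v 0 j)) ->
  (forall j, homfun iota d (fun v => f v 0 j)) -> homfun iota d' h ->
  (forall j, homfun iota d' (fun v => b v 0 j)) ->
  forall j, homfun iota (d + d') (fun v => pvec (g v) (f v) (h v) (b v) 0 j).
Proof.
move=> hg hf hh hb j; case/mxvec_indexP: j => i j.
apply: homfun_ext (fun v => esym (pvecE _ _ _ _ i j)) _; apply: homfunM => //.
move: j; apply: js_cases => [j||l].
- by apply: homfun_ext (hg j) => v; rewrite base_s.
- by apply: homfun_ext hh => v; rewrite base_t.
- by apply: homfun_ext (hb l) => v; rewrite base_b.
Qed.

Variable r : 'rV[R]_(1 + m).
Hypothesis r0 : r 0 0 = 1.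
Local Notation s := (map_mx RtoC r).

Lemma s00 : s 0 0 = 1. Proof. by rewrite mxE r0 rmorph1. Qed.

Definition afft (x y : C) : C := x ^+ 2 + y ^+ 2.

Definition slice_chart_set : set (pt C K) :=
  [set p | exists x y b, good s (affu x y) (afft x y) b /\
     coords p (pvec s (affu x y) (afft x y) b)].
Definition affine_chart_set : set (pt C (1 + (2 + e))) :=
  [set q | exists x y b, good s (affu x y) (afft x y) b /\ coords q (avec 1 x y b)].

Lemma slice_chart_setP p : slice_chart_set p <->
  slice s p /\ exists2 v, coords p v & cZ (colv v (js 0)) != 0.
Proof.
split=> [[x [y [b [g pv]]]]|[sp [v pv]]].
  split; first by exists (affu x y), (afft x y), b.
  exists (pvec s (affu x y) (afft x y) b) => //.
  by rewrite col0_pvec ?s00 // uvzE oner_eq0.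
have [u [t [b [g vE]]]] := slice_coords sp pv.
rewrite vE col0_pvec ?s00 // => z0; have zi : (cZ u)^-1 != 0 by rewrite invr_eq0.
have g2 := good_scale zi g; have [_ _ E _ _] := g2.
have [uE tE] := affu_of E (etrans (cZZ _ _) (mulVf z0)).
exists (((cZ u)^-1 *: u) 0 ox), (((cZ u)^-1 *: u) 0 oy), b.
by rewrite /afft -uE -tE; split=> //; rewrite pvecZ; apply: coordsZ => //; rewrite -vE.
Qed.

Lemma slice_chart_dense : dense_open RtoC (slice s) slice_chart_set.
Proof.
split.
  exists [set p | forall (_ : unit) v, coords p v -> ent v oz (js 0) = 0].
    by apply: (zclosed_homfun (e := fun=> 1%N)) => _; exact: homfun_ent.
  apply/seteqP; split=> p.
    move=> /slice_chart_setP[sp [v pv z0]]; split=> // /(_ tt v pv) z1.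
    by move: z0; rewrite /cZ mxE z1 eqxx.
  move=> [sp nz]; apply/slice_chart_setP; split=> //.
  have [v pv] := coords_ex p; exists v => //; apply: contra_notN nz => /eqP z0 _ w pw.
  apply: homfun_all (homfun_ent RtoC oz (js 0)) pv _ pw.
  by move: z0; rewrite /cZ mxE.
move=> Z hZ UZ p sp; apply: contrapT => nZ.
have [x [y [b [q [g qv nq]]]]] := slice_chart sp hZ nZ.
by apply: nq; apply: UZ; exists x, y, b.
Qed.

(** The map [(x, y, b) |-> pvec s (affu x y) (x^2 + y^2) b] homogenized with the coordinate
    [w 0 a0]: the vector [u] has degree 1, the base part degree 2, the product degree 3. *)
Definition hvec (w : 'rV[C]_(1 + (2 + e))) : 'rV[C]_K :=
  pvec (w 0 a0 ^+ 2 *: s) (\row_i if i == ox then w 0 ax else if i == oy then w 0 ay else w 0 a0)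
    (w 0 ax ^+ 2 + w 0 ay ^+ 2) (\row_l (w 0 a0 * w 0 (ab l))).

Lemma affu_row (x y : C) : affu x y = \row_i if i == ox then x else if i == oy then y else 1.
Proof.
have [h1 h2 h3] := affuE x y.
by apply/rowP; apply: I3_cases; rewrite mxE /=.
Qed.

Lemma hvecE c (x y : C) b : hvec (c *: avec 1 x y b) = c ^+ 3 *: pvec s (affu x y) (afft x y) b.
Proof.
have [h1 h2 h3 h4] := avecE (c * 1) (c * x) (c * y) (c *: b).
rewrite -avecZ /hvec h1 h2 h3 affu_row; rewrite mulr1 in h4 *.
have E3 (p q : C) : c ^+ 3 * (p * q) = (c * p) * (c ^+ 2 * q) by ring.
apply: vecP => i j; rewrite [RHS]mxE !pvecE E3; congr (_ * _).
  by rewrite !mxE; case: eqP => _; [|case: eqP => _] => //; rewrite mulr1.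
move: j; apply: js_cases => [j||l]; rewrite ?base_s ?base_t ?base_b.
- by rewrite mxE.
- by rewrite /afft; ring.
- by rewrite mxE h4 mxE; ring.
Qed.

Lemma homfun_hvec j : homfun RtoC 3 (fun w => hvec w 0 j).
Proof.
have hX i : homfun RtoC 1 (fun w : 'rV[C]_(1 + (2 + e)) => w 0 i) by exact: homfunX.
have h2 i : homfun RtoC 2 (fun w : 'rV[C]_(1 + (2 + e)) => w 0 i ^+ 2).
  exact: (homfun_exp 2 (hX i)).
apply: (homfun_pvec (d := 1) (d' := 2)) => [k|k||k].
- apply: homfun_ext (homfunZ (r 0 k) (h2 a0)) => w.
  by rewrite !mxE mulrC.
- by apply: homfun_ext (hX (if k == ox then ax else if k == oy then ay else a0)) => w;
    rewrite mxE; case: ifP => // _; case: ifP.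
- exact: homfunD.
- apply: homfun_ext (homfunM (hX a0) (hX (ab k))) => w.
  by rewrite mxE.
Qed.

(** The complement is the preimage of [excluded] under [hvec], hence closed over the reals. *)
Lemma affine_chart_dense : dense_open RtoC (affine_space C (2 + e)) affine_chart_set.
Proof.
split.
  exists [set q | forall w p, coords q w -> coords p (hvec w) -> @excluded R m e p].
    by apply: zclosed_preimage homfun_hvec _; exact: excluded_closed.
  apply/seteqP; split=> q.
    move=> [x [y [b [g qv]]]]; split; first by apply/avec_affine; exists x, y, b.
    have [p pv] := pt_ex (pvec_neq0 (afft x y) b s00 (affu_neq0 x y)).
    move=> /(_ _ p qv); rewrite -[avec _ _ _ _]scale1r hvecE expr1n scale1r => /(_ pv).
    by move/(good_excluded s00 (affu_neq0 x y) (affu_conic x y) pv): g.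
  move=> [/avec_affine[x [y [b qv]]] nP]; exists x, y, b; split=> //.
  have [p pv] := pt_ex (pvec_neq0 (afft x y) b s00 (affu_neq0 x y)).
  apply/(good_excluded s00 (affu_neq0 x y) (affu_conic x y) pv) => xp.
  apply: nP => w p' qw; have [c c0 ->] := coords_prop qv qw; rewrite hvecE => pv'.
  suff -> : p' = p by [].
  by apply: coords_inj pv' _; apply: coordsZ => //; rewrite expf_neq0.
move=> Z hZ UZ q /avec_affine[x [y [b qv]]]; apply: contrapT => nZ.
(* For density, the given point is joined to the origin, which is good for every slice. *)
pose X l := x + l * (0 - x); pose Y l := y + l * (0 - y).
pose B l : 'rV[C]_e := \row_i (b 0 i + l * (0 - b 0 i)).
have hB j : polyf (fun l => B l 0 j).
  by apply: polyf_ext (polyf_line (b 0 j) 0) => l; rewrite mxE.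
have hX : polyf X by exact: polyf_line.
have hY : polyf Y by exact: polyf_line.
have c1 : cofinitely (fun l => good s (affu (X l) (Y l)) (afft (X l) (Y l)) (B l)).
  apply: (good_cofinitely (x0 := 1)) => //.
  - exact: polyf_affu.
  - by apply: polyfD; exact: polyf_exp.
  - by move=> l; apply: affu_conic.
  have -> : B 1 = 0 by apply/rowP => i; rewrite !mxE mul1r sub0r subrr.
  by rewrite /X /Y !mul1r !sub0r !subrr; apply: good_origin s00.
have c2 : cofinitely (fun l => forall q, coords q (avec 1 (X l) (Y l) (B l)) -> ~ Z q).
  apply: (curve_notin (g := fun l => avec 1 (X l) (Y l) (B l)) (x0 := 0) (p := q) _ hZ _ nZ).
    apply: avec_cases => [|||l].
    - by apply: polyf_ext (polyfC 1) => l; have [-> _ _ _] := avecE 1 (X l) (Y l) (B l).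
    - by apply: polyf_ext hX => l; have [_ -> _ _] := avecE 1 (X l) (Y l) (B l).
    - by apply: polyf_ext hY => l; have [_ _ -> _] := avecE 1 (X l) (Y l) (B l).
    - by apply: polyf_ext (hB l) => l'; have [_ _ _ ->] := avecE 1 (X l') (Y l') (B l').
  have -> : B 0 = b by apply/rowP => i; rewrite !mxE mul0r addr0.
  by rewrite /X /Y !mul0r !addr0.
have [l [g n]] := cofinitely_ex (cofinitely_and c1 c2).
have [q' q'v] := pt_ex (avec_neq0 (X l) (Y l) (B l) (oner_neq0 C)).
by apply: (n q' q'v); apply: UZ; exists (X l), (Y l), (B l).
Qed.

Lemma rational_coords N (X : set (pt C N)) p : rational_points RtoC X p ->
  X p /\ exists2 v, coords p v & forall i, cj (v 0 i) = v 0 i.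
Proof.
move=> [Xp [v pv]]; split=> //; exists (map_mx RtoC v) => // i.
by rewrite mxE cj_real.
Qed.

(** At a real point [z = 0] forces [x^2 + y^2 = 0], so all of [u] would vanish. *)
Lemma rational_slice_chart : rational_points RtoC (slice s) `<=` slice_chart_set.
Proof.
move=> p /rational_coords[sp [v pv rv]]; apply/slice_chart_setP; split=> //.
exists v => //; have [u [t [b [g vE]]]] := slice_coords sp pv.
have ru i : cj (u 0 i) = u 0 i.
  by have := rv (mxvec_index i (js 0)); rewrite vE pvec_0 ?s00.
have [_ u0 E _ _] := g.
rewrite vE col0_pvec ?s00 //; apply: contraNneq u0 => z0.
move: E; rewrite cUVE z0 expr0n mulr0 => /(cj_fixed_sqr (ru ox) (ru oy))[x0 y0].
by apply/eqP/rowP; apply: I3_cases; rewrite mxE.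
Qed.

Lemma rational_affine_chart :
  rational_points RtoC (affine_space C (2 + e)) `<=` affine_chart_set.
Proof.
move=> q /rational_coords[Aq [w qw rw]].
have [x [y [b qv]]] : exists x y b, coords q (avec 1 x y b) by apply/avec_affine.
have [c c0 wE] := coords_prop qv qw.
have [h1 h2 h3 h4] := avecE 1 x y b.
have rc : cj c = c by have := rw a0; rewrite wE mxE h1 mulr1.
have real z i : avec 1 x y b 0 i = z -> cj z = z.
  move=> zE; apply: (mulfI c0); have := rw i; rewrite wE mxE zE.
  by rewrite cjM rc.
have rx := real x ax h2; have ry := real y ay h3.
have rb l : cj (b 0 l) = b 0 l by apply: (real _ (ab l)).
exists x, y, b; split=> //; split.
- exact: s00.
- exact: affu_neq0.
- exact: affu_conic.
- by move=> l; apply: cj_fixed_sqr1.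
have UV : cj (cU (affu x y)) = cV (affu x y).
  by rewrite !uvzE cjD cjM cj_ii rx ry mulNr.
have VU : cj (cV (affu x y)) = cU (affu x y) by rewrite -UV cjK.
(* At a real point [V] is the conjugate of [U]; with [Z = 1] the two removed conditions give
   [tj j * |w|^2 = -1] and [tj j * |w|^2 = 1]. *)
case=> j [] [tE zE uE]; move: zE uE; rewrite cZ_uvz mulr1 tE => zE uE.
  apply: (@tj_norm_neq j (s 0 j + ii) (-1)); first by rewrite cjN cj1.
    by rewrite oppr_eq0 oner_eq0.
  apply: oppr_inj; rewrite opprK zE -UV uE cjM tj_conj; ring.
apply: (@tj_norm_neq j (s 0 j - ii) 1); [exact: cj1|exact: oner_neq0|].
by rewrite [RHS]zE -VU uE cjM cjN tj_conj; ring.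
Qed.

End Birational.

Section ChartMaps.
Variable R : realType.
Local Notation C := R[i].
Local Notation RtoC := (real_complex R : {rmorphism R -> C}).
Local Notation ii := (ii R).
Variables (m e : nat) (r : 'rV[R]_(1 + m)).
Hypothesis r0 : r 0 0 = 1.
Local Notation n := ((1 + m) + (1 + e))%N.
Local Notation K := (3 * n)%N.
Local Notation js := (@js m e).
Local Notation s := (map_mx RtoC r).
Local Notation s00 := (s00 r0).
Local Notation A := (affine_space C (2 + e)).
Local Notation X := (@slice R m e s).
Local Notation U := (@slice_chart_set R m e r).
Local Notation V := (@affine_chart_set R m e r).
Local Notation a0 := (a0 e).
Local Notation ax := (ax e).
Local Notation ay := (ay e).
Local Notation ab := (@ab e).

Lemma slice_point : exists p : pt C K, X p.
Proof.
have g := good_origin e s00; have [_ u0 _ _ _] := g.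
have [p pv] := pt_ex (pvec_neq0 (0 ^+ 2 + 0 ^+ 2) (0 : 'rV[C]_e) s00 u0).
by exists p, (affu 0 0), (0 ^+ 2 + 0 ^+ 2), 0.
Qed.

Lemma slice_rational_point : rational_points RtoC X !=set0.
Proof.
have g := good_origin e s00; have [_ u0 _ _ _] := g.
have [p pv] := pt_ex (pvec_neq0 (0 ^+ 2 + 0 ^+ 2) (0 : 'rV[C]_e) s00 u0).
exists p; split; first by exists (affu 0 0), (0 ^+ 2 + 0 ^+ 2), 0.
(* The origin of the chart: [x = y = 0], [z = 1], [t = 0], [b = 0]. Only row [oz] of the matrix is
   nonzero. *)
exists (mxvec (\matrix_(i, j) (if i == oz then if split j is inl k then r 0 k else 0 else 0))).
rewrite [map_mx _ _](_ : _ = pvec s (affu 0 0) (0 ^+ 2 + 0 ^+ 2) (0 : 'rV[C]_e)) //.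
have [h1 h2 h3] := affuE (0 : C) 0.
have uE i : affu 0 0 0 i = (i == oz)%:R :> C by move: i; apply: I3_cases.
apply: vecP => i j; rewrite pvecE uE mxE mxvecE mxE.
case: eqP => _; last by rewrite mul0r rmorph0.
rewrite mul1r; move: j; apply: js_cases => [j||l].
- by rewrite base_s (unsplitK (inl j)) [RHS]mxE.
- by rewrite base_t (unsplitK (inr _)) rmorph0 expr0n addr0.
- by rewrite base_b (unsplitK (inr _)) rmorph0 mxE.
Qed.

Lemma affine_rational_point : rational_points RtoC A !=set0.
Proof.
have [p pv] := pt_ex (row_mx1_neq0 (0 : 'rV[C]_(2 + e))).
exists p; split; first by exists 0.
exists (row_mx 1%:M 0).
by rewrite map_row_mx map_mx1 map_mx0.
Qed.

Lemma chart_maps : exists f g, inverse_rational_maps RtoC X A U f V g.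
Proof.
have [q0 _] := affine_rational_point; have [p0 _] := slice_point.
have [q0' _] : exists q : pt C (1 + (2 + e)), A q by case: affine_rational_point => q [Aq _]; exists q.
pose G (u : 'rV[C]_3) (s' : 'rV[C]_(1 + m)) (t : C) (b : 'rV[C]_e) :=
  avec (cZ u) (u 0 ox) (u 0 oy) (cZ u *: b).
(* [G] can vanish where [z = 0], so an arbitrary nonzero value is used there; these points lie
   outside [slice_chart_set]. *)
pose G' u s' t b := if cZ u == 0 then avec 1 0 0 0 else G u s' t b.
have [f hf] : exists f : pt C K -> pt C (1 + (2 + e)), forall p s u t b, good s u t b ->
    coords p (pvec s u t b) -> coords (f p) (G' u s t b).
  apply: (total_map_ex q0' (G := G')) => [s' u t b _|s' u t b a _ na]; rewrite /G'.
    by have [_|z0] := eqVneq (cZ u) 0; rewrite ?/G avec_neq0 ?oner_neq0.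
  rewrite cZZ mulf_eq0 (negbTE na) /=; case: (cZ u =P 0) => _.
    by exists 1; rewrite scale1r.
  by exists a; rewrite /G cZZ !mxE -scalerA avecZ.
have fE p x y b : good s (affu x y) (afft x y) b ->
    coords p (pvec s (affu x y) (afft x y) b) -> coords (f p) (avec 1 x y b).
  move=> g pv; have := hf _ _ _ _ _ g pv; have [h1 h2 _] := affuE x y.
  by rewrite /G' /G cZ_uvz (negbTE (oner_neq0 C)) h1 h2 scale1r.
pose F (w : 'rV[C]_(1 + (2 + e))) := pvec s (affu (w 0 ax / w 0 a0) (w 0 ay / w 0 a0))
   (afft (w 0 ax / w 0 a0) (w 0 ay / w 0 a0)) (\row_l (w 0 (ab l) / w 0 a0)).
have FE c x y b : c != 0 -> F (c *: avec 1 x y b) = pvec s (affu x y) (afft x y) b.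
  move=> c0; rewrite /F -avecZ mulr1; have [-> -> -> h] := avecE c (c * x) (c * y) (c *: b).
  have ck z : c * z / c = z by rewrite mulrC mulKf.
  rewrite !ck; congr pvec.
  by apply/rowP => l; rewrite mxE h mxE ck.
have [g hg] : exists g, forall p v, A p -> coords p v -> coords (g p) (F v).
  apply: (pt_map_ex p0 (X := A) (F := F)) => [p v|p v a] /avec_affine[x [y [b pv]]] pv';
    have [c c0 ->] := coords_prop pv pv'.
    by rewrite FE //; apply: pvec_neq0; [exact: s00|exact: affu_neq0].
  by move=> na; exists 1; rewrite scalerA !FE ?mulf_neq0 // scale1r.
have gE q x y b : coords q (avec 1 x y b) -> coords (g q) (pvec s (affu x y) (afft x y) b).
  move=> qv; rewrite -(FE 1) ?oner_neq0 // scale1r; apply: hg => //.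
  by apply/avec_affine; exists x, y, b.
have UX : U `<=` X by move=> p /(slice_chart_setP r0) [].
have VA : V `<=` A by move=> p [x [y [b [_ pv]]]]; apply/avec_affine; exists x, y, b.
have fU p : U p -> [/\ V (f p) & g (f p) = p].
  move=> [x [y [b [gd pv]]]]; have fv := fE _ _ _ _ gd pv; split.
    by exists x, y, b.
  exact: coords_inj (gE _ _ _ _ fv) pv.
have gV q : V q -> [/\ U (g q) & f (g q) = q].
  move=> [x [y [b [gd qv]]]]; have gv := gE _ _ _ _ qv; split.
    by exists x, y, b.
  exact: coords_inj (fE _ _ _ _ gd gv) qv.
exists f, g; split.
- split; first exact: slice_chart_dense.
  apply: (total_morphism (G := G)).
  + by move=> p /UX; exact: slice_total.
  + move=> i; have hent j k : polyfun RtoC (fun v : 'rV[C]_K => ent v j k) by exact: polyfunX.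
    apply: avec_cases => [|||l].
    * apply: polyfun_ext (hent oz (js 0)) => v.
      by have [-> _ _ _] := avecE (cZ (colv v (js 0))) (colv v (js 0) 0 ox)
        (colv v (js 0) 0 oy) (cZ (colv v (js 0)) *: bv v i); rewrite /cZ mxE.
    * apply: polyfun_ext (hent ox (js 0)) => v.
      by have [_ -> _ _] := avecE (cZ (colv v (js 0))) (colv v (js 0) 0 ox)
        (colv v (js 0) 0 oy) (cZ (colv v (js 0)) *: bv v i); rewrite mxE.
    * apply: polyfun_ext (hent oy (js 0)) => v.
      by have [_ _ -> _] := avecE (cZ (colv v (js 0))) (colv v (js 0) 0 ox)
        (colv v (js 0) 0 oy) (cZ (colv v (js 0)) *: bv v i); rewrite mxE.
    * apply: polyfun_ext (polyfunM (hent oz (js 0)) (hent i (jb m l))) => v.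
      have [_ _ _ ->] := avecE (cZ (colv v (js 0))) (colv v (js 0) 0 ox)
        (colv v (js 0) 0 oy) (cZ (colv v (js 0)) *: bv v i).
      by rewrite /cZ !mxE.
  + move=> p u s' t b /(slice_chart_setP r0)[sp [v pv z0]] gd pv'.
    have [s0' _ _ _ _] := gd; have [a _ vE] := coords_prop pv' pv.
    have zu : cZ u != 0.
      move: z0; rewrite vE -pvecZ col0_pvec // cZZ mulf_eq0 negb_or.
      by case/andP.
    by have := hf _ _ _ _ _ gd pv'; rewrite /G' (negbTE zu).
  + by move=> p /fU[] /VA.
- split; first exact: affine_chart_dense.
  apply: var_morphism_chart => [q /gV[/UX //]|q /VA Aq].
  have [x [y [b qv]]] : exists x y b, coords q (avec 1 x y b) by apply/avec_affine.
  exists a0, (fun j w => pvec s (affu (w 0 ax) (w 0 ay)) (afft (w 0 ax) (w 0 ay))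
     (\row_l (w 0 (ab l))) 0 j); split.
  + have hX i : polyfun RtoC (fun w : 'rV[C]_(1 + (2 + e)) => w 0 i) by exact: polyfunX.
    apply: polyfun_pvec => [j||| j].
    * by apply: polyfun_ext (polyfunC RtoC _ (r 0 j)) => w; rewrite mxE.
    * apply: I3_cases.
      - by apply: polyfun_ext (hX ax) => w; have [-> _ _] := affuE (w 0 ax) (w 0 ay).
      - by apply: polyfun_ext (hX ay) => w; have [_ -> _] := affuE (w 0 ax) (w 0 ay).
      - by apply: polyfun_ext (polyfun1 RtoC _) => w; have [_ _ ->] := affuE (w 0 ax) (w 0 ay).
    * by apply: polyfunD; exact: polyfun_exp.
    * by apply: polyfun_ext (hX (ab j)) => w; rewrite mxE.
  + move=> w qw; have [c c0 ->] := coords_prop qv qw.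
    by rewrite mxE; have [-> _ _ _] := avecE 1 x y b; rewrite mulr1.
  + move=> q' w Vq' qw w0; have := hg q' w (VA _ Vq') qw.
    rewrite /F w0 !divr1; congr coords; apply/rowP => j; rewrite [RHS]mxE.
    congr (pvec _ _ _ _ 0 j); apply/rowP => l.
    by rewrite !mxE divr1.
- exists U; first exact: slice_chart_dense.
  by move=> p Up; have [] := fU p Up.
- exists V; first exact: affine_chart_dense.
  by move=> q Vq; have [] := gV q Vq.
Qed.

Lemma slice_rational : rational_of_dim (2 + e) X.
Proof. by have [f [g h]] := chart_maps; exists U, f, V, g. Qed.

End ChartMaps.

(** * Smoothness by the Jacobian criterion *)

Section PartialDerivatives.
Variables (C : fieldType) (N : nat).
Implicit Types (F G : {mpoly C[N]}) (v : 'rV[C]_N) (j : 'I_N).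

Definition devalp j F v : C := evalp idfun (mderiv j F) v.

Lemma devalpX i j v : devalp j 'X_i v = (i == j)%:R.
Proof.
rewrite /devalp mderivX mnm1E evalpZ evalp_mon rmorph_nat.
case: eqP => [->|_]; last by rewrite mul0r.
by rewrite big1 ?mulr1 // => k _; rewrite mnmBE mnm1E subnn expr0.
Qed.

Lemma devalpD j F G v : devalp j (F + G) v = devalp j F v + devalp j G v.
Proof. by rewrite /devalp mderivD evalpD. Qed.

Lemma devalpB j F G v : devalp j (F - G) v = devalp j F v - devalp j G v.
Proof. by rewrite /devalp mderivB evalpB. Qed.

Lemma devalpM j F G v : devalp j (F * G) v =
  devalp j F v * evalp idfun G v + evalp idfun F v * devalp j G v.
Proof. by rewrite /devalp mderivM evalpD !evalpM. Qed.

Lemma devalpZ j c F v : devalp j (c *: F) v = c * devalp j F v.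
Proof. by rewrite /devalp mderivZ evalpZ. Qed.

End PartialDerivatives.

Lemma mxvec_index_eq M N (i i' : 'I_M) (j j' : 'I_N) :
  (mxvec_index i j == mxvec_index i' j') = (i == i') && (j == j').
Proof.
apply/eqP/andP => [h|[/eqP -> /eqP -> //]].
have : (i, j) = (i', j') by apply: enum_rank_inj; apply: cast_ord_inj h.
by case=> -> ->.
Qed.

Section Smooth.
Variable R : realType.
Local Notation C := R[i].
Local Notation RtoC := (real_complex R : {rmorphism R -> C}).
Variables (m e : nat).
Local Notation n := ((1 + m) + (1 + e))%N.
Local Notation K := (3 * n)%N.
Local Notation js := (@js m e).
Local Notation jt := (jt m e).
Implicit Types (u : 'rV[C]_3) (s : 'rV[C]_(1 + m)) (t : C) (b : 'rV[C]_e).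
Implicit Types (v : 'rV[C]_K).

Lemma pivot_pvec i v : ent v i (js 0) != 0 ->
  (forall k l, ent v k l * ent v i (js 0) = ent v k (js 0) * ent v i l) ->
  let a := (ent v i (js 0))^-1 in
  v = pvec (a *: sv v i) (colv v (js 0)) (a * tv v i) (a *: bv v i).
Proof.
move=> vi h a; apply: vecP => k j; rewrite pvecE; apply: (mulIf vi).
rewrite [v _ _ * _]h -mulrA mxE; congr (_ * _).
have aK x : x = a * x * ent v i (js 0) by rewrite mulrC mulrA mulfV ?mul1r.
by move: j; apply: js_cases => *; rewrite ?base_s ?base_t ?base_b ?[in RHS]mxE;
  rewrite -?aK ?mxE.
Qed.

(** The number of equations must equal the codimension: [2 (n - 1)] minors through the pivot, [m]
    values of [s], and one conic. These minors imply all others where the pivot is nonzero. *)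
Definition jac_index : finType := (('I_2 * 'I_(m + (1 + e))) + ('I_m + unit))%type.

Local Notation XX := (fun i j => 'X_(mxvec_index i j) : {mpoly C[K]}).

(* Equations of slice s where u_i != 0: rank one with pivot the entry (i, js 0),
   the values of s, and the conic. *)
Definition jac_eq s (i : 'I_3) (q : jac_index) : {mpoly C[K]} :=
  match q with
  | inl (k, l) => XX (lift i k) (lift (js 0) l) * XX i (js 0)
                  - XX (lift i k) (js 0) * XX i (lift (js 0) l)
  | inr (inl j) => XX i (js (lift 0 j)) - s 0 (lift 0 j) *: XX i (js 0)
  | inr (inr _) => (XX ox (js 0) * XX ox (js 0) + XX oy (js 0) * XX oy (js 0)) * XX i (js 0)
                   - XX i jt * (XX oz (js 0) * XX oz (js 0))
  end.

Lemma homog_XX i j : XX i j \is 1.-homog.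
Proof. by rewrite dhomogX /= mdeg1. Qed.

Lemma jac_eq_homog s i q : homogeneous (jac_eq s i q).
Proof.
have h := homog_XX; case: q => [[k l]|[j|[]]] /=.
- by exists (1 + 1)%N; apply: rpredB; apply: dhomogM.
- by exists 1%N; apply: rpredB => //; apply: rpredZ.
- have h3 : XX i jt * (XX oz (js 0) * XX oz (js 0)) \is (1 + (1 + 1)).-homog.
    by apply: dhomogM => //; apply: dhomogM.
  exists (1 + 1 + 1)%N; apply: rpredB; last exact: h3.
  by apply: dhomogM => //; apply: rpredD; apply: dhomogM.
Qed.

Lemma jac_zero s i v : s 0 0 = 1 -> ent v i (js 0) != 0 ->
  (forall q, evalp idfun (jac_eq s i q) v = 0) <->
  exists u t b, [/\ v = pvec s u t b, u != 0 & cU u * cV u = t * cZ u ^+ 2].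
Proof.
move=> s0 vi; split=> [h|[u [t [b [-> u0 E]]]] q]; last first.
  case: q => [[k l]|[j|[]]] /=; rewrite !(evalpB, evalpM, evalpD, evalpZ, evalpX).
  - by rewrite !pvecE; ring.
  - by rewrite pvec_s pvec_0 //= mulrC subrr.
  - rewrite !pvec_0 // pvec_t.
    have -> : u 0 ox * u 0 ox + u 0 oy * u 0 oy = t * u 0 oz ^+ 2.
      by rewrite -[RHS]E cUVE !expr2.
    by ring.
have seg k l : ent v k l * ent v i (js 0) = ent v k (js 0) * ent v i l.
  case: (unliftP i k) => [k' ->|->]; last by rewrite mulrC.
  case: (unliftP (js 0) l) => [l' ->|-> //].
  have := h (inl (k', l')); rewrite /= evalpB !evalpM !evalpX => /subr0_eq.
  exact.
have vE := pivot_pvec vi seg; move: vE => /=.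
set a := _^-1; set t := a * _; set b := a *: bv _ _; set u := colv _ _ => vE.
have sE : a *: sv v i = s.
  apply/rowP => j; rewrite !mxE.
  case: (unliftP 0 j) => [j' ->|->]; last by rewrite mulVf.
  have := h (inr (inl j')); rewrite /= evalpB evalpZ !evalpX => /subr0_eq.
  by rewrite /ent => -> /=; rewrite mulrC mulfK.
rewrite sE in vE; exists u, t, b; split=> //.
  by apply: contraNneq vi => /rowP/(_ i); rewrite !mxE => ->.
have := h (inr (inr tt)); rewrite /= !(evalpB, evalpM, evalpD, evalpX) => /subr0_eq E.
rewrite cUVE /cZ !mxE; apply: (mulIf vi).
rewrite !expr2 [LHS]E mulrAC; congr (_ * _).
by rewrite /t mulrC mulrA mulfV ?mul1r.
Qed.

(** A row vector in the left kernel is tested against chosen columns, arranged so that the matrix is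
    triangular: first the minors, then the equations of [s], and last the conic. *)
Lemma jac_row_free s i v : s 0 0 = 1 -> ent v i (js 0) != 0 ->
  (forall q, evalp idfun (jac_eq s i q) v = 0) ->
  row_free (\matrix_(a < #|jac_index|, j < K)
    devalp j (jac_eq s i (enum_val a)) v).
Proof.
move=> s0 vi; move/(jac_zero s0 vi) => [u [t [b [vE u0 E]]]].
have uE k : v 0 (mxvec_index k (js 0)) = u 0 k by rewrite vE pvec_0.
have ui : u 0 i != 0 by rewrite -uE.
set J := \matrix_(a, j) _.
have lin (L : 'rV[C]_#|jac_index|) : L *m J = 0 -> forall k l,
    \sum_q L 0 (enum_rank q) * devalp (mxvec_index k l) (jac_eq s i q) v = 0.
  move=> LJ k l; have /rowP/(_ (mxvec_index k l)) := LJ; rewrite [LHS]mxE [RHS]mxE => h; rewrite -[RHS]h.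
  rewrite (reindex_onto (@enum_val _ (mem jac_index)) enum_rank) /=; last first.
    by move=> q _; rewrite enum_rankK.
  by apply: eq_big => a; rewrite ?enum_valK ?eqxx // => _; rewrite mxE.
have dE k l q : devalp (mxvec_index k l) (jac_eq s i q) v =
  match q with
  | inl (k', l') => ((lift i k' == k) && (lift (js 0) l' == l))%:R * u 0 i
      + v 0 (mxvec_index (lift i k') (lift (js 0) l')) * ((i == k) && (js 0 == l))%:R
      - (((lift i k' == k) && (js 0 == l))%:R * v 0 (mxvec_index i (lift (js 0) l'))
      + u 0 (lift i k') * ((i == k) && (lift (js 0) l' == l))%:R)
  | inr (inl j) => ((i == k) && (js (lift 0 j) == l))%:R
      - s 0 (lift 0 j) * ((i == k) && (js 0 == l))%:R
  | inr (inr _) =>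
     ((((ox == k) && (js 0 == l))%:R * u 0 ox + u 0 ox * ((ox == k) && (js 0 == l))%:R)
      + (((oy == k) && (js 0 == l))%:R * u 0 oy + u 0 oy * ((oy == k) && (js 0 == l))%:R))
       * u 0 i + (u 0 ox * u 0 ox + u 0 oy * u 0 oy) * ((i == k) && (js 0 == l))%:R
     - (((i == k) && (jt == l))%:R * (u 0 oz * u 0 oz) +
        (v 0 (mxvec_index i jt)) * (((oz == k) && (js 0 == l))%:R * u 0 oz
         + u 0 oz * ((oz == k) && (js 0 == l))%:R))
  end.
  case: q => [[k' l']|[j|[]]] /=.
  - by rewrite devalpB !devalpM !devalpX !evalpX !mxvec_index_eq !uE.
  - by rewrite devalpB devalpZ !devalpX !mxvec_index_eq.
  - by rewrite devalpB !devalpM devalpD !devalpM !devalpX evalpD !evalpM !evalpX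
      !mxvec_index_eq !uE.
have jst (j : 'I_(1 + m)) : (js j == jt) = false by rewrite eq_lrshift.
have js_inj (j j' : 'I_(1 + m)) : (js j == js j') = (j == j') by rewrite eq_lshift.
rewrite -kermx_eq0; apply/rowV0P => L /sub_kermxP LJ.
have {}lin := lin L LJ.
(* In the column of an entry outside the pivot row and column, only its own minor has a nonzero
   derivative, namely [u_i]. *)
have Linl k l : L 0 (enum_rank (inl (k, l) : jac_index)) = 0.
  have := lin (lift i k) (lift (js 0) l).
  rewrite (bigD1 (inl (k, l) : jac_index)) // dE /= !eqxx.
  have iF : (i == lift i k) = false by apply/negbTE; exact: neq_lift.
  have jF : (js 0 == lift (js 0) l) = false by apply/negbTE; exact: neq_lift.
  rewrite iF jF /= ?andbF !mulr0 mul0r !addr0 subr0 mul1r.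
  rewrite big1 ?addr0 => [/eqP|].
    by rewrite mulf_eq0 (negbTE ui) orbF => /eqP.
  move=> q qn; rewrite dE; case: q qn => [[k' l']|[j|[]]] /= qn;
    rewrite ?iF ?jF ?andbF /= ?(mulr0, mul0r, addr0, subr0) //.
  rewrite (inj_eq (@lift_inj _ i)) (inj_eq (@lift_inj _ (js 0))).
  suff -> : (k' == k) && (l' == l) = false by rewrite mul0r mulr0.
  by apply: contraNF qn => /andP[/eqP -> /eqP ->].
have Ls j : L 0 (enum_rank (inr (inl j) : jac_index)) = 0.
  have := lin i (js (lift 0 j)).
  have j0 : (js 0 == js (lift 0 j)) = false by rewrite js_inj; apply/negbTE; exact: neq_lift.
  rewrite (bigD1 (inr (inl j) : jac_index)) // dE /= !eqxx j0 /= mulr0 subr0 mulr1.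
  rewrite big1 ?addr0 // => q qn; case: q qn => [[k' l']|[j'|[]]] qn.
  - by rewrite Linl mul0r.
  - rewrite dE /= j0 js_inj (inj_eq (@lift_inj _ _)) andbF mulr0 subr0.
    suff -> : (j' == j) = false by rewrite andbF mulr0.
    by apply: contraNF qn => /eqP ->.
  - rewrite dE /= j0 [jt == _]eq_sym jst !andbF.
    by rewrite !(mulr0, mul0r, addr0, subr0).
have Lc : L 0 (enum_rank (inr (inr tt) : jac_index)) = 0.
  have fin k l : L 0 (enum_rank (inr (inr tt) : jac_index)) *
     devalp (mxvec_index k l) (jac_eq s i (inr (inr tt))) v = 0.
    have := lin k l; rewrite (bigD1 (inr (inr tt) : jac_index)) //.
    rewrite big1; [by rewrite /= addr0 | move=> q qn].
    case: q qn => [[k' l']|[j|[]]] qn; rewrite ?Linl ?Ls ?mul0r //; rewrite eqxx in qn.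
  have use k l : devalp (mxvec_index k l) (jac_eq s i (inr (inr tt))) v != 0 ->
      L 0 (enum_rank (inr (inr tt) : jac_index)) = 0.
    by move=> nz; have /eqP := fin k l; rewrite mulf_eq0 (negbTE nz) orbF => /eqP.
  (* If [z] is nonzero, the derivative in the entry [(i, jt)] is [- z^2]. If [z = 0], then
     [x^2 + y^2 = 0] with [u] nonzero, so [x] and [y] are both nonzero and the derivative in the one
     other than [u_i] works. *)
  have [z0|z0] := eqVneq (u 0 oz) 0; last first.
    apply: (use i jt); rewrite dE /= !eqxx !jst !andbF.
    by rewrite !(mulr0, mul0r, addr0, add0r) mul1r oppr_eq0 mulf_neq0.
  have xy : u 0 ox ^+ 2 + u 0 oy ^+ 2 = 0 by rewrite -cUVE E /cZ z0 expr0n mulr0.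
  have two (a c : C) : a != 0 -> c != 0 -> (1 * a + a * 1) * c != 0.
    by move=> a0 c0; rewrite mul1r mulr1 -mulr2n mulf_neq0 // mulrn_eq0.
  have : i = ox \/ i = oy.
    have : u 0 i != 0 -> i = ox \/ i = oy.
      by move: (i); apply: I3_cases; rewrite ?z0 ?eqxx; auto.
    exact.
  case=> iE; rewrite iE in ui.
    have y0 : u 0 oy != 0.
      by apply: contraNneq ui => y0; move/eqP: xy; rewrite y0 expr0n addr0 sqrf_eq0.
    apply: (use oy (js 0)); rewrite dE /= iE !eqxx /=.
    by rewrite !(mulr0, mul0r, addr0, add0r, subr0); apply: two.
  have x0 : u 0 ox != 0.
    by apply: contraNneq ui => x0; move/eqP: xy; rewrite x0 expr0n add0r sqrf_eq0.
  apply: (use ox (js 0)); rewrite dE /= iE !eqxx /=.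
  by rewrite !(mulr0, mul0r, addr0, add0r, subr0); apply: two.
apply/rowP => a; rewrite mxE -[a]enum_valK.
by case: (enum_val a) => [[k l]|[j|[]]].
Qed.

Lemma jac_card : (K = (#|jac_index| + (2 + e)).+1)%N.
Proof. by rewrite !card_sum card_prod !card_ord card_unit; lia. Qed.

Lemma slice_smooth s : s 0 0 = 1 -> smooth_of_dim (2 + e) (@slice R m e s).
Proof.
move=> s0 p sp; have [u [t [b [g pv]]]] := sp; have [_ u0 E _ _] := g.
have [i ui] := u_pivot u0.
(* Off [W] every point is good and the pivot [u_i] is nonzero, so [jac_eq] cuts out exactly the
   slice. *)
pose W := @excluded R m e `|` [set q | forall (_ : unit) v, coords q v -> ent v i (js 0) = 0].
exists #|jac_index|, (fun a => jac_eq s i (enum_val a)), W; split.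
- by split; [exact: jac_card | move=> a; exact: jac_eq_homog].
- split.
    apply: zclosedU; first exact: zclosed_base_change (excluded_closed R m e).
    by apply: (zclosed_homfun (e := fun=> 1%N)) => _; exact: homfun_ent.
  case=> [|/(_ tt _ pv)].
    by apply/(good_excluded s0 u0 E pv).
  by rewrite /ent pvec_0 // => ui0; rewrite ui0 eqxx in ui.
- have nzi q v : coords q v -> ~ W q -> ent v i (js 0) != 0.
    move=> qv; apply: contra_notN => /eqP vi; right=> _ w qw.
    exact: homfun_all (homfun_ent RtoC i (js 0)) qv vi qw.
  apply/seteqP; split=> q [h1 h2]; split=> //.
    move=> a v qv; have [u' [t' [b' [g' vE]]]] := slice_coords h1 qv.
    have [_ u0' E' _ _] := g'.
    have /(jac_zero s0 (nzi q v qv h2)) h : exists u t b, [/\ v = pvec s u t b, u != 0 &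
        cU u * cV u = t * cZ u ^+ 2] by exists u', t', b'.
    exact: h.
  have [v qv] := coords_ex q.
  have /(jac_zero s0 (nzi q v qv h2))[u' [t' [b' [vE u0' E']]]] :
      forall k, evalp idfun (jac_eq s i k) v = 0.
    by move=> k; have := h1 (enum_rank k) v qv; rewrite enum_rankK.
  rewrite vE in qv; exists u', t', b'; split=> //.
  by apply/(good_excluded s0 u0' E' qv) => xq; apply: h2; left.
- move=> v pv'; have [u' [t' [b' [g' vE]]]] := slice_coords sp pv'.
  have [_ u0' E' _ _] := g'.
  have vi : ent v i (js 0) != 0.
    have [a a0 ->] := coords_prop pv pv'.
    by rewrite /ent mxE pvec_0 // mulf_neq0.
  by apply: jac_row_free => //; apply/jac_zero => //; exists u', t', b'.
Qed.

End Smooth.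

Lemma polyfun_horner (k C : fieldType) (iota : {rmorphism k -> C}) N (f : 'rV[C]_N -> C)
    (P : {poly k}) :
  polyfun iota f -> polyfun iota (fun v => (map_poly iota P).[f v]).
Proof.
move=> hf; apply: (@polyfun_ext _ _ _ _ (fun v => \sum_(i < size P) iota P`_i * f v ^+ i)).
  by move=> v; rewrite horner_poly.
apply: polyfun_sum => i; apply: polyfunM; first exact: polyfunC.
exact: polyfun_exp.
Qed.

(** * Complex trivialization *)

Section Trivialization.
Variable R : realType.
Local Notation C := R[i].
Local Notation ii := (ii R).
Variables (m e : nat).
Local Notation n := ((1 + m) + (1 + e))%N.
Local Notation K := (3 * n)%N.
Local Notation js := (@js m e).
Local Notation jt := (jt m e).
Local Notation jb := (@jb m e).
Implicit Types (u : 'rV[C]_3) (s : 'rV[C]_(1 + m)) (t f h : C) (b : 'rV[C]_e).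

(* The automorphism of the conic over t with parameter f that fixes the point
   v = z = 0, followed by the one with parameter h that fixes u = z = 0. *)
Definition phi f h t u :=
  let U := cU u + t * (2 * f * cZ u + f ^+ 2 * cV u) in
  let Z := cZ u + f * cV u in
  uvz U (cV u + t * (2 * h * Z + h ^+ 2 * U)) (Z + h * U).

Definition psi f h t u :=
  let V := cV u + t * (- (2 * h * cZ u) + h ^+ 2 * cU u) in
  let Z := cZ u - h * cU u in
  uvz (cU u + t * (- (2 * f * Z) + f ^+ 2 * V)) V (Z - f * V).

Lemma phiK f h t u : psi f h t (phi f h t u) = u.
Proof. by apply: uvz_inj; rewrite !uvzE; ring. Qed.

Lemma psiK f h t u : phi f h t (psi f h t u) = u.
Proof. by apply: uvz_inj; rewrite !uvzE; ring. Qed.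

Lemma phiZ f h t a u : phi f h t (a *: u) = a *: phi f h t u.
Proof. by rewrite -uvzZ /phi cUZ cVZ cZZ; congr uvz; ring. Qed.

Lemma psiZ f h t a u : psi f h t (a *: u) = a *: psi f h t u.
Proof. by rewrite -uvzZ /psi cUZ cVZ cZZ; congr uvz; ring. Qed.

Lemma phi_conic f h t u : cU u * cV u = t * cZ u ^+ 2 ->
  cU (phi f h t u) * cV (phi f h t u) = t * cZ (phi f h t u) ^+ 2.
Proof.
move=> E; rewrite !uvzE; apply/eqP; rewrite -subr_eq0; apply/eqP.
transitivity (cU u * cV u - t * cZ u ^+ 2); first by ring.
by rewrite E subrr.
Qed.

Lemma phi_neq0 f h t u : u != 0 -> phi f h t u != 0.
Proof.
apply: contraNneq => p0; rewrite -(phiK f h t u) p0 -[0](scale0r (0 : 'rV[C]_3)).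
by rewrite psiZ !scale0r.
Qed.

Lemma psi_neq0 f h t u : u != 0 -> psi f h t u != 0.
Proof.
apply: contraNneq => p0; rewrite -(psiK f h t u) p0 -[0](scale0r (0 : 'rV[C]_3)).
by rewrite phiZ !scale0r.
Qed.

(** Vanishing at the points [- tj k] decouples the two factors of [phi]: with parameters [f(t)] and
    [f(-t)], only the first acts over [tj k] and only the second over [- tj k]. The nodes are
    distinct by [tj_neqN]. *)
Lemma interpolation_ex (j : 'I_(1 + m)) : exists P : {poly C}, forall k : 'I_(1 + m),
  P.[tj R k] = (k == j)%:R /\ P.[- tj R k] = 0.
Proof.
pose Q : {poly C} := (\prod_(k : 'I_(1 + m)) ('X - (- tj R k)%:P)) *
  (\prod_(k : 'I_(1 + m) | k != j) ('X - (tj R k)%:P)).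
have QN (k : 'I_(1 + m)) : Q.[- tj R k] = 0.
  by rewrite hornerM horner_prod (bigD1 k) //= hornerXsubC subrr !mul0r.
have Q0 (k : 'I_(1 + m)) : k != j -> Q.[tj R k] = 0.
  by move=> kj; rewrite hornerM mulrC horner_prod (bigD1 k) //= hornerXsubC subrr !mul0r.
have Qj : Q.[tj R j] != 0.
  rewrite hornerM !horner_prod mulf_neq0 //; apply/prodf_neq0 => k kj;
    rewrite hornerXsubC subr_eq0.
    exact: tj_neqN.
  by apply: contraNneq kj => /tj_inj ->.
exists (Q.[tj R j]^-1 *: Q) => k; rewrite !hornerZ QN mulr0; split=> //.
by have [->|/Q0 ->] := eqVneq k j; rewrite ?mulVf ?mulr0.
Qed.

Definition lagrange (j : 'I_(1 + m)) : {poly C} := sval (cid (interpolation_ex j)).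

Lemma lagrangeP (j k : 'I_(1 + m)) :
  (lagrange j).[tj R k] = (k == j)%:R /\ (lagrange j).[- tj R k] = 0.
Proof. by rewrite /lagrange; case: cid. Qed.

Definition interp s t : C := \sum_j s 0 j * (lagrange j).[t].

Lemma interp_tj s j : interp s (tj R j) = s 0 j.
Proof.
rewrite /interp (bigD1 j) //= (lagrangeP j j).1 eqxx mulr1 big1 ?addr0 // => k kj.
by rewrite (lagrangeP k j).1 eq_sym (negbTE kj) mulr0.
Qed.

Lemma interp_Ntj s (j : 'I_(1 + m)) : interp s (- tj R j) = 0.
Proof. by apply: big1 => k _; rewrite (lagrangeP k j).2 mulr0. Qed.

(* Over t = tj j this adds s_j to z / v, over t = - tj j it adds s_j to z / u. *)
Definition shift s t u := phi (interp s t) (interp s (- t)) t u.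
Definition unshift s t u := psi (interp s t) (interp s (- t)) t u.

(** Only the values at the nodes matter. There a shear with parameter [d] is the translation
    [w |-> w + d], which carries [s_j + i] to [s'_j + i] and, over the conjugate value, [s_j - i] to
    [s'_j - i]. *)
Lemma removed_shift s s' u t : removed s' (shift (s' - s) t u) t <-> removed s u t.
Proof.
have alg (T U V Z d w w' : C) : w' = w + d ->
    (Z + d * V = w' * V /\ U + T * (2 * d * Z + d ^+ 2 * V) = T * w' * (Z + d * V)) <->
    (Z = w * V /\ U = T * w * Z).
  move=> ->; split=> [[e1 e2]|[e1 e2]]; split.
  - by apply: (addIr (d * V)); rewrite e1; ring.
  - apply: (addIr (T * (2 * d * Z + d ^+ 2 * V))); rewrite e2.
    have -> : Z = w * V by apply: (addIr (d * V)); rewrite e1; ring.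
    by ring.
  - by rewrite e1; ring.
  - by rewrite e2 e1; ring.
have w1 (j : 'I_(1 + m)) c : s' 0 j + c = s 0 j + c + (s' - s) 0 j by rewrite !mxE; ring.
have h1 (j : 'I_(1 + m)) : removed1 s' (shift (s' - s) t u) t j <-> removed1 s u t j.
  rewrite /removed1; have [->|ne] := pselect (t = tj R j); last by split=> -[].
  have -> : shift (s' - s) (tj R j) u = uvz (cU u + tj R j * (2 * (s' - s) 0 j * cZ u
      + (s' - s) 0 j ^+ 2 * cV u)) (cV u) (cZ u + (s' - s) 0 j * cV u).
    rewrite /shift interp_tj interp_Ntj /phi.
    by congr uvz; ring.
  rewrite !uvzE; have [l1 l2] := alg (tj R j) (cU u) (cV u) (cZ u) _ _ _ (w1 j ii).
  by split=> -[_ e1 e2]; [case: l1|case: l2].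
have h2 (j : 'I_(1 + m)) : removed2 s' (shift (s' - s) t u) t j <-> removed2 s u t j.
  rewrite /removed2; have [->|ne] := pselect (t = - tj R j); last by split=> -[].
  have -> : shift (s' - s) (- tj R j) u = uvz (cU u) (cV u + - tj R j * (2 * (s' - s) 0 j * cZ u
      + (s' - s) 0 j ^+ 2 * cU u)) (cZ u + (s' - s) 0 j * cU u).
    rewrite /shift opprK interp_tj interp_Ntj /phi.
    by congr uvz; ring.
  rewrite !uvzE.
  have [l1 l2] := alg (- tj R j) (cV u) (cU u) (cZ u) _ _ _ (w1 j (- ii)).
  by split=> -[_ e1 e2]; [case: l1|case: l2].
by split=> -[j [/h1|/h2] h]; exists j; [left|right|left|right].
Qed.

Lemma good_shift s s' u t b : s' 0 0 = 1 -> good s u t b ->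
  good s' (shift (s' - s) t u) t b.
Proof.
move=> s0' [s0 u0 E hb hr]; split=> //; first exact: phi_neq0.
  exact: phi_conic.
by rewrite removed_shift.
Qed.

Lemma good_unshift s s' u t b : s 0 0 = 1 -> good s' u t b ->
  good s (unshift (s' - s) t u) t b.
Proof.
move=> s0 [s0' u0 E hb hr].
have uE : u = shift (s' - s) t (unshift (s' - s) t u) by rewrite /shift psiK.
split=> //; first exact: psi_neq0.
  set w := unshift _ _ _ in uE *; apply/eqP; rewrite -subr_eq0; apply/eqP.
  transitivity (cU u * cV u - t * cZ u ^+ 2); last by rewrite E subrr.
  by rewrite uE /shift /phi !uvzE; ring.
by rewrite -(removed_shift s s') -uE.
Qed.

Section PolyfunShift.
Variable N : nat.
Implicit Types (g : 'rV[C]_N -> 'rV[C]_3).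
Local Notation pf := (@polyfun C C idfun N).

Lemma pfC c : pf (fun=> c). Proof. exact: (polyfunC idfun). Qed.

Lemma pf_uvz (f0 f1 f2 : 'rV[C]_N -> C) : pf f0 -> pf f1 -> pf f2 ->
  forall i, pf (fun v => uvz (f0 v) (f1 v) (f2 v) 0 i).
Proof.
move=> ha hb hc; apply: I3_cases.
- apply: polyfun_ext (fun v => (f0 v + f1 v) / 2) _ _ _ => [v|]; first by rewrite mxE.
  by apply: polyfunM (pfC _); apply: polyfunD.
- apply: polyfun_ext (fun v => (f1 v - f0 v) * ii / 2) _ _ _ => [v|]; first by rewrite mxE.
  by apply: polyfunM (pfC _); apply: polyfunM (pfC _); apply: polyfunD => //; apply: polyfunN.
- by apply: polyfun_ext hc => v; rewrite mxE.
Qed.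

Lemma pf_cU g : (forall i, pf (fun v => g v 0 i)) -> pf (fun v => cU (g v)).
Proof. by move=> h; apply: polyfunD => //; apply: polyfunM => //; apply: pfC. Qed.
Lemma pf_cV g : (forall i, pf (fun v => g v 0 i)) -> pf (fun v => cV (g v)).
Proof.
by move=> h; apply: polyfunD => //; apply: polyfunN; apply: polyfunM => //; apply: pfC.
Qed.
Lemma pf_cZ g : (forall i, pf (fun v => g v 0 i)) -> pf (fun v => cZ (g v)).
Proof. exact. Qed.

Lemma pf_interp (f : 'rV[C]_N -> 'rV[C]_(1 + m)) (g : 'rV[C]_N -> C) :
  (forall j, pf (fun v => f v 0 j)) -> pf g -> pf (fun v => interp (f v) (g v)).
Proof.
move=> hf hg; apply: polyfun_sum => j; apply: polyfunM => //.
apply: polyfun_ext (polyfun_horner (lagrange j) hg) => v.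
by rewrite map_poly_id.
Qed.

Ltac pf_tac := do ?[assumption | apply: pfC | apply: polyfunD | apply: polyfunN
  | apply: polyfunM | apply: polyfun_exp].

Lemma pf_shift (f : 'rV[C]_N -> 'rV[C]_(1 + m)) (h : 'rV[C]_N -> C) g :
  (forall j, pf (fun v => f v 0 j)) -> pf h -> (forall i, pf (fun v => g v 0 i)) ->
  forall i, pf (fun v => shift (f v) (h v) (g v) 0 i).
Proof.
move=> hf hh hg; have hU := pf_cU hg; have hV := pf_cV hg; have hZ := pf_cZ hg.
have h1 := pf_interp hf hh; have h2 := pf_interp hf (polyfunN hh).
by apply: pf_uvz; pf_tac.
Qed.

Lemma pf_unshift (f : 'rV[C]_N -> 'rV[C]_(1 + m)) (h : 'rV[C]_N -> C) g :
  (forall j, pf (fun v => f v 0 j)) -> pf h -> (forall i, pf (fun v => g v 0 i)) ->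
  forall i, pf (fun v => unshift (f v) (h v) (g v) 0 i).
Proof.
move=> hf hh hg; have hU := pf_cU hg; have hV := pf_cV hg; have hZ := pf_cZ hg.
have h1 := pf_interp hf hh; have h2 := pf_interp hf (polyfunN hh).
by apply: pf_uvz; pf_tac.
Qed.
End PolyfunShift.

Lemma polyfun_chart (k : fieldType) (iota : {rmorphism k -> C}) i :
  [/\ forall j, polyfun iota (fun v : 'rV[C]_K => colv v (js 0) 0 j),
      forall j, polyfun iota (fun v : 'rV[C]_K => sv v i 0 j),
      polyfun iota (fun v : 'rV[C]_K => tv v i) &
      forall l, polyfun iota (fun v : 'rV[C]_K => bv v i 0 l)].
Proof.
have hent j l : polyfun iota (fun v : 'rV[C]_K => ent v j l) by exact: polyfunX.
split=> [j|j||l]; last 1 first.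
- by apply: polyfun_ext (hent i (jb l)) => v; rewrite mxE.
- by apply: polyfun_ext (hent j (js 0)) => v; rewrite mxE.
- by apply: polyfun_ext (hent i (js j)) => v; rewrite mxE.
- exact: hent.
Qed.

Lemma slice_isomorphic s s' : s 0 0 = 1 -> s' 0 0 = 1 ->
  isomorphic idfun (@slice R m e s) (@slice R m e s').
Proof.
move=> s0 s0'.
have [q0 _] : exists q : pt C K, True.
  by have [q _] := pt_ex (pvec_neq0 0 (0 : 'rV[C]_e) s0 (affu_neq0 (0 : C) 0)); exists q.
have [f hf] : exists f : pt C K -> pt C K, forall p s'' u t b, good s'' u t b ->
    coords p (pvec s'' u t b) -> coords (f p) (pvec s' (shift (s' - s) t u) t b).
  apply: (total_map_ex q0 (G := fun u _ t b => pvec s' (shift (s' - s) t u) t b)).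
    by move=> s'' u t b [_ u0 _ _ _]; apply: pvec_neq0 => //; apply: phi_neq0.
  by move=> s'' u t b a _ _; exists a; rewrite -pvecZ /shift phiZ.
have [g hg] : exists g : pt C K -> pt C K, forall p s'' u t b, good s'' u t b ->
    coords p (pvec s'' u t b) -> coords (g p) (pvec s (unshift (s' - s) t u) t b).
  apply: (total_map_ex q0 (G := fun u _ t b => pvec s (unshift (s' - s) t u) t b)).
    by move=> s'' u t b [_ u0 _ _ _]; apply: pvec_neq0 => //; apply: psi_neq0.
  by move=> s'' u t b a _ _; exists a; rewrite -pvecZ /unshift psiZ.
exists f, g; split.
- apply: (total_morphism (G := fun u _ t b => pvec s' (shift (s' - s) t u) t b)).
  + exact: slice_total.
  + move=> i; have [h1 h2 h3 h4] := polyfun_chart idfun i.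
    apply: polyfun_pvec => //; first by move=> j; apply: pfC.
    by apply: pf_shift => // j; apply: pfC.
  + by move=> p u s'' t b _; apply: hf.
  + move=> p [u [t [b [gd pv]]]]; exists (shift (s' - s) t u), t, b.
    by split; [apply: good_shift|apply: hf pv].
- apply: (total_morphism (G := fun u _ t b => pvec s (unshift (s' - s) t u) t b)).
  + exact: slice_total.
  + move=> i; have [h1 h2 h3 h4] := polyfun_chart idfun i.
    apply: polyfun_pvec => //; first by move=> j; apply: pfC.
    by apply: pf_unshift => // j; apply: pfC.
  + by move=> p u s'' t b _; apply: hg.
  + move=> p [u [t [b [gd pv]]]]; exists (unshift (s' - s) t u), t, b.
    by split; [apply: good_unshift|apply: hg pv].
- move=> p [u [t [b [gd pv]]]].
  have := hg _ _ _ _ _ (good_shift s0' gd) (hf _ _ _ _ _ gd pv).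
  by rewrite /unshift phiK => /coords_inj; apply.
- move=> p [u [t [b [gd pv]]]].
  have := hf _ _ _ _ _ (good_unshift s0 gd) (hg _ _ _ _ _ gd pv).
  by rewrite /shift psiK => /coords_inj; apply.
Qed.

End Trivialization.

(** * The family over affine space as a relative real form *)

Section RelativeForm.
Variable R : realType.
Local Notation C := R[i].
Local Notation RtoC := (real_complex R : {rmorphism R -> C}).
Variables (m e : nat).
Local Notation n := ((1 + m) + (1 + e))%N.
Local Notation K := (3 * n)%N.
Local Notation total_space := (@total_space R m e).
Local Notation js := (@js m e).
Implicit Types (u : 'rV[C]_3) (s : 'rV[C]_(1 + m)) (t : C) (b : 'rV[C]_e).
Implicit Types (w : 'rV[C]_((1 + m) * K)).

Lemma affine_of_coords s (p : pt C (1 + m)) : s 0 0 = 1 -> coords p s -> affine_space C m p.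
Proof.
move=> s0 ps; apply/(affineP ps); have -> : lshift m 0 = 0 :> 'I_(1 + m) by apply: val_inj.
by rewrite s0 oner_neq0.
Qed.

Lemma affine_normalize (p : pt C (1 + m)) : affine_space C m p ->
  exists2 s : 'rV[C]_(1 + m), s 0 0 = 1 & coords p s.
Proof.
move=> [a pa]; exists (row_mx 1%:M a) => //.
have -> : 0 = lshift m 0 :> 'I_(1 + m) by apply: val_inj.
by rewrite row_mxEl mxE.
Qed.

Definition segvec s (v : 'rV[C]_K) : 'rV[C]_((1 + m) * K) := mxvec (s^T *m v).

Lemma segvecE s v j k : segvec s v 0 (mxvec_index j k) = s 0 j * v 0 k.
Proof. by rewrite /segvec mxvecE mxE big_ord1 mxE. Qed.

Lemma segvecZl a s v : segvec (a *: s) v = a *: segvec s v.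
Proof. by rewrite /segvec linearZ /= -scalemxAl linearZ. Qed.

Lemma segvecZr a s v : segvec s (a *: v) = a *: segvec s v.
Proof. by rewrite /segvec -scalemxAr linearZ. Qed.

Lemma segvec_neq0 s v : s 0 0 = 1 -> v != 0 -> segvec s v != 0.
Proof.
move=> s0 /rV0Pn[k vk]; apply: contraNneq vk => /rowP/(_ (mxvec_index 0 k)).
by rewrite segvecE s0 mul1r mxE => ->.
Qed.

Variable s1 : 'rV[C]_(1 + m).
Hypothesis s10 : s1 0 0 = 1.
Local Notation X := (@slice R m e s1).

Lemma product_coords r w : var_product (affine_space C m) X r -> coords r w ->
  exists s u t b, [/\ s 0 0 = 1, good s1 u t b & w = segvec s (pvec s1 u t b)].
Proof.
move=> [p [q [/affine_normalize[s s0 ps] Xq [a [v [pa qv rav]]]]]] rw.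
have [c c0 aE] := coords_prop ps pa; have [c' c'0 ->] := coords_prop rav rw.
have [u [t [b [g vE]]]] := slice_coords Xq qv.
exists s, ((c' * c) *: u), t, b; split=> //.
  by apply: good_scale g; rewrite mulf_neq0.
by rewrite aE vE pvecZ segvecZr -[mxvec _]/(segvec _ _) segvecZl scalerA.
Qed.

(* For w = segvec s (pvec s1 u t b) and a pivot u_i, inv_s w i u_i^-1 is s. *)
Definition inv_vec w : 'rV[C]_K := \row_k w 0 (mxvec_index 0 k).
Definition inv_s w i (a : C) : 'rV[C]_(1 + m) :=
  \row_j (a * w 0 (mxvec_index j (mxvec_index i (js 0)))).
Definition inv_theta w i (a : C) : 'rV[C]_K :=
  let v := inv_vec w in let s := inv_s w i a in
  pvec s (unshift (s1 - s) (a * tv v i) (colv v (js 0))) (a * tv v i) (a *: bv v i).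

Lemma inv_thetaE s u t b i : s 0 0 = 1 -> u 0 i != 0 ->
  inv_theta (segvec s (pvec s1 u t b)) i (u 0 i)^-1 = pvec s (unshift (s1 - s) t u) t b.
Proof.
move=> s0 ui; rewrite /inv_theta.
have -> : inv_vec (segvec s (pvec s1 u t b)) = pvec s1 u t b.
  by apply/rowP => k; rewrite mxE segvecE s0 mul1r.
have -> : inv_s (segvec s (pvec s1 u t b)) i (u 0 i)^-1 = s.
  by apply/rowP => j; rewrite mxE segvecE pvec_0 // mulrCA mulVf // mulr1.
by rewrite tv_pvec bv_pvec col0_pvec // mulrA mulVf // mul1r scalerA mulVf // scale1r.
Qed.

(** [theta] keeps [s], [t], [b] and shears slice [s] onto the fixed slice [s1]. It is algebraic in
    [s] as well, because [interp] is linear in [s] and its Lagrange polynomials depend only on the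
    nodes. *)
Lemma relative_form_ex : exists h theta,
  relative_real_form X (affine_space C m) total_space h theta /\
  (forall (s : 'rV[C]_(1 + m)) p, s 0 0 = 1 -> coords p s -> fibre total_space h p = @slice R m e s).
Proof.
have [q0 _] : exists q : pt C K, True.
  by have [q _] := pt_ex (pvec_neq0 0 (0 : 'rV[C]_e) s10 (affu_neq0 (0 : C) 0)); exists q.
have s1n : s1 != 0.
  by apply/eqP => /rowP/(_ 0); rewrite s10 mxE => /eqP; rewrite oner_eq0.
have [p1 p1s] := pt_ex s1n.
have sn s : s 0 0 = 1 -> s != 0.
  by move=> s0; apply/eqP => /rowP/(_ 0); rewrite s0 mxE => /eqP; rewrite oner_eq0.
have [h hh] : exists h : pt C K -> pt C (1 + m), forall p s u t b, good s u t b ->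
    coords p (pvec s u t b) -> coords (h p) s.
  apply: (total_map_ex p1 (G := fun _ s _ _ => s)).
    by move=> s u t b [s0 _ _ _ _]; exact: sn.
  by move=> s u t b a _ _; exists 1; rewrite scale1r.
pose G u s t b := segvec s (pvec s1 (shift (s1 - s) t u) t b).
have [r0 _] : exists r : pt C ((1 + m) * K), True.
  have [r _] := pt_ex (segvec_neq0 s10
    (pvec_neq0 0 (0 : 'rV[C]_e) s10 (affu_neq0 (0 : C) 0))).
  by exists r.
have [theta ht] : exists f : pt C K -> pt C ((1 + m) * K), forall p s u t b,
    good s u t b -> coords p (pvec s u t b) -> coords (f p) (G u s t b).
  apply: (total_map_ex r0 (G := G)).
    move=> s u t b [s0 u0 _ _ _]; apply: segvec_neq0 => //; apply: pvec_neq0 => //.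
    exact: phi_neq0.
  by move=> s u t b a _ _; exists a; rewrite /G -segvecZr -pvecZ /shift phiZ.
pose piv (v : 'rV[C]_K) := odflt ox [pick i | ent v i (js 0) != 0].
have pivP s u t b : s 0 0 = 1 -> u != 0 -> u 0 (piv (pvec s u t b)) != 0.
  move=> s0 /u_pivot[i ui]; rewrite /piv; case: pickP => [i'|/(_ i)]; rewrite /ent pvec_0 //=.
  by rewrite ui.
(* The inverse as a map on points: dividing by the pivot entry makes [F] homogeneous of degree one,
   so it is well defined. *)
pose F w := inv_theta w (piv (inv_vec w)) (ent (inv_vec w) (piv (inv_vec w)) (js 0))^-1.
have FE s u t b : s 0 0 = 1 -> u != 0 ->
    F (segvec s (pvec s1 u t b)) = pvec s (unshift (s1 - s) t u) t b.
  move=> s0 u0; rewrite /F.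
  have -> : inv_vec (segvec s (pvec s1 u t b)) = pvec s1 u t b.
    by apply/rowP => k; rewrite mxE segvecE s0 mul1r.
  by rewrite /ent pvec_0 // inv_thetaE // pivP.
have [g hg] : exists g, forall r w, var_product (affine_space C m) X r -> coords r w ->
    coords (g r) (F w).
  apply: (pt_map_ex q0 (X := var_product (affine_space C m) X) (F := F)).
    move=> r w Pr rw; have [s [u [t [b [s0 gd ->]]]]] := product_coords Pr rw.
    have [_ u0 _ _ _] := gd; rewrite FE //; apply: pvec_neq0 => //; exact: psi_neq0.
  move=> r w a Pr rw a0; have [s [u [t [b [s0 gd ->]]]]] := product_coords Pr rw.
  have [_ u0 _ _ _] := gd; exists a.
  by rewrite -segvecZr -pvecZ !FE ?scaler_eq0 ?negb_or ?a0 // -pvecZ /unshift psiZ.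
have gE r s u t b : s 0 0 = 1 -> good s1 u t b -> coords r (segvec s (pvec s1 u t b)) ->
    coords (g r) (pvec s (unshift (s1 - s) t u) t b).
  move=> s0 gd rv; have [_ u0 _ _ _] := gd; rewrite -FE //; apply: (hg _ _ _ rv).
  have [p ps] := pt_ex (sn s s0); have [q qv] := pt_ex (pvec_neq0 t b s10 u0).
  exists p, q; split; [exact: affine_of_coords ps|by exists u, t, b|].
  by exists s, (pvec s1 u t b); split; [exact: ps|exact: qv|exact: rv].
have thetaP p s u t b : good s u t b -> coords p (pvec s u t b) ->
    exists x, [/\ X x, coords x (pvec s1 (shift (s1 - s) t u) t b) & segre (h p) x (theta p)].
  move=> gd pv; have g1 := good_shift s10 gd; have [_ u0 _ _ _] := g1.
  have [x xv] := pt_ex (pvec_neq0 t b s10 u0); exists x; split=> //.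
    by exists (shift (s1 - s) t u), t, b.
  exists s, (pvec s1 (shift (s1 - s) t u) t b); split=> //; first exact: hh pv.
  exact: ht pv.
have hA p : total_space p -> affine_space C m (h p).
  move=> [s [u [t [b [gd pv]]]]]; have [s0 _ _ _ _] := gd.
  exact: affine_of_coords (hh _ _ _ _ _ gd pv).
exists h, theta; split.
  split.
  - exact: total_quasi_projective.
  - apply: (total_morphism (G := fun _ s _ _ => s)) => //.
    + by move=> i; have [_ h2 _ _] := polyfun_chart m e RtoC i.
    + by move=> p u s t b _; exact: hh.
  - exists g; split.
    + apply: (total_morphism (G := G)) => //.
      * move=> i; have [h1 h2 h3 h4] := polyfun_chart m e (idfun : {rmorphism C -> C}) i.
        have pc c : polyfun idfun (fun _ : 'rV[C]_K => c) by exact: (polyfunC idfun).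
        move=> l; case/mxvec_indexP: l => j k.
        apply: (@polyfun_ext _ _ _ _ (fun v => sv v i 0 j * pvec s1 (shift (s1 - sv v i)
          (tv v i) (colv v (js 0))) (tv v i) (bv v i) 0 k)) => [v|].
          by rewrite /G segvecE.
        apply: polyfunM => //.
        apply: polyfun_pvec => //; apply: pf_shift => // l.
        apply: (@polyfun_ext _ _ _ _ (fun v => s1 0 l - sv v i 0 l)).
          by move=> v; rewrite [RHS]mxE [X in _ = _ + X]mxE.
        by apply: polyfunD => //; apply: polyfunN.
      * by move=> p u s t b _; exact: ht.
      * move=> p tp; have [s [u [t [b [gd pv]]]]] := tp.
        have [x [Xx _ sx]] := thetaP _ _ _ _ _ gd pv.
        by exists (h p), x; split=> //; exact: hA.
    + apply: var_morphism_chart => [r Pr|r Pr].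
        have [w rw] := coords_ex r.
        have [s [u [t [b [s0 gd wE]]]]] := product_coords Pr rw.
        rewrite wE in rw; have g1 := good_unshift s0 gd.
        by exists s, (unshift (s1 - s) t u), t, b; split=> //; exact: gE.
      have [w rw] := coords_ex r.
      have [s [u [t [b [s0 gd wE]]]]] := product_coords Pr rw.
      have [_ u0 _ _ _] := gd; have [i ui] := u_pivot u0.
      (* This coordinate is [s_0 * u_i = u_i]. In the chart where it equals 1 the divisor in
         [inv_theta] is 1, and the inverse is polynomial. *)
      exists (mxvec_index 0 (mxvec_index i (js 0))), (fun k w => inv_theta w i 1 0 k); split.
      * have hX k : polyfun idfun (fun w : 'rV[C]_((1 + m) * K) => w 0 k) by exact: polyfunX.
        have hs j : polyfun idfun (fun w => inv_s w i 1 0 j).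
          apply: polyfun_ext (hX (mxvec_index j (mxvec_index i (js 0)))) => w'.
          by rewrite mxE mul1r.
        have hent k l : polyfun idfun (fun w => ent (inv_vec w) k l).
          by apply: polyfun_ext (hX (mxvec_index 0 (mxvec_index k l))) => w'; rewrite /ent mxE.
        have ht' : polyfun idfun (fun w => 1 * tv (inv_vec w) i).
          by apply: polyfun_ext (hent i (jt m e)) => w'; rewrite mul1r.
        apply: polyfun_pvec => //.
          apply: pf_unshift => // l.
            apply: (@polyfun_ext _ _ _ _ (fun w => s1 0 l - inv_s w i 1 0 l)).
              by move=> w'; rewrite [RHS]mxE [X in _ = _ + X]mxE.
            by apply: polyfunD; [exact: (polyfunC idfun)|apply: polyfunN].
          by apply: polyfun_ext (hent l (js 0)) => w'; rewrite mxE.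
        move=> l; apply: polyfun_ext (hent i (jb m l)) => w'.
        by rewrite !mxE mul1r.
      * move=> w' rw'; have [a a0 ->] := coords_prop rw rw'.
        by rewrite mxE wE segvecE s0 mul1r pvec_0 // mulf_neq0.
      * move=> r' w' Pr' rw' w1.
        have [s' [u' [t' [b' [s0' gd' w'E]]]]] := product_coords Pr' rw'.
        move: w1; rewrite w'E segvecE s0' mul1r pvec_0 // => u1.
        have := inv_thetaE t' b' s0' (i := i) (u := u'); rewrite u1 oner_eq0 invr1.
        move=> /(_ isT) iE.
        have -> : \row_k inv_theta (segvec s' (pvec s1 u' t' b')) i 1 0 k =
            pvec s' (unshift (s1 - s') t' u') t' b'.
          by apply/rowP => k; rewrite mxE iE.
        by apply: gE => //; rewrite -w'E.
    + move=> p [s [u [t [b [gd pv]]]]]; have [s0 _ _ _ _] := gd.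
      have := gE _ _ _ _ _ s0 (good_shift s10 gd) (ht _ _ _ _ _ gd pv).
      by rewrite /unshift phiK => /coords_inj; apply.
    + move=> r Pr; have [w rw] := coords_ex r.
      have [s [u [t [b [s0 gd wE]]]]] := product_coords Pr rw.
      rewrite wE in rw; have g1 := good_unshift s0 gd.
      have := ht _ _ _ _ _ g1 (gE _ _ _ _ _ s0 gd rw).
      by rewrite /G /shift psiK => /coords_inj; apply.
  - move=> p [s [u [t [b [gd pv]]]]].
    by have [x [Xx _ sx]] := thetaP _ _ _ _ _ gd pv; exists x.
move=> s p s0 ps; apply/seteqP; split=> z.
  move=> [[s' [u [t [b [gd zv]]]]] hz]; exists u, t, b.
  suff <- : s' = s by [].
  have zs := hh _ _ _ _ _ gd zv; rewrite hz in zs; have [s0' _ _ _ _] := gd.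
  have [a _ sE] := coords_prop ps zs; rewrite sE.
  have a1 : a = 1 by move: s0'; rewrite sE mxE s0 mulr1.
  by rewrite a1 scale1r.
move=> [u [t [b [gd zv]]]]; split; first by exists s, u, t, b.
by apply: coords_inj ps; exact: hh zv.
Qed.

End RelativeForm.

(** * Rigidity *)

Section CurveLifting.
Variable C : numClosedFieldType.

(** C[x] is principal: [g] generates the ideal of the [P i], built by iterating the two-term Bezout
    identity. *)
Lemma poly_bezout (I : finType) (P : I -> {poly C}) : exists g a Q,
  (forall i, P i = Q i * g) /\ g = \sum_i a i * P i.
Proof.
pose ideal g := exists a, g = \sum_i a i * P i.
have idealP i : ideal (P i).
  exists (fun k => (k == i)%:R); rewrite (bigD1 i) //= eqxx mul1r big1 ?addr0 // => k ki.
  by rewrite (negbTE ki) mul0r.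
have idealD u v g h : ideal g -> ideal h -> ideal (u * g + v * h).
  move=> [a ->] [b ->]; exists (fun i => u * a i + v * b i).
  rewrite !mulr_sumr -big_split; apply: eq_bigr => i _ /=.
  by rewrite mulrDl !mulrA.
have [g [a gE] gP] : exists2 g, ideal g & forall i, i \in enum I -> g %| P i.
  elim: (enum I) => [|i r [g Ig gP]].
    by exists 0 => //; exists (fun=> 0); rewrite big1 // => i _; rewrite mul0r.
  have [[u' v'] /= e] := Bezoutp (P i) g.
  exists (u' * P i + v' * g); first exact: idealD.
  move=> k; rewrite inE (eqp_dvdl _ e) => /orP[/eqP ->|/gP]; first exact: dvdp_gcdl.
  by apply: dvdp_trans; exact: dvdp_gcdr.
exists g, a, (fun i => P i %/ g); split=> // i.
by rewrite divpK // gP // mem_enum.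
Qed.

(** A common divisor of entries without common zero has no root, so it is a nonzero constant and can
    be divided out. *)
Lemma polyf_bezout N (g : C -> 'rV[C]_N) : (forall i, polyf (fun x => g x 0 i)) ->
  (forall x, g x != 0) ->
  exists a : 'I_N -> C -> C, (forall i, polyf (a i)) /\
    forall x, \sum_i a i x * g x 0 i = 1.
Proof.
move=> /choice[P hP] nz; have [d [a [Q [PQ dE]]]] := poly_bezout P.
have dx x : d.[x] != 0.
  have /rV0Pn[i gi] := nz x.
  by apply: contraNneq gi => d0; rewrite hP PQ hornerM d0 mulr0.
have dC x : d.[x] = d.[0] := polyf_nz_const (polyf_horner d) dx x.
exists (fun i x => d.[0]^-1 * (a i).[x]); split.
  by move=> i; apply: polyfM; [exact: polyfC|exact: polyf_horner].
move=> x; transitivity (d.[0]^-1 * d.[x]); last by rewrite dC mulVf // dx.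
have -> : d.[x] = \sum_i (a i).[x] * (P i).[x].
  by rewrite [in LHS]dE horner_sum; apply: eq_bigr => i _; rewrite hornerM.
by rewrite mulr_sumr; apply: eq_bigr => i _; rewrite hP mulrA.
Qed.

Lemma proportional N (v w : 'rV[C]_N) : v != 0 -> w != 0 ->
  (forall i j, v 0 i * w 0 j = v 0 j * w 0 i) -> exists2 a, a != 0 & w = a *: v.
Proof.
move=> /rV0Pn[i vi] w0 h.
have wE : w = (w 0 i / v 0 i) *: v.
  by apply/rowP => j; rewrite mxE mulrAC [w 0 i * _]mulrC -h mulrAC divff ?mul1r.
exists (w 0 i / v 0 i) => //.
by apply: contraNneq w0 => e; rewrite wE e scale0r.
Qed.

Section Morphism.
Variables (k : fieldType) (iota : {rmorphism k -> C}) (N M : nat).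
Variables (X : set (pt C N)) (Y : set (pt C M)) (f : pt C N -> pt C M).
Hypothesis hf : var_morphism iota X Y f.

(** One local formula of [f] around [p0], composed with [g], gives polynomial representatives near
    [x0]; a relation true for almost all [x] is then a polynomial identity. *)
Lemma morphism_linear_closed (g : C -> 'rV[C]_N) (E : 'I_M -> C -> C) x0 p0 :
  (forall i, polyf (fun x => g x 0 i)) -> (forall i, polyf (E i)) ->
  X p0 -> coords p0 (g x0) ->
  cofinitely (fun x => exists p, [/\ X p, coords p (g x) &
     forall v, coords (f p) v -> \sum_i E i x * v 0 i = 0]) ->
  forall v, coords (f p0) v -> \sum_i E i x0 * v 0 i = 0.
Proof.
move=> hg hE Xp0 p0g gen v fv; have [_ loc] := hf.
have [d [F [homF F0 FE]]] := loc p0 Xp0.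
pose r x : 'rV[C]_M := \row_i evalp iota (F i) (g x).
have hr i : polyf (fun x => r x 0 i).
  by apply: polyf_ext (polyf_evalp iota (F i) hg) => x; rewrite mxE.
have r0 := F0 _ p0g; have /rV0Pn[i ri] := r0.
have [a a0 ->] := coords_prop (FE p0 _ Xp0 p0g r0) fv.
transitivity (a * \sum_i E i x0 * r x0 0 i).
  by rewrite mulr_sumr; apply: eq_bigr => j _; rewrite mxE mulrCA.
suff -> : \sum_i E i x0 * r x0 0 i = 0 by rewrite mulr0.
apply: (polyf_eq (f := fun x => \sum_i E i x * r x 0 i) _ (polyfC 0)).
  by apply: polyf_sum => j; apply: polyfM.
have ci := cofinitely_neq0 (hr i) ri.
apply: cofinitelyW (cofinitely_and gen ci) => x [[p [Xp pg h]] rx].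
apply: h; apply: FE => //.
by apply: contraNneq rx => h; rewrite [r x]h mxE.
Qed.

Lemma morphism_entry_closed (g : C -> 'rV[C]_N) (c : C -> C) (k1 k2 : 'I_M) x0 p0 :
  (forall i, polyf (fun x => g x 0 i)) -> polyf c -> X p0 -> coords p0 (g x0) ->
  cofinitely (fun x => exists p, [/\ X p, coords p (g x) &
     forall v, coords (f p) v -> v 0 k1 = c x * v 0 k2]) ->
  forall v, coords (f p0) v -> v 0 k1 = c x0 * v 0 k2.
Proof.
move=> hg hc Xp0 p0g gen v fv.
pose E i x := (i == k1)%:R - c x * (i == k2)%:R.
have sumE x (w : 'rV[C]_M) : \sum_i E i x * w 0 i = w 0 k1 - c x * w 0 k2.
  have aux (l0 : 'I_M) : \sum_l (l == l0)%:R * w 0 l = w 0 l0.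
    rewrite (bigD1 l0) //= eqxx mul1r big1 ?addr0 // => l /negbTE ->.
    by rewrite mul0r.
  rewrite -(aux k1) -(aux k2) mulr_sumr -sumrB; apply: eq_bigr => l _.
  by rewrite mulrBl mulrA.
apply/eqP; rewrite -subr_eq0 -sumE; apply/eqP.
apply: (morphism_linear_closed hg _ Xp0 p0g _ fv) => [l|].
  by apply: polyfB; [exact: polyfC|apply: polyfM => //; exact: polyfC].
apply: cofinitelyW gen => x [p [Xp pg h]]; exists p; split=> // w fw.
by rewrite sumE h // subrr.
Qed.

(** Proportionality to [h x] is expressed by 2 by 2 minors, which are linear in the coordinates of
    the image. *)
Lemma morphism_limit (g : C -> 'rV[C]_N) (h : C -> 'rV[C]_M) x0 p0 :
  (forall i, polyf (fun x => g x 0 i)) -> (forall i, polyf (fun x => h x 0 i)) ->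
  X p0 -> coords p0 (g x0) -> h x0 != 0 ->
  cofinitely (fun x => exists p, [/\ X p, coords p (g x) & coords (f p) (h x)]) ->
  coords (f p0) (h x0).
Proof.
move=> hg hh Xp0 p0g h0 gen; have [v fv] := coords_ex (f p0).
have [a a0 ->] : exists2 a, a != 0 & h x0 = a *: v; last exact: coordsZ.
apply: proportional h0 _ => [|i j]; first exact: coords_neq0 fv.
pose E l x := (l == i)%:R * h x 0 j - (l == j)%:R * h x 0 i.
have sumE x w : \sum_l E l x * w 0 l = w 0 i * h x 0 j - w 0 j * h x 0 i.
  have aux c (l0 : 'I_M) : \sum_l (l == l0)%:R * c * w 0 l = w 0 l0 * c.
    rewrite (bigD1 l0) //= eqxx mul1r mulrC big1 ?addr0 // => l /negbTE ->.
    by rewrite !mul0r.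
  rewrite -(aux (h x 0 j) i) -(aux (h x 0 i) j) -sumrB; apply: eq_bigr => l _.
  by rewrite mulrBl.
apply/eqP; rewrite -subr_eq0 -sumE; apply/eqP.
apply: (morphism_linear_closed hg _ Xp0 p0g _ fv) => [l|].
  by apply: polyfB; apply: polyfM => //; exact: polyfC.
apply: cofinitelyW gen => x [p [Xp pg fp]]; exists p; split=> // w fw.
by rewrite sumE; have [c _ ->] := coords_prop fp fw; rewrite !mxE; ring.
Qed.

(** A local formula at one point, divided by the gcd of its entries, has no common zero on the line.
    It is correct generically, hence everywhere by [morphism_limit]. *)
Lemma morphism_lift (g : C -> 'rV[C]_N) :
  (forall i, polyf (fun x => g x 0 i)) -> (forall x, exists2 p, coords p (g x) & X p) ->
  exists h : C -> 'rV[C]_M, (forall i, polyf (fun x => h x 0 i)) /\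
    forall x p, coords p (g x) -> coords (f p) (h x).
Proof.
move=> hg hX; have [_ loc] := hf.
have [p0 p0g Xp0] := hX 0; have [d [F [homF F0 FE]]] := loc p0 Xp0.
have /choice[P hP] i : exists P : {poly C}, forall x, evalp iota (F i) (g x) = P.[x].
  exact: polyf_evalp.
have [D [a [Q [PQ DE]]]] := poly_bezout P.
have rE x : \row_i evalp iota (F i) (g x) = D.[x] *: \row_i (Q i).[x].
  by apply/rowP => i; rewrite !mxE hP PQ hornerM mulrC.
have D0 : D != 0.
  by have := F0 _ p0g; apply: contraNneq => D0; rewrite rE D0 horner0 scale0r.
have QE : \sum_i a i * Q i = 1.
  apply: (mulIf D0); rewrite mul1r {2}DE mulr_suml; apply: eq_bigr => i _.
  by rewrite PQ mulrA.
have Qn x : \row_i (Q i).[x] != 0.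
  apply/eqP => /rowP h; have := congr1 (horner^~ x) QE.
  rewrite horner_sum hornerC big1 => [/esym/eqP|i _]; first by rewrite oner_eq0.
  by have := h i; rewrite !mxE hornerM => ->; rewrite mulr0.
have hQ i : polyf (fun x => (\row_i (Q i).[x]) 0 i).
  by exists (Q i) => x; rewrite mxE.
exists (fun x => \row_i (Q i).[x]); split=> // x p pg.
have [p' p'g Xp'] := hX x; rewrite (coords_inj pg p'g) {p pg}.
apply: (morphism_limit hg hQ) => //.
exists D => // y Dy; have [q qg Xq] := hX y; exists q; split=> //.
have : coords (f q) (\row_i evalp iota (F i) (g y)).
  by apply: FE => //; rewrite rE scaler_eq0 negb_or Dy Qn.
rewrite rE => /(coordsZ (a := D.[y]^-1)); rewrite scalerA mulVf // scale1r; apply.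
by rewrite invr_eq0.
Qed.

End Morphism.

Lemma horner_nat0 (P : {poly C}) : (forall j : nat, P.[j%:R] = 0) -> P = 0.
Proof.
move=> h; apply/eqP; apply: contraT => P0.
have := max_poly_roots P0 (rs := [seq i%:R | i <- iota 0 (size P)]).
rewrite size_map size_iota ltnn; apply.
  by apply/allP => x /mapP[i _ ->]; rewrite /root h.
by rewrite map_inj_uniq ?iota_uniq //; apply: mulrIn; rewrite oner_eq0.
Qed.

(** Needed for relations involving conjugation, which become polynomial only at real [x]; the
    natural numbers are enough real points. *)
Lemma polyf_eq_nat (f g : C -> C) : polyf f -> polyf g ->
  cofinitely (fun x => (exists j : nat, x = j%:R) -> f x = g x) -> forall x, f x = g x.
Proof.
move=> [P hP] [Q hQ] [e e0 he] x.
have : (P - Q) * e = 0.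
  apply: horner_nat0 => j; rewrite hornerM hornerD hornerN -hP -hQ.
  have [->|/he ->] := eqVneq e.[j%:R] 0; first by rewrite mulr0.
    by rewrite subrr mul0r.
  by exists j.
move=> /eqP; rewrite mulf_eq0 (negbTE e0) orbF subr_eq0 => /eqP PQ.
by rewrite hP hQ PQ.
Qed.

(** Degrees multiply under composition, and [g] composed with [f] has degree one. *)
Lemma polyf_inverse (f g : C -> C) : polyf f -> polyf g -> (forall x, g (f x) = x) ->
  exists a b, a != 0 /\ forall x, f x = a * x + b.
Proof.
move=> [P hP] [Q hQ] h.
have QP : Q \Po P = 'X.
  apply/eqP; rewrite -subr_eq0; apply/eqP; apply: horner_inj0 => x.
  by rewrite hornerD hornerN horner_comp -hP -hQ h hornerX subrr.
have := size_comp_poly Q P; rewrite QP size_polyX /= => /esym/eqP.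
rewrite muln_eq1 => /andP[_ /eqP sP].
have P2 : size P = 2%N by move: sP; case: (size P) => [|[|[|]]].
exists P`_1, P`_0; split=> [|x].
  have : lead_coef P != 0 by rewrite lead_coef_eq0 -size_poly_eq0 P2.
  by rewrite lead_coefE P2.
by rewrite hP horner_coef P2 big_ord_recl big_ord1 /= expr0 expr1 mulr1 addrC.
Qed.

(** [f] and [g] are the two affine expressions of one regular function on the projective line.
    Multiplying by a power of [x] compares degrees and leaves only a constant. *)
Lemma polyf_inv_const (f g : C -> C) c : c != 0 -> polyf f -> polyf g ->
  (forall x, x != 0 -> f x = g (c * x)^-1) -> forall x, f x = f 0.
Proof.
move=> c0 [P hP] [Q hQ] h x.
have E : P * 'X^(size Q) = \sum_(i < size Q) (Q`_i * c^-1 ^+ i) *: 'X^(size Q - i).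
  apply/eqP; rewrite -subr_eq0; apply/eqP.
  (* The extra factor ['X] settles [y = 0], where the relation between [f] and [g] is not given. *)
  have : (P * 'X^(size Q) - \sum_(i < size Q) (Q`_i * c^-1 ^+ i) *: 'X^(size Q - i)) * 'X = 0.
    apply: horner_inj0 => y; rewrite hornerM hornerX.
    have [->|y0] := eqVneq y 0; first by rewrite mulr0.
    rewrite hornerD hornerN hornerM hornerXn -hP h // hQ horner_coef horner_sum.
    rewrite mulr_suml -sumrB big1 ?mul0r // => i _.
    have yi : y^-1 ^+ i * y ^+ i = 1 by rewrite -exprMn mulVf // expr1n.
    have -> : y ^+ size Q = y ^+ (size Q - i) * y ^+ i by rewrite -exprD subnK // ltnW.
    rewrite hornerZ hornerXn invfM exprMn.
    transitivity (Q`_i * c^-1 ^+ i * y ^+ (size Q - i) * (y^-1 ^+ i * y ^+ i - 1)).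
      by move: (c^-1 ^+ i) (y^-1 ^+ i) (y ^+ i) (y ^+ _) Q`_i => *; ring.
    by rewrite yi subrr mulr0.
  by move=> /eqP; rewrite mulf_eq0 polyX_eq0 orbF => /eqP.
have : (size (P * 'X^(size Q))%R <= (size Q).+1)%N.
  rewrite E; apply: (leq_trans (poly.size_sum _ _ _)); apply/bigmax_leqP => i _.
  apply: (leq_trans (size_scale_leq _ _)); rewrite size_polyXn ltnS leq_subr.
  by [].
have [P0|P0] := eqVneq P 0.
  by move=> _; rewrite !hP P0 !horner0.
rewrite size_mulXn // -addn1 leq_add2l => /size1_polyC PC.
by rewrite !hP PC !hornerC.
Qed.

End CurveLifting.

(** The hypothesis [h 0 != h 1] is a checkable form of nonconstancy. *)
Lemma polyf_neq (C : numClosedFieldType) (h : C -> C) a :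
  polyf h -> h 0 != h 1 -> cofinitely (fun x => h x != a).
Proof.
move=> hh h01; have ph := polyfB hh (polyfC a).
have [h0|h0] := eqVneq (h 0) a.
  apply: cofinitelyW (cofinitely_neq0 (x := 1) ph _) => [x|]; first by rewrite subr_eq0.
  by rewrite subr_eq0 -h0 eq_sym.
apply: cofinitelyW (cofinitely_neq0 (x := 0) ph _) => [x|]; first by rewrite subr_eq0.
by rewrite subr_eq0.
Qed.

Lemma polyf_notin (C : numClosedFieldType) (h : C -> C) (r : seq C) :
  polyf h -> h 0 != h 1 -> cofinitely (fun x => h x \notin r).
Proof.
move=> hh h01; elim: r => [|a r IH]; first exact: cofinitely_all.
apply: cofinitelyW (cofinitely_and (polyf_neq a hh h01) IH) => x [h1 h2].
by rewrite inE negb_or h1.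
Qed.

(** * Isomorphisms preserve the projection to [t] *)

Section Fibration.
Variable R : realType.
Local Notation C := R[i].
Local Notation cj := (@cj R).
Local Notation conjv := (map_mx cj).
Local Notation ii := (ii R).
Variables (m e : nat).
Local Notation n := ((1 + m) + (1 + e))%N.
Local Notation K := (3 * n)%N.
Local Notation js := (@js m e).
Local Notation jt := (jt m e).
Local Notation jb := (@jb m e).
Local Notation slice := (@slice R m e).
Implicit Types (u : 'rV[C]_3) (s : 'rV[C]_(1 + m)) (t w : C) (b : 'rV[C]_e).

(* The two affine lines covering the conic over t, with coordinates w = z / v (for
   o = true) and w = z / u. *)
Definition cu (o : bool) t w : 'rV[C]_3 :=
  if o then uvz (t * w ^+ 2) 1 w else uvz 1 (t * w ^+ 2) w.
Definition cB (o : bool) u := if o then cV u else cU u.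

Lemma cu_conic o t w : cU (cu o t w) * cV (cu o t w) = t * cZ (cu o t w) ^+ 2.
Proof. by case: o; rewrite !uvzE; ring. Qed.

Lemma cB_cu o t w : cB o (cu o t w) = 1.
Proof. by case: o; rewrite /= uvzE. Qed.

Lemma cZ_cu o t w : cZ (cu o t w) = w.
Proof. by case: o; rewrite /= uvzE. Qed.

Lemma cB_neq0 o u : cB o u != 0 -> u != 0.
Proof.
apply: contraNneq => ->.
by case: o; rewrite /= /cV /cU !mxE mulr0 ?addr0 ?subr0.
Qed.

Lemma cu_neq0 o t w : cu o t w != 0.
Proof. by apply: (@cB_neq0 o); rewrite cB_cu oner_neq0. Qed.

Lemma cu_conj o t w : conjv (cu o t w) = cu (~~ o) (cj t) (cj w).
Proof.
by apply: uvz_inj; rewrite ?cU_conj ?cV_conj ?cZ_conj; case: o;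
  rewrite /= !uvzE ?cj1 ?cjM ?cjX.
Qed.

(** The coordinates [z / v] and [z / u] have product [z^2 / (u v) = 1 / t]. *)
Lemma cu_flip o t w : t != 0 -> w != 0 ->
  cu (~~ o) t w = (t * w ^+ 2) *: cu o t (t * w)^-1.
Proof.
move=> t0 w0; have E : t * w ^+ 2 * (t * (t * w)^-1 ^+ 2) = 1.
  by field; rewrite t0 w0.
have E' : t * w ^+ 2 * (t * w)^-1 = w by field; rewrite t0 w0.
by apply: uvz_inj; rewrite ?cUZ ?cVZ ?cZZ; case: o; rewrite /= !uvzE ?mulr1 ?E ?E'.
Qed.

Lemma cu_eta o u t : cU u * cV u = t * cZ u ^+ 2 -> cB o u != 0 ->
  u = cB o u *: cu o t (cZ u / cB o u).
Proof.
move=> E B0; apply: uvz_inj; rewrite ?cUZ ?cVZ ?cZZ ?cZ_cu; last first.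
- by rewrite mulrC divfK.
- move: B0; case: o; rewrite /= !uvzE ?mulr1 // => B0.
  by apply: (mulfI B0); rewrite E; field.
- move: B0; case: o; rewrite /= !uvzE ?mulr1 // => B0.
  by apply: (mulIf B0); rewrite E; field.
Qed.

Lemma polyf_cu o (f g : C -> C) : polyf f -> polyf g ->
  forall i, polyf (fun x => cu o (f x) (g x) 0 i).
Proof.
move=> hf hg; have h : polyf (fun x => f x * g x ^+ 2).
  by apply: polyfM => //; apply: polyf_exp.
by case: o; apply: polyf_uvz => //; exact: polyfC.
Qed.

Definition real_row s := forall j, cj (s 0 j) = s 0 j.

Lemma real_add_ii x : cj x = x -> x + ii != 0.
Proof.
move=> rx; rewrite addr_eq0; apply/eqP => xE; move: rx.
rewrite xE cjN cj_ii opprK => /eqP; rewrite -subr_eq0 opprK -mulr2n mulrn_eq0 /=.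
by rewrite (negbTE (ii_neq0 R)).
Qed.

Lemma real_sub_ii x : cj x = x -> x - ii != 0.
Proof.
move=> rx; rewrite -(opprK x) -opprD oppr_eq0; apply: real_add_ii.
by rewrite cjN rx.
Qed.

Definition badseq : seq C :=
  [seq tj R j | j : 'I_(1 + m)] ++ [seq - tj R j | j : 'I_(1 + m)].

Lemma removed_bad s u t : removed s u t -> t \in badseq.
Proof.
case=> j [[-> _ _]|[-> _ _]]; rewrite mem_cat.
  by rewrite map_f ?mem_enum.
by rewrite [X in _ || X]map_f ?mem_enum ?orbT.
Qed.

(** A removed point has coordinate [s_j + i] or [s_j - i], nonzero for real [s]. Hence the two
    sections are complete affine lines in every real slice. *)
Lemma removed_cu0 s o t : real_row s -> ~ removed s (cu o t 0) t.
Proof.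
move=> rs; have n1 j := real_add_ii (rs j); have n2 j := real_sub_ii (rs j).
case=> j; case: o; rewrite /removed1 /removed2 /= !uvzE !mulr0 mulr1 => -[][_].
- by move=> /esym/eqP; rewrite (negbTE (n1 j)).
- by move=> _ /eqP; rewrite oner_eq0.
- by move=> _ /eqP; rewrite oner_eq0.
- by move=> /esym/eqP; rewrite (negbTE (n2 j)).
Qed.

Lemma good_cu0 s o t b : s 0 0 = 1 -> real_row s -> (forall l, b 0 l ^+ 2 + 1 != 0) ->
  good s (cu o t 0) t b.
Proof.
by move=> s0 rs hb; split=> //; [exact: cu_neq0|exact: cu_conic|exact: removed_cu0].
Qed.

Lemma good_generic s u t b : s 0 0 = 1 -> (forall l, b 0 l ^+ 2 + 1 != 0) -> u != 0 ->
  cU u * cV u = t * cZ u ^+ 2 -> t \notin badseq -> good s u t b.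
Proof.
by move=> s0 hb u0 E tb; split=> // /removed_bad; rewrite (negbTE tb).
Qed.

Lemma pvec_prop s u t b u' t' b' p : s 0 0 = 1 -> u != 0 ->
  coords p (pvec s u t b) -> coords p (pvec s u' t' b') ->
  [/\ t' = t, b' = b & exists2 a, a != 0 & u' = a *: u].
Proof.
move=> s0 u0 pv pv'; have [a a0] := coords_prop pv pv'; rewrite -pvecZ => /esym E.
have au : a *: u != 0 by rewrite scaler_eq0 negb_or a0.
by have [_ <- <- <-] := pvec_inj s0 s0 au E; split=> //; exists a.
Qed.

(** Every point, even over a bad value of [t] or on the singular conic, starts a polynomial curve
    along which [t] varies. Statements known over generic [t] reach all points through it. *)
Lemma generic_curve u t : u != 0 -> cU u * cV u = t * cZ u ^+ 2 ->
  exists (g : C -> 'rV[C]_3) (h : C -> C),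
  [/\ forall i, polyf (fun x => g x 0 i), polyf h,
      forall x, cU (g x) * cV (g x) = h x * cZ (g x) ^+ 2,
      g 0 = u /\ h 0 = t &
      h 0 != h 1 /\ exists o, cofinitely (fun x => cB o (g x) != 0)].
Proof.
move=> u0 E; have pX := @polyfX C; have pc := @polyfC C.
have [z0|z0] := eqVneq (cZ u) 0.
  have [o Bo] : exists o, cB o u != 0.
    have [V0|V0] := eqVneq (cV u) 0; last by exists true.
    exists false => /=; apply: contraNneq u0 => U0.
    by rewrite u_eq0 U0 V0 z0 !eqxx.
  exists (fun=> u), (fun x => t + x); split=> //.
  - exact: polyfD.
  - by move=> x; rewrite E z0 expr0n !mulr0.
  - by rewrite addr0.
  - split; first by rewrite addr0 -subr_eq0 opprD addrA subrr add0r oppr_eq0 oner_eq0.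
    by exists o; apply: cofinitely_all.
have z2 : cZ u ^+ 2 != 0 by rewrite expf_neq0.
have tE : t = cU u * cV u / cZ u ^+ 2 by rewrite E mulfK.
have [V0|V0] := eqVneq (cV u) 0; last first.
  exists (fun x => uvz (cU u + x) (cV u) (cZ u)), (fun x => (cU u + x) * cV u / cZ u ^+ 2).
  split.
  - by apply: polyf_uvz => //; exact: polyfD.
  - by apply: polyfM => //; apply: polyfM => //; exact: polyfD.
  - by move=> x; rewrite !uvzE divfK.
  - by rewrite !addr0 uvzK -tE.
  - split; last by exists true; apply: cofinitely_all => x; rewrite /= uvzE.
    rewrite addr0 -subr_eq0 -mulrBl -mulrBl opprD addrA subrr add0r.
    by rewrite !mulf_neq0 ?invr_eq0 ?oppr_eq0 ?oner_eq0.
have [U0|U0] := eqVneq (cU u) 0; last first.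
  exists (fun x => uvz (cU u) (cV u + x) (cZ u)), (fun x => cU u * (cV u + x) / cZ u ^+ 2).
  split.
  - by apply: polyf_uvz => //; exact: polyfD.
  - by apply: polyfM => //; apply: polyfM => //; exact: polyfD.
  - by move=> x; rewrite !uvzE divfK.
  - by rewrite !addr0 uvzK -tE.
  - split; last by exists false; apply: cofinitely_all => x; rewrite /= uvzE.
    rewrite addr0 -subr_eq0 -mulrBl -mulrBr opprD addrA subrr add0r.
    by rewrite !mulf_neq0 ?invr_eq0 ?oppr_eq0 ?oner_eq0.
exists (fun x => uvz x x (cZ u)), (fun x => x * x / cZ u ^+ 2); split.
- exact: polyf_uvz.
- by apply: polyfM => //; exact: polyfM.
- by move=> x; rewrite !uvzE divfK.
- by split; [apply: uvz_inj; rewrite uvzE ?U0 ?V0|rewrite tE U0 !mul0r].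
- split; last by exists true; apply: cofinitelyW (cofinitely_neq 0) => x; rewrite /= uvzE.
  by rewrite !mul0r eq_sym mulf_neq0 ?invr_eq0 ?mulf_neq0 ?oner_neq0.
Qed.

Section Lift.
Variables (k : fieldType) (iota : {rmorphism k -> C}).
Variables (s s' : 'rV[C]_(1 + m)) (f : pt C K -> pt C K).
Hypotheses (s0 : s 0 0 = 1) (s0' : s' 0 0 = 1) (rs : real_row s).
Hypothesis hf : var_morphism iota (slice s) (slice s') f.

Lemma slice_of_good u t b p : good s u t b -> coords p (pvec s u t b) -> slice s p.
Proof. by move=> g pv; exists u, t, b. Qed.

(** The lift of a curve in Segre coordinates splits into polynomial lifts of the parameters. *)
Lemma slice_lift (u : C -> 'rV[C]_3) (t : C -> C) (b : C -> 'rV[C]_e) :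
  (forall i, polyf (fun x => u x 0 i)) -> polyf t -> (forall l, polyf (fun x => b x 0 l)) ->
  (forall x, good s (u x) (t x) (b x)) ->
  exists (u' : C -> 'rV[C]_3) (t' : C -> C) (b' : C -> 'rV[C]_e),
  [/\ forall i, polyf (fun x => u' x 0 i), polyf t', forall l, polyf (fun x => b' x 0 l),
      forall x, good s' (u' x) (t' x) (b' x) &
      forall x p, coords p (pvec s (u x) (t x) (b x)) ->
        coords (f p) (pvec s' (u' x) (t' x) (b' x))].
Proof.
move=> hu ht hb hg; have pc := @polyfC C.
have hX x : exists2 p, coords p (pvec s (u x) (t x) (b x)) & slice s p.
  have [_ u0 _ _ _] := hg x; have [p pv] := pt_ex (pvec_neq0 (t x) (b x) s0 u0).
  by exists p => //; exact: slice_of_good (hg x) pv.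
have [h [hh hE]] := morphism_lift hf (polyf_pvec (fun j => pc (s 0 j)) hu ht hb) hX.
have hS x : exists u' t' b', good s' u' t' b' /\ h x = pvec s' u' t' b'.
  have [p pv Xp] := hX x; apply: (@slice_coords _ _ _ _ (f p)); last exact: hE.
  by have [fXY _] := hf; exact: fXY.
pose u' x := colv (h x) (js 0).
have hu' i : polyf (fun x => u' x 0 i).
  by apply: polyf_ext (hh (mxvec_index i (js 0))) => x; rewrite mxE.
have u0' x : u' x != 0.
  by have [v [t1 [b1 [[_ v0 _ _ _] E]]]] := hS x; rewrite /u' E col0_pvec.
(* The entries of [u'] have no common zero, so [\sum_i a_i u'_i = 1]; applying the same combination
   to the columns [u' t'] and [u' b'_l] isolates [t'] and [b'_l] without division. *)
have [a [ha a1]] := polyf_bezout hu' u0'.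
have sumE x (j : 'I_n) v t1 b1 : h x = pvec s' v t1 b1 ->
    \sum_i a i x * ent (h x) i j = base s' t1 b1 0 j.
  move=> E; rewrite -[RHS]mul1r -(a1 x) mulr_suml; apply: eq_bigr => i _.
  by rewrite /u' E col0_pvec // /ent pvecE mulrA.
have hsum j : polyf (fun x => \sum_i a i x * ent (h x) i j).
  by apply: polyf_sum => i; apply: polyfM => //; exact: hh.
exists u', (fun x => \sum_i a i x * ent (h x) i jt),
  (fun x => \row_l \sum_i a i x * ent (h x) i (jb l)).
have main x : good s' (u' x) (\sum_i a i x * ent (h x) i jt)
      (\row_l \sum_i a i x * ent (h x) i (jb l)) /\
    h x = pvec s' (u' x) (\sum_i a i x * ent (h x) i jt)
      (\row_l \sum_i a i x * ent (h x) i (jb l)).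
  have [v [t1 [b1 [gd E]]]] := hS x.
  rewrite (sumE _ _ _ _ _ E) base_t.
  have -> : \row_l \sum_i a i x * ent (h x) i (jb l) = b1.
    by apply/rowP => l; rewrite mxE (sumE _ _ _ _ _ E) base_b.
  by rewrite /u' E col0_pvec.
split=> //.
- by move=> l; apply: polyf_ext (hsum (jb l)) => x; rewrite mxE.
- by move=> x; have [] := main x.
- by move=> x p pv; have [_ <-] := main x; exact: hE.
Qed.

(** [b^2 + 1 = (b + i) (b - i)], so [b + i] is a nowhere vanishing polynomial. *)
Lemma branch_const (b : C -> 'rV[C]_e) : (forall l, polyf (fun x => b x 0 l)) ->
  (forall x l, b x 0 l ^+ 2 + 1 != 0) -> forall x, b x = b 0.
Proof.
move=> hb nz x; apply/rowP => l; apply: (addIr ii).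
apply: (polyf_nz_const (f := fun x => b x 0 l + ii)).
  by apply: polyfD => //; exact: polyfC.
move=> y; apply: contraNneq (nz y l) => h.
have -> : b y 0 l ^+ 2 + 1 = (b y 0 l + ii) * (b y 0 l - ii).
  by rewrite [RHS]mulrC -subr_sqr [ii ^+ 2]mulii opprK.
by rewrite h mul0r.
Qed.

(** A conic over a generic [t] is a projective line, so the [t] of its image is constant along it;
    the [b] is constant along every affine line. *)
Lemma fibration b : (forall l, b 0 l ^+ 2 + 1 != 0) -> exists (tau : C -> C) (beta : 'rV[C]_e),
  polyf tau /\ forall u t p, good s u t b -> coords p (pvec s u t b) ->
    exists u', good s' u' (tau t) beta /\ coords (f p) (pvec s' u' (tau t) beta).
Proof.
move=> hb; have pX := @polyfX C; have pc := @polyfC C.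
have hbc l : polyf (fun _ : C => b 0 l) by exact: pc.
(* [tau] is read along the section [w = 0], which meets every fibre of [t]; this makes it a
   polynomial. *)
have [u1 [tau [b1 [hu1 htau hb1 g1 c1]]]] :=
  slice_lift (polyf_cu true pX (pc 0)) pX hbc (fun x => good_cu0 true x s0 rs hb).
have b1c : forall x, b1 x = b1 0.
  by apply: branch_const => // x; have [_ _ _ + _] := g1 x.
have gl o t w : t \notin badseq -> good s (cu o t w) t b.
  by move=> tb; apply: good_generic => //; [exact: cu_neq0|exact: cu_conic].
have lines t : t \notin badseq -> t != 0 -> forall o w p,
    coords p (pvec s (cu o t w) t b) ->
    exists u', good s' u' (tau t) (b1 0) /\ coords (f p) (pvec s' u' (tau t) (b1 0)).
  move=> tb t0.
  have L o := slice_lift (polyf_cu o (pc t) pX) (pc t) hbc (fun w => gl o t w tb).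
  have [uT [tT [bT [_ htT hbT gT cT]]]] := L true.
  have [uF [tF [bF [_ htF hbF gF cF]]]] := L false.
  have bTc : forall x, bT x = bT 0.
    by apply: branch_const => // x; have [_ _ _ + _] := gT x.
  have bFc : forall x, bF x = bF 0.
    by apply: branch_const => // x; have [_ _ _ + _] := gF x.
  (* The two lines overlap through [w |-> 1 / (t w)], the form required by [polyf_inv_const]. *)
  have swap w : w != 0 -> tT w = tF (t * w)^-1 /\ bT w = bF (t * w)^-1.
    move=> w0; have [p pv] := pt_ex (pvec_neq0 t b s0 (cu_neq0 true t w)).
    have a0 : t * w ^+ 2 != 0 by rewrite mulf_neq0 ?expf_neq0.
    have pv' : coords p (pvec s (cu false t (t * w)^-1) t b).
      move: pv; rewrite (cu_flip false t0 w0) pvecZ => /(coordsZ (a := (t * w ^+ 2)^-1)).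
      by rewrite invr_eq0 scalerA mulVf // scale1r; apply.
    have [_ uF0 _ _ _] := gF (t * w)^-1.
    by have [-> -> _] := pvec_prop s0' uF0 (cF _ _ pv') (cT _ _ pv).
  have swap' w : w != 0 -> tF w = tT (t * w)^-1.
    move=> w0; have tw : (t * w)^-1 != 0 by rewrite invr_eq0 mulf_neq0.
    by have [-> _] := swap _ tw; congr tF; rewrite invfM invrK mulKf.
  have tTc : forall w, tT w = tT 0.
    by apply: (polyf_inv_const t0 htT htF) => w w0; have [] := swap w w0.
  have tFc : forall w, tF w = tF 0.
    by apply: (polyf_inv_const t0 htF htT) => w w0; exact: swap'.
  have [tT1 bT1] : tT 0 = tau t /\ bT 0 = b1 0.
    have [p pv] := pt_ex (pvec_neq0 t b s0 (cu_neq0 true t 0)).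
    have [_ u10 _ _ _] := g1 t.
    by rewrite -(b1c t); have [-> -> _] := pvec_prop s0' u10 (c1 _ _ pv) (cT _ _ pv).
  have [tF1 bF1] : tF 0 = tau t /\ bF 0 = b1 0.
    have [e1 e2] := swap 1 (oner_neq0 _).
    by rewrite -(tFc (t * 1)^-1) -(bFc (t * 1)^-1) -e1 -e2 tTc bTc.
  move=> [] w p pv.
    by exists (uT w); have := gT w; have := cT w p pv; rewrite tTc bTc tT1 bT1.
  by exists (uF w); have := gF w; have := cF w p pv; rewrite tFc bFc tF1 bF1.
exists tau, (b1 0); split=> // u t p gd pv.
have [_ u0 E _ _] := gd.
(* [lines] covers only values of [t] that are neither bad nor 0; the point is now reached as a limit
   along a curve. *)
have [g [h [hg hh gE [g0 h0] [h01 [o cB0]]]]] := generic_curve u0 E.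
have Xp := slice_of_good gd pv.
have hp := polyf_pvec (fun j => pc (s 0 j)) hg hh hbc.
have pv0 : coords p (pvec s (g 0) (h 0) b) by rewrite g0 h0.
have gen : cofinitely (fun x => exists q, [/\ slice s q, coords q (pvec s (g x) (h x) b) &
    exists u', coords (f q) (pvec s' u' (tau (h x)) (b1 0))]).
  have c2 := cofinitely_and cB0 (cofinitely_and (polyf_notin badseq hh h01) (polyf_neq 0 hh h01)).
  apply: cofinitelyW c2 => x [Bx [tb t0]].
  have gx := cu_eta (gE x) Bx.
  have [q qv] := pt_ex (pvec_neq0 (h x) b s0 (cB_neq0 Bx)).
  exists q; split=> //.
    exists (g x), (h x), b; split=> //; apply: good_generic => //; exact: cB_neq0 Bx.
  have qv' : coords q (pvec s (cu o (h x) (cZ (g x) / cB o (g x))) (h x) b).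
    move: qv; rewrite {1}gx pvecZ => /(coordsZ (a := (cB o (g x))^-1)).
    by rewrite invr_eq0 scalerA mulVf // scale1r; apply.
  by have [u' [_ fu']] := lines _ tb t0 _ _ _ qv'; exists u'.
have Xfp : slice s' (f p) by have [fXY _] := hf; exact: fXY.
have [u' [t' [b' [gd' fv]]]] := Xfp.
have [_ u0' _ _ _] := gd'; have [i ui] := u_pivot u0'.
have tE : t' = tau t.
  apply: (mulfI ui); rewrite -[LHS](pvec_t s' u' t' b') mulrC -h0.
  rewrite -(pvec_0 u' t' b' i s0').
  apply: (morphism_entry_closed hf (c := fun x => tau (h x)) hp _ Xp pv0 _ fv).
    exact: polyf_comp.
  apply: cofinitelyW gen => x [q [Xq qv [v fq]]]; exists q; split=> // w fw.
  by have [a _ ->] := coords_prop fq fw; rewrite -pvecZ pvec_t pvec_0 // mulrC.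
have bE : b' = b1 0.
  apply/rowP => l; apply: (mulfI ui); rewrite -[LHS](pvec_b s' u' t' b') mulrC.
  rewrite -(pvec_0 u' t' b' i s0').
  apply: (morphism_entry_closed hf (c := fun x => b1 0 0 l) hp _ Xp pv0 _ fv).
    exact: pc.
  apply: cofinitelyW gen => x [q [Xq qv [v fq]]]; exists q; split=> // w fw.
  by have [a _ ->] := coords_prop fq fw; rewrite -pvecZ pvec_b pvec_0 // mulrC.
by exists u'; rewrite -tE -bE.
Qed.

End Lift.
End Fibration.

(** * Real morphisms, conjugate sections and parity *)

Section ConjugateMaps.
Variable R : realType.
Local Notation C := R[i].
Local Notation RtoC := (real_complex R : {rmorphism R -> C}).
Local Notation cj := (@cj R).
Local Notation conjv := (map_mx cj).

(** A local formula with real coefficients commutes with conjugation; the formula at [p] is also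
    valid at the conjugate point. *)
Lemma morphism_conj N M (X : set (pt C N)) (Y : set (pt C M)) f p :
  var_morphism RtoC X Y f -> X p -> X (conjpt p) -> f (conjpt p) = conjpt (f p).
Proof.
move=> [_ loc] Xp Xp'; have [d [F [homF F0 FE]]] := loc p Xp.
have [v pv] := coords_ex p; have Fv := F0 v pv.
have E : \row_i evalp RtoC (F i) (conjv v) = conjv (\row_i evalp RtoC (F i) v).
  by apply/rowP => i; rewrite !mxE evalp_conj.
have h := FE _ _ Xp' (coords_conj pv).
apply: (@coords_inj _ _ _ _ (conjv (\row_i evalp RtoC (F i) v))).
  by rewrite -E; apply: h; rewrite E; apply: conjv_neq0.
by apply: coords_conj; exact: FE.
Qed.

Definition cjpoly (P : {poly C}) : {poly C} := map_poly (@conjc R) P.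

Lemma horner_cjpoly P x : (cjpoly P).[x] = cj P.[cj x].
Proof.
rewrite -[x in LHS](cjK x).
exact: (horner_map (@conjc R : {rmorphism C -> C}) P (cj x)).
Qed.

Lemma coef_cjpoly P j : (cjpoly P)`_j = cj P`_j.
Proof. exact: coef_map. Qed.

Lemma size_cjpoly P : size (cjpoly P) = size P.
Proof. exact: size_map_poly. Qed.

Lemma normsq_add_eq0 (x y : C) : x * cj x + y * cj y = 0 -> x = 0 /\ y = 0.
Proof.
have E (z : C) : z * cj z = `|z| ^+ 2 by rewrite sqr_normc.
rewrite !E => /eqP; rewrite paddr_eq0 ?exprn_ge0 // !expf_eq0 /= !normr_eq0.
by move=> /andP[/eqP -> /eqP ->].
Qed.

Lemma coef_mul_top (P Q : {poly C}) D : (size P <= D.+1)%N -> (size Q <= D.+1)%N ->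
  (P * Q)`_(D + D) = P`_D * Q`_D.
Proof.
move=> sP sQ; have Dlt : (D < (D + D).+1)%N by rewrite ltnS leq_addr.
rewrite coefM (bigD1 (Ordinal Dlt)) //= addnK big1 ?addr0 // => i.
rewrite -val_eqE /= neq_ltn => /orP[iD|Di].
  by rewrite [Q`__]nth_default ?mulr0 //; apply: leq_trans sQ _; lia.
by rewrite [P`__]nth_default ?mul0r //; apply: leq_trans sP _.
Qed.

(* The intersection number of a section with its complex conjugate has the
   parity of the degree of t, so disjoint conjugate sections lie in z = 0. *)
Lemma section_parity (U V Z : {poly C}) (a c k0 : C) : a != 0 ->
  U * V = (a *: 'X + c%:P) * Z ^+ 2 ->
  U * cjpoly U + V * cjpoly V - (a *: 'X + c%:P) * (2%:P * (Z * cjpoly Z)) = k0%:P ->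
  Z = 0.
Proof.
move=> a0 E N; apply/eqP; apply: contraT => Z0.
have sT : size (a *: 'X + c%:P) = 2%N.
  by rewrite -mul_polyC size_MXaddC polyC_eq0 (negbTE a0) size_polyC a0.
have T0 : a *: 'X + c%:P != 0 by rewrite -size_poly_eq0 sT.
have UV0 : U * V != 0 by rewrite E mulf_neq0 ?expf_neq0.
have [U0 V0] : U != 0 /\ V != 0 by move: UV0; rewrite mulf_eq0 negb_or => /andP.
(* In degrees, [deg U + deg V = 2 deg Z + 1]. The sum is odd, so the larger of the two degrees
   exceeds [deg Z]. *)
have sE : (size U + size V = (size Z).*2.+1)%N.
  have := congr1 (fun P : {poly C} => size P) E.
  rewrite expr2 !size_mul ?mulf_neq0 // sT.
  have := size_poly_gt0 Z; have := size_poly_gt0 U; have := size_poly_gt0 V.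
  rewrite Z0 U0 V0; move: (size U) (size V) (size Z) => [|p] [|q] [|r] // _ _ _; lia.
have sZ : (0 < size Z)%N by rewrite size_poly_gt0.
(* [D] is the larger degree. The term with [Z] has degree at most [2 (D - 1) + 1], so the
   coefficient of degree [2 D] is a sum of two squared moduli, which must vanish although one
   leading coefficient occurs in it. *)
pose D := (maxn (size U) (size V)).-1.
have sU : (size U <= D.+1)%N by rewrite /D; lia.
have sV : (size V <= D.+1)%N by rewrite /D; lia.
have DZ : (size Z <= D)%N by rewrite /D; move: sE; move: (size U) (size V) (size Z); lia.
have D0 : (0 < D)%N by apply: leq_trans sZ DZ.
have := congr1 (fun P : {poly C} => P`_(D + D)) N.
have sU' : (size (cjpoly U) <= D.+1)%N by rewrite size_cjpoly.
have sV' : (size (cjpoly V) <= D.+1)%N by rewrite size_cjpoly.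
rewrite coefB coefD (coef_mul_top sU sU') (coef_mul_top sV sV') !coef_cjpoly coefC.
rewrite ifN; last by rewrite -lt0n addn_gt0 D0.
rewrite [X in _ - X]nth_default ?subr0; last first.
  apply: leq_trans (size_polyMleq _ _) _; rewrite sT /=.
  apply: (@leq_trans (size (Z * cjpoly Z)%R).+1).
    by rewrite ltnS mul_polyC; exact: size_scale_leq.
  rewrite size_mul -?size_poly_eq0 ?size_cjpoly ?size_poly_eq0 //.
  by move: DZ sZ; move: (size Z) (D) => z d; lia.
move=> /normsq_add_eq0[UD VD].
have [h|h] := leqP (size U) (size V).
  have : lead_coef V != 0 by rewrite lead_coef_eq0.
  by rewrite lead_coefE -[(size V).-1]/((size V).-1) (_ : (size V).-1 = D) ?VD ?eqxx // /D; lia.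
have : lead_coef U != 0 by rewrite lead_coef_eq0.
by rewrite lead_coefE (_ : (size U).-1 = D) ?UD ?eqxx // /D; lia.
Qed.

Lemma const_factor (A B : {poly C}) : size (A * B) = 2%N -> size A = 1%N \/ size B = 1%N.
Proof.
move=> s2; have AB0 : A * B != 0 by rewrite -size_poly_eq0 s2.
have [A0 B0] : A != 0 /\ B != 0 by move: AB0; rewrite mulf_eq0 negb_or => /andP.
move: s2; rewrite size_mul //.
have := size_poly_gt0 A; have := size_poly_gt0 B; rewrite A0 B0.
by move: (size A) (size B) => p q; lia.
Qed.

End ConjugateMaps.

Section Rigidity.
Variable R : realType.
Local Notation C := R[i].
Local Notation RtoC := (real_complex R : {rmorphism R -> C}).
Local Notation cj := (@cj R).
Local Notation conjv := (map_mx cj).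
Local Notation ii := (ii R).
Variables (m e : nat).
Local Notation n := ((1 + m) + (1 + e))%N.
Local Notation K := (3 * n)%N.
Local Notation slice := (@slice R m e).
Local Notation badseq := (badseq R m).
Implicit Types (u : 'rV[C]_3) (s : 'rV[C]_(1 + m)) (t w : C) (b : 'rV[C]_e).

(** The last equation is the vanishing of the polar form. A tangent of a smooth conic meets it only
    at the point of contact: in the coordinates [w], [w'] the form is [t V V' (w - w')^2]. *)
Lemma conic_tangent t u u' : t != 0 -> u != 0 -> u' != 0 ->
  cU u * cV u = t * cZ u ^+ 2 -> cU u' * cV u' = t * cZ u' ^+ 2 ->
  cU u * cV u' + cV u * cU u' = 2 * t * (cZ u * cZ u') -> exists2 a, a != 0 & u' = a *: u.
Proof.
move=> t0 u0 u0' E E' B.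
have zero v : cU v * cV v = t * cZ v ^+ 2 -> cU v * cV v = 0 -> cZ v = 0.
  move=> -> /eqP; rewrite mulf_eq0 (negbTE t0) /= expf_eq0 /=.
  by move/eqP.
have [V0|V0] := eqVneq (cV u) 0.
  have Z0 : cZ u = 0 by apply: zero => //; rewrite V0 mulr0.
  have U0 : cU u != 0 by move: u0; rewrite u_eq0 V0 Z0 !eqxx !andbT.
  have V0' : cV u' = 0.
    by move/eqP: B; rewrite V0 Z0 !(mul0r, mulr0, addr0) mulf_eq0 (negbTE U0) => /eqP.
  have Z0' : cZ u' = 0 by apply: zero => //; rewrite V0' mulr0.
  have U0' : cU u' != 0 by move: u0'; rewrite u_eq0 V0' Z0' !eqxx !andbT.
  exists (cU u' / cU u); first by rewrite mulf_neq0 ?invr_eq0.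
  by apply: uvz_inj; rewrite ?cUZ ?cVZ ?cZZ ?divfK ?V0 ?V0' ?Z0 ?Z0' ?mulr0.
have V0' : cV u' != 0.
  apply: contraNneq u0' => V0'.
  have Z0' : cZ u' = 0 by apply: zero => //; rewrite V0' mulr0.
  move/eqP: B; rewrite V0' Z0' !(mulr0, add0r) mulf_eq0 (negbTE V0) /= => U0'.
  by rewrite u_eq0 U0' V0' Z0' !eqxx.
have h := cu_eta (o := true) E V0; have h' := cu_eta (o := true) E' V0'.
move: h h'; rewrite /cB; set w := cZ u / cV u; set w' := cZ u' / cV u' => h h'.
have ww : w = w'.
  apply/eqP; rewrite -subr_eq0 -sqrf_eq0.
  have : t * cV u * cV u' * (w - w') ^+ 2 = 0.
    have e1 : cU u = cV u * (t * w ^+ 2) by rewrite [in LHS]h cUZ uvzE.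
    have e2 : cU u' = cV u' * (t * w' ^+ 2) by rewrite [in LHS]h' cUZ uvzE.
    have e3 : cZ u = cV u * w by rewrite [in LHS]h cZZ uvzE.
    have e4 : cZ u' = cV u' * w' by rewrite [in LHS]h' cZZ uvzE.
    move: B; rewrite e1 e2 e3 e4 => /eqP; rewrite -subr_eq0 => /eqP <-.
    by move: (cV u) (cV u') => *; ring.
  by move=> /eqP; rewrite !mulf_eq0 (negbTE t0) (negbTE V0) (negbTE V0').
exists (cV u' / cV u); first by rewrite mulf_neq0 ?invr_eq0.
have uE : cu true t w = (cV u)^-1 *: u by rewrite [X in _ *: X]h scalerA mulVf ?scale1r.
by rewrite [LHS]h' -ww uE scalerA.
Qed.

Lemma good_conj s u t b : real_row s -> good s u t b ->
  good s (conjv u) (cj t) (conjv b).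
Proof.
move=> rs [s0 u0 E hb hr].
have sE : conjv s = s by apply/rowP => j; rewrite mxE rs.
split=> //.
- exact: conjv_neq0.
- by rewrite cU_conj cV_conj cZ_conj -cjM mulrC E cjM cjX.
- move=> l; rewrite mxE -(cjX (b 0 l) 2) -[1](@cj1 R) -cjD cj_eq0; exact: hb.
- move=> /removed_conj; rewrite cjK.
  have -> : conjv (conjv u) = u by apply/rowP => i; rewrite !mxE cjK.
  by rewrite sE.
Qed.

Lemma coords_pvec_conj s u t b (p : pt C K) : real_row s -> coords p (pvec s u t b) ->
  coords (conjpt p) (pvec s (conjv u) (cj t) (conjv b)).
Proof.
move=> rs /coords_conj; rewrite pvec_conj.
by have -> : conjv s = s by apply/rowP => j; rewrite mxE rs.
Qed.

Lemma zero_row_branch (l : 'I_e) : (0 : 'rV[C]_e) 0 l ^+ 2 + 1 != 0.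
Proof. by rewrite mxE expr0n add0r oner_eq0. Qed.

Section Isomorphism.
Variables (s s' : 'rV[C]_(1 + m)) (f g : pt C K -> pt C K).
Hypotheses (s0 : s 0 0 = 1) (s0' : s' 0 0 = 1) (rs : real_row s) (rs' : real_row s').
Hypothesis hf : var_morphism RtoC (slice s) (slice s') f.
Hypothesis hg : var_morphism RtoC (slice s') (slice s) g.
Hypothesis gf : forall p, slice s p -> g (f p) = p.

(** [fibration] is applied to [f] on [b = 0] and to [g] on the image value [beta]. The two maps of
    [t] compose to the identity, so the first is affine; commutation with conjugation makes it
    real. *)
Lemma iso_base : exists (a c : C) (beta : 'rV[C]_e),
  [/\ a != 0, cj a = a /\ cj c = c, conjv beta = beta,
  forall u t p, good s u t (0 : 'rV[C]_e) -> coords p (pvec s u t (0 : 'rV[C]_e)) ->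
    exists u', good s' u' (a * t + c) beta /\ coords (f p) (pvec s' u' (a * t + c) beta) &
  forall u t q, good s' u (a * t + c) beta -> coords q (pvec s' u (a * t + c) beta) ->
    exists u', good s u' t (0 : 'rV[C]_e) /\ coords (g q) (pvec s u' t (0 : 'rV[C]_e))].
Proof.
have [tau [beta [htau hF]]] := fibration s0 s0' rs hf zero_row_branch.
have gC o t := good_cu0 o t s0 rs zero_row_branch.
have pC o t : exists p, coords p (pvec s (cu o t 0) t (0 : 'rV_e)).
  by have [p] := pt_ex (pvec_neq0 t (0 : 'rV[C]_e) s0 (cu_neq0 o t 0)); exists p.
have hbeta l : beta 0 l ^+ 2 + 1 != 0.
  have [p pv] := pC true 0; have [u' [[_ _ _ h _] _]] := hF _ _ _ (gC true 0) pv.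
  exact: h.
have [taug [betag [htaug hG]]] := fibration s0' s0 rs' hg hbeta.
have inv t : taug (tau t) = t /\ betag = 0.
  have [p pv] := pC true t; have [u' [gd fv]] := hF _ _ _ (gC true t) pv.
  have [u2 [_ gv]] := hG _ _ _ gd fv.
  rewrite gf in gv; last by exists (cu true t 0), t, 0.
  by have [-> -> _] := pvec_prop s0 (cu_neq0 true t 0) pv gv.
have [a [c [a0 tauE]]] := polyf_inverse htau htaug (fun t => (inv t).1).
have real t : tau (cj t) = cj (tau t) /\ conjv beta = beta.
  have [p pv] := pC true t; have [u' [gd fv]] := hF _ _ _ (gC true t) pv.
  have pv' := coords_pvec_conj rs pv.
  have z0 : conjv (0 : 'rV[C]_e) = 0 by apply/rowP => l; rewrite !mxE cj0.
  have gd' := good_conj rs (gC true t); rewrite z0 in pv' gd'.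
  have [u2 [gd2 fv2]] := hF _ _ _ gd' pv'.
  rewrite (morphism_conj hf) in fv2; last 2 first.
  - by exists (cu true t 0), t, 0.
  - by exists (conjv (cu true t 0)), (cj t), 0.
  have [_ u20 _ _ _] := gd2.
  by have [-> -> _] := pvec_prop s0' u20 fv2 (coords_pvec_conj rs' fv).
have cc : cj c = c.
  by have [h _] := real 0; move: h; rewrite cj0 tauE mulr0 add0r => <-.
have ca : cj a = a.
  have [h _] := real 1; move: h; rewrite cj1 tauE mulr1 cjD cc => h.
  by apply: (addIr c).
exists a, c, beta; split=> //.
- by have [_ ->] := real 0.
- by move=> u t p gd pv; rewrite -tauE; exact: hF pv.
- move=> u t q gd qv; rewrite -tauE in gd qv; have := hG _ _ _ gd qv.
  by have [-> ->] := inv t.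
Qed.

End Isomorphism.
End Rigidity.

Lemma poly_ext (C : numClosedFieldType) (P Q : {poly C}) :
  (forall x, P.[x] = Q.[x]) -> P = Q.
Proof.
move=> h; apply/eqP; rewrite -subr_eq0; apply/eqP; apply: horner_inj0 => x.
by rewrite hornerD hornerN h subrr.
Qed.

(** * Images of the sections and of the lines in a conic *)

Section Lines.
Variable R : realType.
Local Notation C := R[i].
Local Notation RtoC := (real_complex R : {rmorphism R -> C}).
Local Notation cj := (@cj R).
Local Notation conjv := (map_mx cj).
Local Notation ii := (ii R).
Variables (m e : nat).
Local Notation n := ((1 + m) + (1 + e))%N.
Local Notation K := (3 * n)%N.
Local Notation slice := (@slice R m e).
Local Notation badseq := (badseq R m).
Implicit Types (u : 'rV[C]_3) (s : 'rV[C]_(1 + m)) (t w : C) (b : 'rV[C]_e).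

Lemma coords_unscale s u t b k (p : pt C K) : k != 0 ->
  coords p (pvec s (k *: u) t b) -> coords p (pvec s u t b).
Proof.
move=> k0; rewrite pvecZ => /(coordsZ (a := k^-1)); rewrite invr_eq0 scalerA mulVf //.
by rewrite scale1r; apply.
Qed.

Lemma cB_flip o t : cB (~~ o) (cu o t 0) = 0.
Proof. by case: o; rewrite /= uvzE expr0n mulr0. Qed.

Lemma cu_section o t u : cU u * cV u = t * cZ u ^+ 2 -> u != 0 -> cZ u = 0 -> cB (~~ o) u = 0 ->
  exists2 k, k != 0 & u = k *: cu o t 0.
Proof.
move=> E u0 Z0 B0.
have B1 : cB o u != 0.
  by apply: contraNneq u0 => B1; rewrite u_eq0 Z0; move: B0 B1; case: o => /= -> ->; rewrite !eqxx.
by exists (cB o u) => //; rewrite [LHS](cu_eta E B1) Z0 mul0r.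
Qed.

Lemma cu_coords_inj s o t w w' b (p : pt C K) : s 0 0 = 1 ->
  coords p (pvec s (cu o t w) t b) -> coords p (pvec s (cu o t w') t b) -> w' = w.
Proof.
move=> s0 pv pv'; have [_ _ [k k0 E]] := pvec_prop s0 (cu_neq0 o t w) pv pv'.
have k1 : k = 1.
  have := congr1 (cB o) E; rewrite cB_cu; move=> /esym; move: (cB_cu o t w).
  by case: o {pv pv' E} => /= h; rewrite ?cUZ ?cVZ h mulr1.
by have := congr1 (@cZ R) E; rewrite cZZ !cZ_cu k1 mul1r.
Qed.

Lemma cu_coords_flip s o t w b (p : pt C K) : s 0 0 = 1 ->
  coords p (pvec s (cu o t w) t b) -> coords p (pvec s (cu (~~ o) t 0) t b) -> False.
Proof.
move=> s0 pv pv'; have [_ _ [k k0 E]] := pvec_prop s0 (cu_neq0 o t w) pv pv'.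
have := congr1 (cB o) E; rewrite -{1}[o]negbK cB_flip => /esym/eqP.
move: (cB_cu o t w).
by case: o {pv pv' E} => /= h; rewrite ?cUZ ?cVZ h mulr1 (negbTE k0).
Qed.

(** [cu (~~ o) t 0] is the point at infinity of line [o]. Since [f] is injective and matches the
    points at infinity, the image of the line avoids that point, and [z] is polynomial in the affine
    coordinate. *)
Lemma line_image s s' f o1 o2 t b t' b' : s 0 0 = 1 -> s' 0 0 = 1 ->
  var_morphism RtoC (slice s) (slice s') f ->
  (forall p q, slice s p -> slice s q -> f p = f q -> p = q) -> t' != 0 ->
  (forall w, good s (cu o1 t w) t b) -> good s (cu (~~ o1) t 0) t b ->
  (forall w p, coords p (pvec s (cu o1 t w) t b) -> exists u',
     good s' u' t' b' /\ coords (f p) (pvec s' u' t' b')) ->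
  (forall p, coords p (pvec s (cu o1 t 0) t b) ->
     coords (f p) (pvec s' (cu o2 t' 0) t' b')) ->
  (forall p, coords p (pvec s (cu (~~ o1) t 0) t b) ->
     coords (f p) (pvec s' (cu (~~ o2) t' 0) t' b')) ->
  exists z : C -> C, [/\ polyf z, z 0 = 0 & forall w p,
    coords p (pvec s (cu o1 t w) t b) -> coords (f p) (pvec s' (cu o2 t' (z w)) t' b')].
Proof.
move=> s0 s0' hf inj t0 gd gd' hF h1 h2; have pX := @polyfX C; have pc := @polyfC C.
have [u1 [t1 [b1 [hu1 _ _ g1 c1]]]] := slice_lift s0 s0' hf (polyf_cu o1 (pc t) pX) (pc t)
  (fun l => pc (b 0 l)) gd.
have ptx o w : exists p : pt C K, coords p (pvec s (cu o t w) t b).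
  by have [p] := pt_ex (pvec_neq0 t b s0 (cu_neq0 o t w)); exists p.
have tb w : t1 w = t' /\ b1 w = b'.
  have [p pv] := ptx o1 w; have [u' [[_ u0' _ _ _] fv]] := hF _ _ pv.
  by have [-> ->] := pvec_prop s0' u0' fv (c1 _ _ pv).
have E1 w : cU (u1 w) * cV (u1 w) = t' * cZ (u1 w) ^+ 2.
  by have [_ _ + _ _] := g1 w; have [-> _] := tb w.
have fc w p : coords p (pvec s (cu o1 t w) t b) -> coords (f p) (pvec s' (u1 w) t' b').
  by move=> /c1; have [-> ->] := tb w.
(* A zero of this entry would place the image at the point at infinity, which is already the image
   of another point. *)
have B0 w : cB o2 (u1 w) != 0.
  apply/eqP => B0; have [_ u0 _ _ _] := g1 w.
  have Z0 : cZ (u1 w) = 0.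
    have : t' * cZ (u1 w) ^+ 2 = 0.
      by rewrite -E1; move: B0; case: (o2) => /= ->; rewrite ?mul0r ?mulr0.
    by move=> /eqP; rewrite mulf_eq0 (negbTE t0) expf_eq0 /= => /eqP.
  have B0' : cB (~~ ~~ o2) (u1 w) = 0 by rewrite negbK.
  have [k k0 uE] := cu_section (E1 w) u0 Z0 B0'.
  have [p pv] := ptx o1 w; have [q qv] := ptx (~~ o1) 0.
  have fpq : f p = f q.
    by apply: coords_inj (h2 q qv); apply: (coords_unscale k0); rewrite -uE; exact: fc.
  have pq : p = q.
    by apply: inj fpq; [exact: slice_of_good (gd w) pv|exact: slice_of_good gd' qv].
  by rewrite -pq in qv; exact: cu_coords_flip s0 pv qv.
have hB : polyf (fun w => cB o2 (u1 w)).
  by case: (o2); [exact: polyf_cV|exact: polyf_cU].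
have Bc w : cB o2 (u1 w) = cB o2 (u1 0) := polyf_nz_const hB B0 w.
have zE w p : coords p (pvec s (cu o1 t w) t b) ->
    coords (f p) (pvec s' (cu o2 t' (cZ (u1 w) / cB o2 (u1 0))) t' b').
  move=> pv; apply: (coords_unscale (B0 0)); rewrite -(Bc w) -(cu_eta (E1 w) (B0 w)).
  exact: fc.
exists (fun w => cZ (u1 w) / cB o2 (u1 0)); split=> //.
  by apply: polyfM => //; exact: polyf_cZ.
have [p pv] := ptx o1 0.
exact: cu_coords_inj s0' (h1 p pv) (zE _ _ pv).
Qed.

Section Isomorphism.
Variables (s s' : 'rV[C]_(1 + m)) (f g : pt C K -> pt C K).
Hypotheses (s0 : s 0 0 = 1) (s0' : s' 0 0 = 1) (rs : real_row s) (rs' : real_row s').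
Hypothesis hf : var_morphism RtoC (slice s) (slice s') f.
Hypothesis gf : forall p, slice s p -> g (f p) = p.
Variables (a c : C) (beta : 'rV[C]_e).
Hypotheses (a0 : a != 0) (ca : cj a = a) (cc : cj c = c) (hbeta : conjv beta = beta).
Local Notation T t := (a * t + c).
Local Notation z0 := (0 : 'rV[C]_e).
Hypothesis hF : forall u t p, good s u t z0 -> coords p (pvec s u t z0) ->
  exists u', good s' u' (T t) beta /\ coords (f p) (pvec s' u' (T t) beta).

Lemma iso_inj p q : slice s p -> slice s q -> f p = f q -> p = q.
Proof. by move=> Xp Xq pq; rewrite -(gf Xp) -(gf Xq) pq. Qed.

Lemma cu_point o t w : exists p : pt C K, coords p (pvec s (cu o t w) t z0).
Proof. by have [p] := pt_ex (pvec_neq0 t z0 s0 (cu_neq0 o t w)); exists p. Qed.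

Lemma good_section o t : good s (cu o t 0) t z0.
Proof. exact: (good_cu0 o t s0 rs (@zero_row_branch R e)). Qed.

Lemma cjT t : cj (T t) = T (cj t).
Proof. by rewrite cjD cjM ca cc. Qed.

(** The polar form [N] of the image section and its conjugate never vanishes, so it is constant.
    [section_parity] then gives [Z = 0], and [U V = 0] leaves one of the two standard sections. *)
Lemma section_image : exists o, forall o1 t p, coords p (pvec s (cu o1 t 0) t z0) ->
  coords (f p) (pvec s' (cu (o1 == o) (T t) 0) (T t) beta).
Proof.
have pX := @polyfX C; have pc := @polyfC C.
have [u1 [t1 [b1 [hu1 _ _ g1 c1]]]] := slice_lift s0 s0' hf (polyf_cu true pX (pc 0)) pX
  (fun l => pc (z0 0 l)) (fun t => good_section true t).
have tb t : t1 t = T t /\ b1 t = beta.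
  have [p pv] := cu_point true t 0; have [u' [[_ u0' _ _ _] fv]] := hF (good_section true t) pv.
  by have [-> ->] := pvec_prop s0' u0' fv (c1 _ _ pv).
have E1 t : cU (u1 t) * cV (u1 t) = T t * cZ (u1 t) ^+ 2.
  by have [_ _ + _ _] := g1 t; have [-> _] := tb t.
have n1 t : u1 t != 0 by have [] := g1 t.
have fT t p : coords p (pvec s (cu true t 0) t z0) -> coords (f p) (pvec s' (u1 t) (T t) beta).
  by move=> /c1; have [-> ->] := tb t.
have z0c : conjv z0 = z0 by apply/rowP => l; rewrite !mxE cj0.
(* The second section is the conjugate of the first, so its image is the conjugate image. *)
have fFl t p : coords p (pvec s (cu false t 0) t z0) ->
    coords (f p) (pvec s' (conjv (u1 (cj t))) (T t) beta).
  move=> pv; have [q qv] := cu_point true (cj t) 0.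
  have qv' := coords_pvec_conj rs qv; rewrite cu_conj cjK cj0 z0c /= in qv'.
  rewrite (coords_inj pv qv') (morphism_conj hf).
  - by have := coords_pvec_conj rs' (fT _ _ qv); rewrite cjT cjK hbeta.
  - exact: slice_of_good (good_section true _) qv.
  - exact: slice_of_good (good_section false _) qv'.
have [U hU] := polyf_cU hu1; have [V hV] := polyf_cV hu1; have [Z hZ] := polyf_cZ hu1.
have hT t : (a *: 'X + c%:P).[t] = T t by rewrite hornerD hornerZ hornerX hornerC.
have UVZ : U * V = (a *: 'X + c%:P) * Z ^+ 2.
  by apply: poly_ext => t; rewrite [LHS]hornerM [RHS]hornerM hT horner_exp -hU -hV -hZ E1.
have cjU t : (cjpoly U).[t] = cV (conjv (u1 (cj t))) by rewrite horner_cjpoly -hU cV_conj.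
have cjV t : (cjpoly V).[t] = cU (conjv (u1 (cj t))) by rewrite horner_cjpoly -hV cU_conj.
have cjZ t : (cjpoly Z).[t] = cZ (conjv (u1 (cj t))) by rewrite horner_cjpoly -hZ cZ_conj.
pose N := U * cjpoly U + V * cjpoly V - (a *: 'X + c%:P) * (2%:P * (Z * cjpoly Z)).
have NE t : N.[t] = cU (u1 t) * cV (conjv (u1 (cj t))) + cV (u1 t) * cU (conjv (u1 (cj t)))
    - T t * (2 * (cZ (u1 t) * cZ (conjv (u1 (cj t))))).
  rewrite /N hornerD hornerN hornerD !hornerM hT hornerC cjU cjV cjZ.
  by rewrite -hU -hV -hZ.
have N0 t : N.[t] != 0.
  rewrite NE; apply/eqP => /subr0_eq N0; have [Tt|Tt] := eqVneq (T t) 0; last first.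
    have E2 : cU (conjv (u1 (cj t))) * cV (conjv (u1 (cj t))) =
        T t * cZ (conjv (u1 (cj t))) ^+ 2.
      by rewrite cU_conj cV_conj cZ_conj -cjM mulrC E1 cjM cjX cjT cjK.
    have B : cU (u1 t) * cV (conjv (u1 (cj t))) + cV (u1 t) * cU (conjv (u1 (cj t))) =
        2 * T t * (cZ (u1 t) * cZ (conjv (u1 (cj t)))).
      by rewrite N0 mulrA [_ * 2]mulrC.
    have [k k0 kE] := conic_tangent Tt (n1 t) (conjv_neq0 (n1 (cj t))) (E1 t) E2 B.
    have [p pv] := cu_point true t 0; have [q qv] := cu_point false t 0.
    have pq : p = q.
      apply: iso_inj; first exact: slice_of_good (good_section true _) pv.
        exact: slice_of_good (good_section false _) qv.
      apply: coords_inj (fT _ _ pv) _; apply: (coords_unscale k0); rewrite -kE; exact: fFl.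
    by rewrite -pq in qv; exact: (cu_coords_flip (o := true) s0 pv qv).
  have rt : cj t = t.
    have : T (cj t) = T t by rewrite -cjT Tt cj0.
    by move/addIr/(mulfI a0).
  (* On the singular conic [t] is real and [N] is [|U|^2 + |V|^2]. Its vanishing makes [U V]
     divisible by the square of [x - t], while [T] has a simple root there and [Z] is nonzero. *)
  move: N0; rewrite rt Tt mul0r cV_conj cU_conj => /normsq_add_eq0[Ut Vt].
  have Zt : cZ (u1 t) != 0 by apply: contraNneq (n1 t) => Zt; rewrite u_eq0 Ut Vt Zt !eqxx.
  have [U1 U1E] : exists Q, U = Q * ('X - t%:P) by apply/factor_theorem; rewrite /root -hU Ut.
  have [V1 V1E] : exists Q, V = Q * ('X - t%:P) by apply/factor_theorem; rewrite /root -hV Vt.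
  have h x : (x - t) * (U1.[x] * V1.[x]) = a * cZ (u1 x) ^+ 2.
    apply: (polyf_eq (f := fun x => (x - t) * (U1.[x] * V1.[x]))
      (g := fun x => a * cZ (u1 x) ^+ 2)).
    - apply: polyfM; first by apply: polyfB.
      by apply: polyfM; exact: polyf_horner.
    - by apply: polyfM => //; apply: polyf_exp; exists Z.
    apply: cofinitelyW (cofinitely_neq t) => y yt.
    have yt0 : y - t != 0 by rewrite subr_eq0.
    apply: (mulfI yt0).
    have Ty : T y = a * (y - t).
      by rewrite -[LHS]subr0 -Tt; ring.
    rewrite [in RHS]mulrA [_ * a]mulrC -Ty -E1 hU hV U1E V1E !hornerM hornerXsubC.
    by move: (U1.[y]) (V1.[y]) => *; ring.
  have := h t; rewrite subrr mul0r => /esym/eqP.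
  by rewrite mulf_eq0 (negbTE a0) expf_eq0 (negbTE Zt).
have Nc : N = (N.[0])%:P.
  by apply: poly_ext => t; rewrite hornerC; exact: (polyf_nz_const (polyf_horner N) N0 t).
have Z0 := section_parity a0 UVZ Nc.
have [o ho] : exists o, forall t, cB (~~ o) (u1 t) = 0.
  have /eqP : U * V = 0 by rewrite UVZ Z0 expr0n mulr0.
  rewrite mulf_eq0 => /orP[/eqP U0|/eqP V0].
    by exists true => t; rewrite /= hU U0 horner0.
  by exists false => t; rewrite /= hV V0 horner0.
have uE t : exists2 k, k != 0 & u1 t = k *: cu o (T t) 0.
  by apply: cu_section => //; rewrite hZ Z0 horner0.
exists o => -[] t p pv.
  have [k k0 kE] := uE t; have := fT _ _ pv; rewrite kE => /(coords_unscale k0).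
  by case: (o).
have [k k0 kE] := uE (cj t); have := fFl _ _ pv; rewrite kE.
have -> : conjv (k *: cu o (T (cj t)) 0) = cj k *: cu (~~ o) (T t) 0.
  by rewrite -[T t]cjK cjT -{2}[0]cj0 -cu_conj; apply/rowP => i; rewrite !mxE cjM.
have ck0 : cj k != 0 by rewrite cj_eq0.
by move=> /(coords_unscale ck0); case: (o).
Qed.

End Isomorphism.
End Lines.

(** * The action on the fibres is a constant scaling *)

Section Scaling.
Variable R : realType.
Local Notation C := R[i].
Local Notation RtoC := (real_complex R : {rmorphism R -> C}).
Local Notation cj := (@cj R).
Local Notation conjv := (map_mx cj).
Local Notation ii := (ii R).
Variables (m e : nat).
Local Notation n := ((1 + m) + (1 + e))%N.
Local Notation K := (3 * n)%N.
Local Notation slice := (@slice R m e).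
Local Notation badseq := (badseq R m).
Implicit Types (u : 'rV[C]_3) (t w : C) (b : 'rV[C]_e).
Variables (s s' : 'rV[C]_(1 + m)) (f g : pt C K -> pt C K).
Hypotheses (s0 : s 0 0 = 1) (s0' : s' 0 0 = 1) (rs : real_row s) (rs' : real_row s').
Hypothesis hf : var_morphism RtoC (slice s) (slice s') f.
Hypothesis hg : var_morphism RtoC (slice s') (slice s) g.
Hypothesis gf : forall p, slice s p -> g (f p) = p.
Hypothesis fg : forall q, slice s' q -> f (g q) = q.
Variables (a c : C) (beta : 'rV[C]_e).
Hypotheses (a0 : a != 0) (ca : cj a = a) (cc : cj c = c) (hbeta : conjv beta = beta).
Local Notation T t := (a * t + c).
Local Notation z0 := (0 : 'rV[C]_e).
Hypothesis hF : forall u t p, good s u t z0 -> coords p (pvec s u t z0) ->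
  exists u', good s' u' (T t) beta /\ coords (f p) (pvec s' u' (T t) beta).
Hypothesis hG : forall u t q, good s' u (T t) beta -> coords q (pvec s' u (T t) beta) ->
  exists u', good s u' t z0 /\ coords (g q) (pvec s u' t z0).
Variable o : bool.
Hypothesis hS : forall o1 t p, coords p (pvec s (cu o1 t 0) t z0) ->
  coords (f p) (pvec s' (cu (o1 == o) (T t) 0) (T t) beta).

Lemma slice_point_f p : slice s p -> slice s' (f p).
Proof. by case: hf => h _; exact: h. Qed.

Lemma beta_branch l : beta 0 l ^+ 2 + 1 != 0.
Proof.
have [p pv] := cu_point e s0 true 0 0.
by have [u' [[_ _ _ h _] _]] := hF (good_section e s0 rs true 0) pv; exact: h.
Qed.

(** Over such [t] the conics of source and target are smooth and have lost no point. *)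
Definition generic t := [/\ t \notin badseq, T t \notin badseq, t != 0 & T t != 0].

Lemma polyfT : polyf (fun t => T t).
Proof.
apply: polyfD (polyfC _); apply: polyfM; [exact: polyfC|exact: polyfX].
Qed.

Lemma cofinitely_generic : cofinitely generic.
Proof.
have T01 : T 0 != T 1.
  by rewrite mulr0 mulr1 add0r -subr_eq0 opprD addrA addrAC subrr add0r oppr_eq0.
have h1 := cofinitely_and (cofinitely_notin badseq) (cofinitely_neq (0 : C)).
have h2 := cofinitely_and (polyf_notin badseq polyfT T01) (polyf_neq 0 polyfT T01).
by apply: cofinitelyW (cofinitely_and h1 h2) => t [[? ?] [? ?]].
Qed.

Lemma good_line t o1 w : t \notin badseq -> good s (cu o1 t w) t z0.
Proof.
move=> tb; apply: good_generic => //.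
- exact: zero_row_branch.
- exact: cu_neq0.
- exact: cu_conic.
Qed.

Lemma good_line' t o1 w : T t \notin badseq -> good s' (cu o1 (T t) w) (T t) beta.
Proof.
move=> tb; apply: good_generic => //.
- exact: beta_branch.
- exact: cu_neq0.
- exact: cu_conic.
Qed.

Lemma hS_inv o1 t q : coords q (pvec s' (cu (o1 == o) (T t) 0) (T t) beta) ->
  coords (g q) (pvec s (cu o1 t 0) t z0).
Proof.
move=> qv; have [p pv] := cu_point e s0 o1 t 0.
rewrite (coords_inj qv (hS pv)) gf //.
exact: slice_of_good (good_section e s0 rs o1 t) pv.
Qed.

(** [f] and [g] are polynomial and mutually inverse on the line, hence affine; they fix [w = 0]. The
    scalar still depends on [t]. *)
Lemma line_scaling t : generic t -> exists2 k, k != 0 & forall w p,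
  coords p (pvec s (cu true t w) t z0) ->
  coords (f p) (pvec s' (cu o (T t) (k * w)) (T t) beta).
Proof.
move=> [tb Tb t0 Tt0].
have F1 w p : coords p (pvec s (cu true t w) t z0) ->
    exists u', good s' u' (T t) beta /\ coords (f p) (pvec s' u' (T t) beta).
  exact: hF (good_line true w tb).
have F2 p : coords p (pvec s (cu true t 0) t z0) ->
    coords (f p) (pvec s' (cu o (T t) 0) (T t) beta).
  by move=> /hS; rewrite eq_sym eqb_id.
have F3 p : coords p (pvec s (cu (~~ true) t 0) t z0) ->
    coords (f p) (pvec s' (cu (~~ o) (T t) 0) (T t) beta).
  by move=> /hS; rewrite eq_sym eqbF_neg.
have [z [hz z00 zE]] := line_image s0 s0' hf (iso_inj gf) Tt0
  (fun w => good_line true w tb) (good_line false 0 tb) F1 F2 F3.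
have G1 w q : coords q (pvec s' (cu o (T t) w) (T t) beta) ->
    exists u', good s u' t z0 /\ coords (g q) (pvec s u' t z0).
  exact: hG (good_line' o w Tb).
have G2 q : coords q (pvec s' (cu o (T t) 0) (T t) beta) ->
    coords (g q) (pvec s (cu true t 0) t z0).
  by move=> qv; apply: hS_inv; rewrite eq_sym eqb_id.
have G3 q : coords q (pvec s' (cu (~~ o) (T t) 0) (T t) beta) ->
    coords (g q) (pvec s (cu (~~ true) t 0) t z0).
  by move=> qv; apply: hS_inv; rewrite eq_sym eqbF_neg.
have [y [hy y00 yE]] := line_image s0' s0 hg (iso_inj fg) t0
  (fun w => good_line' o w Tb) (good_line' (~~ o) 0 Tb) G1 G2 G3.
have yz w : y (z w) = w.
  have [p pv] := cu_point e s0 true t w.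
  have := yE _ _ (zE _ _ pv); rewrite gf; last exact: slice_of_good (good_line true w tb) pv.
  by move=> pv'; exact: cu_coords_inj s0 pv pv'.
have [k [k' [k0 zk]]] := polyf_inverse hz hy yz.
have k'0 : k' = 0 by have := zk 0; rewrite z00 mulr0 add0r.
exists k; first exact: k0.
move=> w p pv; have := zE w p pv; rewrite zk k'0 addr0; exact.
Qed.

Lemma removed_cu_true t w : removed s (cu true t w) t ->
  exists j, w = s 0 j + ii \/ 1 + tj R j * (s 0 j - ii) * w = 0.
Proof.
case=> j [[_ + _]|[-> _ +]]; rewrite /= !uvzE => h; exists j; [left|right].
  by rewrite h mulr1.
by rewrite h; ring.
Qed.

(** Each of the finitely many removed points excludes at most one value of [w]. *)
Lemma horizontal_ex : exists2 w, w != 0 & forall t, good s (cu true t w) t z0.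
Proof.
have c1 : cofinitely (fun w => forall j, w != s 0 j + ii).
  by apply: cofinitely_forall => j; exact: cofinitely_neq.
have c2 : cofinitely (fun w => forall j, 1 + tj R j * (s 0 j - ii) * w != 0).
  apply: cofinitely_forall => j.
  apply: (cofinitely_neq0 (f := fun w => 1 + tj R j * (s 0 j - ii) * w) (x := 0)).
    by apply: polyfD (polyfC _) _; apply: polyfM; [exact: polyfC|exact: polyfX].
  by rewrite mulr0 addr0 oner_eq0.
have [w [[h1 h2] w0]] := cofinitely_ex (cofinitely_and (cofinitely_and c1 c2)
  (cofinitely_neq (0 : C))).
exists w => // t; split=> //.
- exact: cu_neq0.
- exact: cu_conic.
- exact: zero_row_branch.
- move=> /removed_cu_true[j [h|h]]; first by have := h1 j; rewrite h eqxx.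
  by have := h2 j; rewrite h eqxx.
Qed.

(** For real [t], conjugation takes [w = 1] to the same coordinate on the other line, that is to
    [w = 1 / t]. Comparing images gives [k / t = 1 / (T t * cj k)]. *)
Lemma scaling_conj t k : generic t -> cj t = t -> k != 0 ->
  (forall w p, coords p (pvec s (cu true t w) t z0) ->
    coords (f p) (pvec s' (cu o (T t) (k * w)) (T t) beta)) ->
  k * cj k * T t = t.
Proof.
move=> [tb Tb t0 Tt0] rt k0 hk.
have z0c : conjv z0 = z0 by apply/rowP => l; rewrite !mxE cj0.
have rT : cj (T t) = T t by rewrite cjD cjM ca cc rt.
have [p pv] := cu_point e s0 true t 1.
have Xp := slice_of_good (good_line true 1 tb) pv.
have := coords_pvec_conj rs pv; rewrite cu_conj rt cj1 z0c => pv1.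
have t1 : t * 1 ^+ 2 != 0 by rewrite expr1n mulr1.
have pv2 : coords (conjpt p) (pvec s (cu true t (t * 1)^-1) t z0).
  by apply: (coords_unscale t1); rewrite -cu_flip ?oner_neq0.
have Xp' := slice_of_good (good_line true _ tb) pv2.
have := hk _ _ pv2; rewrite (morphism_conj hf Xp Xp') => fv1.
have := coords_pvec_conj rs' (hk _ _ pv); rewrite cu_conj rT hbeta mulr1 => fv2.
have ck0 : cj k != 0 by rewrite cj_eq0.
have Tk : T t * cj k ^+ 2 != 0 by rewrite mulf_neq0 ?expf_neq0.
have fv3 : coords (conjpt (f p)) (pvec s' (cu o (T t) (T t * cj k)^-1) (T t) beta).
  by apply: (coords_unscale Tk); rewrite -cu_flip.
have := cu_coords_inj s0' fv1 fv3; rewrite mulr1 => E.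
have TK : T t * cj k != 0 by rewrite mulf_neq0.
have -> : k * cj k * T t = (k / t) * (T t * cj k) * t by field.
by rewrite -E mulVf // mul1r.
Qed.

(** The image of a curve [w = const] compares the scalars over different [t]: with [z] its constant
    entry, [k w cB o (u1 t) = z], so [k] is constant once [cB o] is. *)
Lemma iso_scaling : exists k, [/\ k != 0, c = 0, a * (k * cj k) = 1 &
  forall t, generic t -> forall w p, coords p (pvec s (cu true t w) t z0) ->
    coords (f p) (pvec s' (cu o (T t) (k * w)) (T t) beta)].
Proof.
have pX := @polyfX C; have pc := @polyfC C.
have [w w0 gw] := horizontal_ex.
have [u1 [t1 [b1 [hu1 _ _ g1 c1]]]] := slice_lift s0 s0' hf (polyf_cu true pX (pc w)) pX
  (fun l => pc (z0 0 l)) gw.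
have tb t : t1 t = T t /\ b1 t = beta.
  have [p pv] := cu_point e s0 true t w; have [u' [[_ u0' _ _ _] fv]] := hF (gw t) pv.
  by have [-> ->] := pvec_prop s0' u0' fv (c1 _ _ pv).
have E1 t : cU (u1 t) * cV (u1 t) = T t * cZ (u1 t) ^+ 2.
  by have [_ _ + _ _] := g1 t; have [-> _] := tb t.
have n1 t : u1 t != 0 by have [] := g1 t.
have fT t p : coords p (pvec s (cu true t w) t z0) -> coords (f p) (pvec s' (u1 t) (T t) beta).
  by move=> /c1; have [-> ->] := tb t.
(* A zero would put the image on one of the standard sections, contradicting injectivity since [w]
   is nonzero. *)
have Zn t : cZ (u1 t) != 0.
  apply/eqP => Z0; have [o1 B0] : exists o1, cB (~~ (o1 == o)) (u1 t) = 0.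
    have /eqP : cU (u1 t) * cV (u1 t) = 0 by rewrite E1 Z0 expr0n mulr0.
    rewrite mulf_eq0 => /orP[/eqP h|/eqP h].
      by exists o; rewrite eqxx.
    by exists (~~ o); case: (o).
  have [k k0 uE] := cu_section (E1 t) (n1 t) Z0 B0.
  have [p pv] := cu_point e s0 true t w; have [q qv] := cu_point e s0 o1 t 0.
  have pq : p = q.
    apply: (iso_inj gf); first exact: slice_of_good (gw t) pv.
      exact: slice_of_good (good_section e s0 rs o1 t) qv.
    apply: coords_inj (hS qv); apply: (coords_unscale k0); rewrite -uE; exact: fT.
  rewrite -pq in qv; have [_ _ [l l0 /(congr1 (@cZ R))]] := pvec_prop s0 (cu_neq0 _ _ _) pv qv.
  by rewrite cZZ !cZ_cu => /esym/eqP; rewrite mulf_eq0 (negbTE l0) (negbTE w0).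
have Zc t : cZ (u1 t) = cZ (u1 0) := polyf_nz_const (polyf_cZ hu1) Zn t.
set z := cZ (u1 0) in Zc; have zn : z != 0 by exact: Zn.
have hB o1 : polyf (fun t => cB o1 (u1 t)).
  by case: (o1); [exact: polyf_cV|exact: polyf_cU].
have AB t : cB (~~ o) (u1 t) * cB o (u1 t) = T t * z ^+ 2.
  by rewrite -(Zc t) -E1; case: (o) => //=; rewrite mulrC.
have ratio t k : generic t -> (forall w p, coords p (pvec s (cu true t w) t z0) ->
    coords (f p) (pvec s' (cu o (T t) (k * w)) (T t) beta)) -> k * w * cB o (u1 t) = z.
  move=> [tbad Tb t0 Tt0] hk; have Bn : cB o (u1 t) != 0.
    apply: contraTneq (mulf_neq0 Tt0 (expf_neq0 2 zn)) => B0.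
    by rewrite -AB B0 mulr0 eqxx.
  have [p pv] := cu_point e s0 true t w.
  have fv := fT _ _ pv; rewrite (cu_eta (E1 t) Bn) in fv.
  by rewrite (cu_coords_inj s0' (coords_unscale Bn fv) (hk _ _ pv)) Zc divfK.
have key t : generic t -> cj t = t ->
    z * cj z * T t = t * (w * cj w) * (cB o (u1 t) * cj (cB o (u1 t))).
  move=> gt rt; have [k k0 hk] := line_scaling gt.
  have h := scaling_conj gt rt k0 hk.
  have h2 := ratio t k gt hk; rewrite -h2 -{4}h !cjM.
  by move: (cB o (u1 t)) => B; ring.
(* [A B] has degree one, so one factor is constant; it has to be [B]. *)
have [A hA] := hB (~~ o); have [B hB'] := hB o.
have ABp : A * B = (a *: 'X + c%:P) * (z ^+ 2)%:P.
  apply: poly_ext => t; rewrite !hornerM -hA -hB' AB.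
  by rewrite hornerD hornerZ hornerX !hornerC.
have sAB : size (A * B) = 2%N.
  have z2 : z ^+ 2 != 0 by rewrite expf_neq0.
  rewrite ABp mulrC mul_polyC size_scale //.
  by rewrite -mul_polyC size_MXaddC polyC_eq0 (negbTE a0) size_polyC a0.
have nat_ext (h1 h2 : C -> C) : polyf h1 -> polyf h2 ->
    (forall t, generic t -> cj t = t -> h1 t = h2 t) -> forall t, h1 t = h2 t.
  move=> p1 p2 h; apply: (polyf_eq_nat p1 p2).
  apply: cofinitelyW cofinitely_generic => t gt [j tE]; apply: h => //.
  by rewrite tE cj_nat.
have norm0 x : x != 0 -> x * cj x != 0 by move=> x0; rewrite mulf_neq0 ?cj_eq0.
have [/eqP/size_poly1P[A0 A0n AE]|/eqP/size_poly1P[B0 B0n BE]] := const_factor sAB.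
  (* If [A] is the constant [A0], then [B] is proportional to [T] and [key] becomes
     [|A0|^2 = t |w|^2 T |z|^2]. Extended from real [t] to all [t], this fails at [t = 0]. *)
  exfalso; have BT t : A0 * cB o (u1 t) = T t * z ^+ 2.
    by rewrite -AB hA AE hornerC.
  have p2 : polyf (fun t => t * (w * cj w) * (T t * (z * cj z))).
    apply: polyfM; first by apply: polyfM.
    by apply: polyfM => //; exact: polyfT.
  suff E0 : A0 * cj A0 = 0 * (w * cj w) * (T 0 * (z * cj z)).
    by move: (norm0 _ A0n); rewrite E0 !mul0r eqxx.
  apply: (nat_ext (fun=> A0 * cj A0) _ (pc _) p2) => t gt rt; have [_ _ _ Tt0] := gt.
  have rT : cj (T t) = T t by rewrite cjD cjM ca cc rt.
  apply: (mulIf Tt0); apply: (mulfI (norm0 _ zn)).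
  have -> : z * cj z * (A0 * cj A0 * T t) = A0 * cj A0 * (z * cj z * T t) by ring.
  rewrite (key t gt rt).
  have -> : A0 * cj A0 * (t * (w * cj w) * (cB o (u1 t) * cj (cB o (u1 t)))) =
    t * (w * cj w) * ((A0 * cB o (u1 t)) * cj (A0 * cB o (u1 t))) by rewrite cjM; ring.
  by rewrite BT cjM cjX rT; ring.
have Bc t : cB o (u1 t) = B0 by rewrite hB' BE hornerC.
(* With [B] constant, [key] says that [T t] is proportional to [t], which gives [c = 0] and the norm
   of [k]. *)
have lin t : z * cj z * T t = t * ((w * cj w) * (B0 * cj B0)).
  apply: (nat_ext (fun t => z * cj z * T t) (fun t => t * ((w * cj w) * (B0 * cj B0)))).
  - by apply: polyfM => //; exact: polyfT.
  - by apply: polyfM.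
  - by move=> y gy ry; rewrite key // Bc; exact/esym/mulrA.
have c0 : c = 0.
  have /eqP := lin 0; rewrite mulr0 add0r mul0r mulf_eq0 (negbTE (norm0 _ zn)) /=.
  by move/eqP.
have wB : w * B0 != 0 by rewrite mulf_neq0.
exists (z / (w * B0)); split; [by rewrite mulf_neq0 ?invr_eq0|exact: c0| |].
  have := lin 1; rewrite c0 addr0 mulr1 mul1r => h.
  have cw : cj w != 0 by rewrite cj_eq0.
  have cB' : cj B0 != 0 by rewrite cj_eq0.
  rewrite cjM cjV cjM.
  have -> : a * (z / (w * B0) * (cj z / (cj w * cj B0))) =
    (z * cj z * a) / (w * cj w * (B0 * cj B0)) by field; rewrite cB' cw B0n w0.
  by rewrite h divff // !mulf_neq0.
move=> t gt; have [k k0 hk] := line_scaling gt.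
suff <- : k = z / (w * B0) by [].
have := ratio t k gt hk; rewrite Bc -mulrA => <-; rewrite mulfK // wB.
Qed.

(** If the image were kept, [g] would be defined there, and its limit along [w = s_j + i] would be
    the removed point itself, which is not in the slice. *)
Lemma removed_image k j : (forall t, generic t -> forall w p,
    coords p (pvec s (cu true t w) t z0) ->
    coords (f p) (pvec s' (cu o (T t) (k * w)) (T t) beta)) ->
  removed s' (cu o (T (tj R j)) (k * (s 0 j + ii))) (T (tj R j)).
Proof.
move=> hk; apply: contrapT => nr; set w := s 0 j + ii in nr *.
have pX := @polyfX C; have pc := @polyfC C.
have gd : good s' (cu o (T (tj R j)) (k * w)) (T (tj R j)) beta.
  by split=> //; [exact: cu_neq0|exact: cu_conic|exact: beta_branch].
have [q qv] := pt_ex (pvec_neq0 (T (tj R j)) beta s0' (cu_neq0 o (T (tj R j)) (k * w))).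
have Xq := slice_of_good gd qv.
have h1 := polyf_pvec (fun j => pc (s' 0 j)) (polyf_cu o polyfT (pc (k * w))) polyfT
  (fun l => pc (beta 0 l)).
have h2 := polyf_pvec (fun j => pc (s 0 j)) (polyf_cu true pX (pc w)) pX
  (fun l => pc (z0 0 l)).
have lim : coords (g q) (pvec s (cu true (tj R j) w) (tj R j) z0).
  apply: (morphism_limit hg (x0 := tj R j) h1 h2 Xq qv).
    exact: pvec_neq0 s0 (cu_neq0 _ _ _).
  apply: cofinitelyW cofinitely_generic => t gt.
  have [tb Tb _ _] := gt; have [p pv] := cu_point e s0 true t w.
  have Xp := slice_of_good (good_line true w tb) pv.
  exists (f p); split; [exact: slice_point_f|exact: hk|by rewrite gf].
have Xg : slice s (g q) by case: hg => h _; exact: h.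
have [u [t [b [gd' E]]]] := slice_coords Xg lim.
have [_ _ _ _ nr'] := gd'.
have [_ uE tE _] := pvec_inj s0 s0 (cu_neq0 _ _ _) E.
apply: nr'; rewrite -uE -tE; exists j; left; split=> //; rewrite /= !uvzE ?mulr1 //.
by rewrite expr2 mulrA.
Qed.

End Scaling.

(** * The removed points determine the parameters *)

Section RigidityConclusion.
Variable R : realType.
Local Notation C := R[i].
Local Notation RtoC := (real_complex R : {rmorphism R -> C}).
Local Notation cj := (@cj R).
Local Notation ii := (ii R).
Variables (m e : nat).
Local Notation slice := (@slice R m e).

(** [k * cj k] is a nonnegative real number. The sign of [a] prevents it from exchanging the values
    [tj j] with their conjugates. *)
Lemma positive_norm (a k : C) : cj a = a -> a * (k * cj k) = 1 ->
  exists2 r : R, a = RtoC r & 0 < r.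
Proof.
move=> /cj_fixed[r ->]; have -> : k * cj k = RtoC (complex.Re k ^+ 2 + complex.Im k ^+ 2).
  by case: (k) => x y; apply/eqP; rewrite eq_complex; apply/andP; split; apply/eqP => /=; ring.
rewrite -rmorphM -[1](rmorph1 RtoC) => /(@complexI R) E; exists r => //.
have : 0 <= complex.Re k ^+ 2 + complex.Im k ^+ 2 by rewrite addr_ge0 ?sqr_ge0.
by move: (_ + _) E => v E v0; rewrite -(pmulr_lgt0 _ (_ : 0 < v)) ?E ?ltr01 //
  lt_neqAle v0 andbT; apply: contra_eq_neq E => <-; rewrite mulr0 eq_sym oner_neq0.
Qed.

Lemma slice_rigid (s s' : 'rV[C]_(1 + m)) : s 0 0 = 1 -> s' 0 0 = 1 ->
  real_row s -> real_row s' -> isomorphic RtoC (slice s) (slice s') -> s = s'.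
Proof.
move=> s0 s0' rs rs' [f [g [hf hg gf fg]]].
have [a [c [beta [a0 [ca cc] hbeta hF hG]]]] := iso_base s0 s0' rs rs' hf hg gf.
have [o hS] := section_image s0 s0' rs rs' hf gf a0 ca cc hbeta hF.
have [k [k0 c0 ak hk]] := iso_scaling s0 s0' rs rs' hf hg gf fg a0 ca cc hbeta hF hG hS.
have rem j := removed_image s0 s0' rs hf hg gf a0 hF j hk.
rewrite c0 in rem; have {}rem j : removed s' (cu o (a * tj R j) (k * (s 0 j + ii))) (a * tj R j).
  by have := rem j; rewrite addr0.
have [r aE r0] := positive_norm ca ak.
have tjE (j : 'I_(1 + m)) : exists2 l : 'I_(1 + m), r * j.+1%:R = l.+1%:R & True.
  have [l [[h _ _]|[h _ _]]] := rem j; exists l => //.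
    apply: (@complexI R); apply: (mulIf (ii_neq0 R)).
    by rewrite rmorphM !rmorph_nat -aE -mulrA.
  exfalso; have : r * j.+1%:R = - l.+1%:R.
    apply: (@complexI R); apply: (mulIf (ii_neq0 R)).
    by rewrite rmorphM rmorphN !rmorph_nat -aE -mulrA mulNr.
  move=> E; have : 0 < r * j.+1%:R by rewrite mulr_gt0 // ltr0Sn.
  by rewrite E oppr_gt0 ltNge ler0n.
(* The largest index gives [r <= 1], the smallest gives [r >= 1]. *)
have r1 : r = 1.
  apply/eqP; rewrite eq_le; apply/andP; split.
    have [l E _] := tjE (@ord_max m).
    have : r * m.+1%:R <= 1 * m.+1%:R by rewrite E mul1r ler_nat; exact: (ltn_ord l).
    by rewrite ler_pM2r // ltr0Sn.
  by have [l E _] := tjE 0; move: E; rewrite mulr1 => ->; rewrite ler1n.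
have a1 : a = 1 by rewrite aE r1 rmorph1.
(* With [a = 1] the value of [t] is kept, so the index is kept too, and [tj_neqN] rules out the
   conjugate kind. *)
have rem1 j : removed1 s' (cu o (tj R j) (k * (s 0 j + ii))) (tj R j) j.
  have := rem j; rewrite a1 mul1r => -[l [h|[h _ _]]].
    by have [/tj_inj jl _ _] := h; rewrite -jl in h.
  by have := tj_neqN R j l; rewrite h eqxx.
have kk : k * cj k = 1 by move: ak; rewrite a1 mul1r.
have w0 : 1 + ii != 0 by rewrite real_add_ii ?cj1.
case: o {hS hk rem} rem1 => rem1.
  have k1 : k = 1.
    have [_ + _] := rem1 0; rewrite /= !uvzE s0 s0' mulr1 => /eqP.
    by rewrite -subr_eq0 -[X in _ - X]mul1r -mulrBl mulf_eq0 (negbTE w0) orbF subr_eq0 => /eqP.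
  apply/rowP => j; have [_ + _] := rem1 j; rewrite /= !uvzE k1 mul1r mulr1.
  exact: addIr.
(* f exchanges u and v: then the removed point over tj 0 gives 2 |k| = 1. *)
exfalso; have [_ _] := rem1 0; rewrite /= !uvzE s0 s0' /tj mul1r.
have w2 : (1 + ii) * (1 + ii) = 2 * ii.
  by rewrite mulrDl !mulrDr mulii; ring.
have -> : ii * (1 + ii) * (k * (1 + ii)) = k * ii * ((1 + ii) * (1 + ii)) by ring.
rewrite w2 mulrCA -mulrA mulii mulrN1 mulrN => E.
have := congr1 (fun x => x * cj x) E.
rewrite cj1 mulr1 cjN cjM cj_nat mulrNN.
have -> : 2 * k * (2 * cj k) = 4 * (k * cj k) by ring.
rewrite kk mulr1 => /eqP; rewrite -[1]/(1%:R) eqr_nat.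
by [].
Qed.

End RigidityConclusion.

Section Fibres.
Variable R : realType.
Local Notation C := R[i].
Local Notation RtoC := (real_complex R : {rmorphism R -> C}).
Variable m : nat.

Lemma rational_affine_coords (p : pt C (1 + m)) :
  rational_points RtoC (affine_space C m) p ->
  exists2 r : 'rV[R]_(1 + m), r 0 0 = 1 & coords p (map_mx RtoC r).
Proof.
move=> [Ap [v pv]]; have v0 : v 0 0 != 0.
  have /(affineP pv) := Ap; rewrite mxE (_ : lshift m 0 = 0) ?fmorph_eq0 //.
  exact: val_inj.
exists ((v 0 0)^-1 *: v); first by rewrite mxE mulVf.
rewrite map_mxZ; apply: coordsZ pv.
by rewrite fmorph_eq0 invr_eq0.
Qed.

Lemma real_row_map (r : 'rV[R]_(1 + m)) : real_row (map_mx RtoC r).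
Proof. by move=> j; rewrite mxE cj_real. Qed.

Lemma slice_birationally_diffeomorphic e (r : 'rV[R]_(1 + m)) : r 0 0 = 1 ->
  birationally_diffeomorphic (slice (e := e) (map_mx RtoC r)) (affine_space C (2 + e)).
Proof.
move=> r0; have s0 : (map_mx RtoC r) 0 0 = 1 by rewrite mxE r0 rmorph1.
split.
- split; last exact: slice_rational_point.
    by split; [exact: slice_quasi_projective|exact: slice_irreducible].
  by move=> p Xp; exists (2 + e)%N; exact: (slice_smooth s0).
- split; [exact: affine_real_variety| |exact: affine_rational_point].
  by move=> p Ap; exists (2 + e)%N; exact: (affine_smooth Ap).
have [f [g fg]] := chart_maps e r0.
exists (slice_chart_set r), f, (affine_chart_set r), g.
by split; [exact: fg|exact: rational_slice_chart|exact: rational_affine_chart].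
Qed.

End Fibres.

Theorem theorem4 (R : realType) (d m : nat) (hd : (2 <= d)%N) (hm : (1 <= m)%N) :
  exists (N K : nat) (X : set (pt R[i] N)) (XX : set (pt R[i] K))
    (h : pt R[i] K -> pt R[i] (1 + m)) (theta : pt R[i] K -> pt R[i] ((1 + m) * N)),
  [/\ [/\ real_variety X, smooth_of_dim d X & rational_of_dim d X],
      relative_real_form X (affine_space R[i] m) XX h theta,
      forall s, rational_points (real_complex R) (affine_space R[i] m) s ->
        real_form X (fibre XX h s),
      forall s t, rational_points (real_complex R) (affine_space R[i] m) s ->
        rational_points (real_complex R) (affine_space R[i] m) t -> s <> t ->
        ~ isomorphic (real_complex R) (fibre XX h s) (fibre XX h t) &
      forall s, rational_points (real_complex R) (affine_space R[i] m) s ->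
        birationally_diffeomorphic (fibre XX h s) (affine_space R[i] d)].
Proof.
have [e ->] : exists e, d = (2 + e)%N by exists (d - 2)%N; rewrite subnKC.
(* The reference variety is the slice at [s = (1, ..., 1)]; any real point would serve. *)
pose r1 : 'rV[R]_(1 + m) := const_mx 1.
have r10 : r1 0 0 = 1 by rewrite mxE.
have map1 (r : 'rV[R]_(1 + m)) : r 0 0 = 1 -> (map_mx (real_complex R) r) 0 0 = 1.
  by move=> r0; rewrite mxE r0 rmorph1.
have [h [theta [form fibE]]] := relative_form_ex e (map1 _ r10).
exists (3 * ((1 + m) + (1 + e)))%N, (3 * ((1 + m) + (1 + e)))%N.
exists (slice (e := e) (map_mx (real_complex R) r1)), (total_space (e := e)), h, theta.
split=> //.
- split; [|exact: slice_smooth (map1 _ r10)|exact: slice_rational].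
  by split; [exact: slice_quasi_projective|exact: slice_irreducible (map1 _ r10)].
- move=> s /rational_affine_coords[r r0 sr]; rewrite (fibE _ _ (map1 _ r0) sr); split.
    exact: slice_quasi_projective.
  exact: slice_isomorphic (map1 _ r0) (map1 _ r10).
- move=> s t /rational_affine_coords[r r0 sr] /rational_affine_coords[r' r0' tr'].
  rewrite (fibE _ _ (map1 _ r0) sr) (fibE _ _ (map1 _ r0') tr') => st iso; apply: st.
  have E := slice_rigid (map1 _ r0) (map1 _ r0') (real_row_map r) (real_row_map r') iso.
  by apply: coords_inj sr _; rewrite E.
- move=> s /rational_affine_coords[r r0 sr]; rewrite (fibE _ _ (map1 _ r0) sr).
  exact: slice_birationally_diffeomorphic.
Qed.
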